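(* Let $0<a_1,a_2<1$ and $0<t_1<t_2$, and let $u_0\in L^2(a_1,1)$, $\widetilde u_0\in L^2(a_2,1)$. Let $u^{a_1}$ and $u^{a_2}$ be the solutions of $$\partial_t u-\partial_x((x-a)\partial_x u)=0 \ \text{ in } (a,1)\times(0,\infty),\quad u(1,t)=0,\quad (x-a)\partial_x u(x,t)\big|_{x=a}=0$$ with $a=a_1$ and initial value $u_0$, and with $a=a_2$ and initial value $\widetilde u_0$, respectively. Assume that $$U_1^0(a_1):=\int_0^{j_1}u_0\Big(a_1+(1-a_1)\frac{s^2}{j_1^2}\Big)sJ_0(s)\,ds\neq0,\qquad \widetilde U_1^0(a_2):=\int_0^{j_1}\widetilde u_0\Big(a_2+(1-a_2)\frac{s^2}{j_1^2}\Big)sJ_0(s)\,ds\neq0 .$$ If $\partial_xu^{a_1}(1,t)=\partial_xu^{a_2}(1,t)$ for $t_1<t<t_2$, then $a_1=a_2$ and $u_0=\widetilde u_0$.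
   Context: $J_0(z)=\sum_{k\ge0}\frac{(-1)^k}{(k!)^2}(z/2)^{2k}$ is the Bessel function of the first kind of order $0$ and $j_1$ is its smallest positive zero. The solution with initial value $v\in L^2(a,1)$ is $e^{tA}v$, where $A u=\partial_x((x-a)\partial_x u)$ on $L^2(a,1)$ has domain consisting of those $u\in L^2(a,1)$ with $\int_a^1(x-a)|\partial_xu|^2dx<\infty$, $u(1)=0$ and $(x-a)\partial_x u\in H^1(a,1)$. $A$ generates an analytic contraction semigroup; for $t>0$ the equation and boundary conditions hold classically. *)

(* Defs.v *)
From HB Require Import structures.
From mathcomp Require Import all_boot all_order all_algebra.
From mathcomp Require Import all_classical all_reals all_analysis.
Set Implicit Arguments.
Unset Strict Implicit.
Unset Printing Implicit Defensive.
Import Order.TTheory GRing.Theory Num.Theory.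
Import numFieldNormedType.Exports.
Local Open Scope classical_set_scope.
Local Open Scope ring_scope.

Definition besselJ0 (R : realType) (z : R) : R :=
  limn (series (fun k : nat =>
    (-1) ^+ k / (k`!%:R) ^+ 2 * (z / 2) ^+ (2 * k)%N)).

Definition smallest_positive_zero (R : realType) (f : R -> R) (j : R) : Prop :=
  [/\ 0 < j, f j = 0 & forall z, 0 < z -> z < j -> f z != 0].

(* Functions on (a, 1) are represented by functions on the whole line; the
   restricted measure makes their values outside of (a, 1) irrelevant. *)
Definition leb (R : realType) (a : R) :
    {measure set (measurableTypeR R) -> \bar R} :=
  mrestr (@lebesgue_measure R) (measurable_itv `]a, 1[).

Definition L2 (R : realType) (a : R) : {pred R -> R} := Lfun (leb a) 2%:E.

Definition L2norm (R : realType) (a : R) (f : R -> R) : \bar R :=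
  'N[leb a]_2%:E[EFin \o f]%E.

(* Class C^1 with compact support is the usual choice of test functions for
   Sobolev spaces on an interval; C^oo test functions define the same weak
   derivatives. *)
Definition test_function (R : realType) (a : R) (phi : R -> R) : Prop :=
  [/\ forall x, derivable phi x 1,
      continuous (derive1 phi) &
      exists K : set R, [/\ compact K, K `<=` `]a, 1[ &
                            forall x, ~ K x -> phi x = 0]].

Definition weak_derivative (R : realType) (a : R) (u g : R -> R) : Prop :=
  [/\ locally_integrable `]a, 1[ u,
      locally_integrable `]a, 1[ g &
      forall phi, test_function a phi ->
        \int[lebesgue_measure]_(x in `]a, 1[) (u x * derive1 phi x) =
        - \int[lebesgue_measure]_(x in `]a, 1[) (g x * phi x)].

(* [H1 a w f]: w belongs to H^1(a, 1) and f is its weak derivative. *)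
Definition H1 (R : realType) (a : R) (w f : R -> R) : Prop :=
  [/\ w \in L2 a, f \in L2 a & weak_derivative a w f].

(* [continuous_version a u w]: w is the representative of the class of u that
   is continuous up to the end point 1; its values on (a, 1] are determined by
   the class of u. *)
Definition continuous_version (R : realType) (a : R) (u w : R -> R) : Prop :=
  {within `]a, 1], continuous w} /\ w = u %[ae leb a].

(* The graph of A: u belongs to the domain of A and A u = f. *)
Definition opA (R : realType) (a : R) (u f : R -> R) : Prop :=
  u \in L2 a /\
  exists g : R -> R,
    [/\ weak_derivative a u g,
        (\int[lebesgue_measure]_(x in `]a, 1%R[)
           ((x - a) * `|g x| ^+ 2)%:E < +oo)%E,
        exists2 w, continuous_version a u w & w 1 = 0 &
        H1 a (fun x => (x - a) * g x) f].

(* S is a strongly continuous contraction semigroup on L^2(a, 1) whose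
   infinitesimal generator is A; the generator determines it up to equality
   almost everywhere. *)
Definition semigroup_generated_by_A (R : realType) (a : R)
    (S : R -> (R -> R) -> (R -> R)) : Prop :=
  [/\ forall t f, 0 <= t -> f \in L2 a ->
        S t f \in L2 a /\ (L2norm a (S t f) <= L2norm a f)%E,
      forall t (c : R) f g, 0 <= t -> f \in L2 a -> g \in L2 a ->
        S t (fun x => c * f x + g x) =
          (fun x => c * S t f x + S t g x) %[ae leb a],
      (forall f, f \in L2 a -> S 0 f = f %[ae leb a]) /\
      (forall s t f, 0 <= s -> 0 <= t -> f \in L2 a ->
        S (s + t) f = S s (S t f) %[ae leb a]),
      forall f, f \in L2 a ->
        L2norm a (fun x => S t f x - f x) @[t --> 0^'+] --> 0%E &
      forall f g, f \in L2 a -> g \in L2 a ->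
        (opA a f g <->
         L2norm a (fun x => (S t f x - f x) / t - g x) @[t --> 0^'+] --> 0%E)].

(* u t x is the value at (x, t) of e^{tA} v, taken in the continuous version. *)
Definition solution (R : realType) (a : R) (v : R -> R) (u : R -> R -> R) :
    Prop :=
  exists2 S, semigroup_generated_by_A a S &
    forall t, 0 < t -> continuous_version a (S t v) (u t).

Definition left_derivative (R : realType) (f : R -> R) (x : R) : R :=
  lim ((f (x + h) - f x) / h @[h --> 0^'-]).

Definition U1 (R : realType) (j1 a : R) (v : R -> R) : R :=
  \int[lebesgue_measure]_(s in `]0, j1[)
    (v (a + (1 - a) * (s ^+ 2 / j1 ^+ 2)) * s * besselJ0 s).

(* Main.v *)
Require Import Defs.
From HB Require Import structures.
From mathcomp Require Import all_boot all_order all_algebra.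
From mathcomp Require Import all_classical all_reals all_analysis measurable_realfun.
From mathcomp Require Import ring lra.
Import Order.TTheory GRing.Theory Num.Theory.
Import numFieldNormedType.Exports.
Local Open Scope classical_set_scope.
Local Open Scope ring_scope.

(** The measured flux drives the moments of the solution through a triangular
recursion, and this recursion cancels the flux when two solutions are compared.

Put p_k(x) = (x - a)^k / k!^2, so that A p_0 = 0 and A p_(k+1) = p_k.
Integrating by parts, the moments m_k(t) = (1 - a)^(-1) <u(t), p_k> satisfy
m_k' = m_(k-1) + q p_k(1) for t > 0, where q(t) is the flux u_x(1, t) and
m_(-1) = 0 [moment_derive].  Take two solutions with the same flux on (t1, t2),
let m1, m2 be their moments and d1_k, d2_k the values p_k(1) for a1, a2.  In
e_k = sum_j (m1_j d2_(k-j) - m2_j d1_(k-j)) the two terms containing q are equal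
by the symmetry of convolution, so e_k' = e_(k-1).  As moreover
|e_k| <= C 4^k / k!^2 on the whole interval, all e_k vanish: e_0 is constant,
it is a k-th derivative of e_k, and the k-th finite difference of a function
that small is too small for a nonzero constant [chain_zero, cross_zero].
Hence, for the entire functions N_i(s) = sum m_i,k s^k and
D_i(s) = sum d_i,k s^k, we have N_1 D_2 = N_2 D_1 [entire_mul].

Let psi_s = sum_k s^k p_k.  Then A psi_s = s psi_s, psi_s(1) = D(s) and
D(s) = J_0(z) when z^2 = - 4 s (1 - a) [psi_bessel].  Choose s with
D_1(s) = J_0(j_1) = 0.  Then psi_s is an eigenfunction, so <u(t), psi_s> =
exp(s t) <u_0, psi_s>, and this is nonzero because, after the substitution
x = a + (1 - a) s^2 / j_1^2, the hypothesis on the initial value says that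
<u_0, psi_s> is nonzero [psi_initial, U1_psi].  Hence N_1(s) is nonzero, so
D_2(s) = 0, that is, J_0 vanishes at j_1 sqrt((1 - a2) / (1 - a1)).  Since j_1 is
the smallest positive zero, a2 <= a1; by symmetry a1 = a2 [zero_comparison].
Now D_1 = D_2 has constant term 1, so all moments of the two solutions agree on
(t1, t2).  The difference of the solutions is continuous on (a, 1] with vanishing
moments, hence zero [moments_zero], and backward uniqueness for the semigroup
gives the equality of the initial values [sg_backward].

The semigroup is known only through its generator, so the facts used about it
have to be derived.  The inverse of - A is the explicit operator
K h = P q(1) - P q with q = P h / (x - a), where P f(x) is the integral of f over
(a, x); it is symmetric, and the graph of A is exactly that of - K^(-1)
[opA_Kop, opA_inv].  From the symmetry of K alone one obtains, in an abstract
inner product space, that the semigroup is symmetric and unique [sg_sym,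
sg_unique] and injective [sg_backward], and, when the space is complete, that it
maps into the range of K at positive times [sg_smoothing] and is differentiable
there [sg_derive].  To use this, L^2(a, 1) is realised as a vector space of
classes and its completeness is proved. *)

(** * Inner products on real vector spaces *)

Lemma le0_eps (R : realType) (x : R) : (forall e, 0 < e -> x <= e) -> x <= 0.
Proof. by move=> H; rewrite leNgt; apply/negP => x0; have := H (x / 2); lra. Qed.

Record innerProduct (R : realType) (V : lmodType R) := InnerProduct {
  ip :> V -> V -> R;
  ipC : forall x y, ip x y = ip y x;
  ip_linear : forall c x y z, ip (c *: x + y) z = c * ip x z + ip y z;
  ip_ge0 : forall x, 0 <= ip x x;
  ip_eq0 : forall x, ip x x = 0 -> x = 0 }.

Arguments ip {R V} _ _ _.
Arguments ipC {R V} _ _ _.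
Arguments ip_linear {R V} _ _ _ _ _.
Arguments ip_ge0 {R V} _ _.
Arguments ip_eq0 {R V} _ [x] _.

Section Norm.
Variables (R : realType) (V : lmodType R) (h : innerProduct R V).
Implicit Types (x y z : V) (c e : R).

Definition ipnorm x : R := Num.sqrt (h x x).
Local Notation N := ipnorm.

Lemma ipDl x y z : h (x + y) z = h x z + h y z.
Proof. by rewrite -{1}(scale1r x) ip_linear mul1r. Qed.

Lemma ip0l z : h 0 z = 0.
Proof. by apply: (addrI (h 0 z)); rewrite -ipDl !addr0. Qed.

Lemma ipZl c x z : h (c *: x) z = c * h x z.
Proof. by rewrite -(addr0 (c *: x)) ip_linear ip0l addr0. Qed.

Lemma ipNl x z : h (- x) z = - h x z.
Proof. by rewrite -scaleN1r ipZl mulN1r. Qed.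

Lemma ipBl x y z : h (x - y) z = h x z - h y z.
Proof. by rewrite ipDl ipNl. Qed.

Lemma ipDr x y z : h z (x + y) = h z x + h z y.
Proof. by rewrite ipC ipDl !(ipC _ z). Qed.

Lemma ipZr c x z : h z (c *: x) = c * h z x.
Proof. by rewrite ipC ipZl (ipC _ z). Qed.

Lemma ipNr x z : h z (- x) = - h z x.
Proof. by rewrite ipC ipNl (ipC _ z). Qed.

Lemma ipBr x y z : h z (x - y) = h z x - h z y.
Proof. by rewrite ipDr ipNr. Qed.

Lemma ip_ext x y : (forall z, h x z = h y z) -> x = y.
Proof.
move=> e; apply/eqP; rewrite -subr_eq0; apply/eqP/(ip_eq0 h).
by rewrite ipBl e subrr.
Qed.

Lemma ipnorm_ge0 x : 0 <= N x.
Proof. exact: sqrtr_ge0. Qed.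

Lemma sqr_ipnorm x : N x ^+ 2 = h x x.
Proof. by rewrite sqr_sqrtr // ip_ge0. Qed.

Lemma ipnorm_le x c : 0 <= c -> h x x <= c ^+ 2 -> N x <= c.
Proof.
by move=> c0 xc; rewrite -(ger0_norm c0) -sqrtr_sqr ler_sqrt // sqr_ge0.
Qed.

Lemma cauchy_schwarz x y : `|h x y| <= N x * N y.
Proof.
have pos t : 0 <= h x x - 2 * t * h x y + t ^+ 2 * h y y.
  have := ip_ge0 h (x - t *: y).
  rewrite ipBl !ipBr !ipZl !ipZr (ipC h y x); congr (_ <= _); ring.
rewrite -ler_sqr ?nnegrE ?normr_ge0 ?mulr_ge0 ?ipnorm_ge0 //.
rewrite real_normK ?num_real // exprMn !sqr_ipnorm.
have [y0|y0] := eqVneq (h y y) 0.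
  rewrite y0 mulr0.
  have [->|c0] := eqVneq (h x y) 0; first by rewrite expr0n.
  (* The quadratic polynomial is affine here, so it takes the value -1. *)
  have := pos ((h x x + 1) / (2 * h x y)).
  rewrite y0 mulr0 addr0 (_ : 2 * _ * _ = h x x + 1); first by lra.
  by field.
have yy : 0 < h y y by rewrite lt_neqAle eq_sym y0 ip_ge0.
have := pos (h x y / h y y).
rewrite (_ : _ + _ = h x x - h x y ^+ 2 / h y y); last by field.
by rewrite subr_ge0 ler_pdivrMr.
Qed.

Lemma ipnormD x y : N (x + y) <= N x + N y.
Proof.
apply: ipnorm_le; first by rewrite addr_ge0 ?ipnorm_ge0.
rewrite ipDl !ipDr sqrrD !sqr_ipnorm (ipC h y x).
have := le_trans (ler_norm _) (cauchy_schwarz x y); lra.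
Qed.

Lemma ipnormZ c x : N (c *: x) = `|c| * N x.
Proof. by rewrite /ipnorm ipZl ipZr mulrA -expr2 sqrtrM ?sqr_ge0 // sqrtr_sqr. Qed.

Lemma ipnormN x : N (- x) = N x.
Proof. by rewrite -scaleN1r ipnormZ normrN1 mul1r. Qed.

Lemma ipnormB x y : N (x - y) = N (y - x).
Proof. by rewrite -ipnormN opprB. Qed.

Lemma ler_ip_dist x y z : N (x - z) <= N (x - y) + N (y - z).
Proof. by rewrite -{1}(subrKA y) ipnormD. Qed.

Lemma ipnorm0 : N 0 = 0.
Proof. by rewrite /ipnorm ip0l sqrtr0. Qed.

Lemma ipnorm_eq0 x : N x <= 0 -> x = 0.
Proof.
move=> x0; apply: (ip_eq0 h); rewrite -sqr_ipnorm.
have -> : N x = 0 by apply/le_anti; rewrite x0 ipnorm_ge0.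
by rewrite expr0n.
Qed.

Lemma ipnorm_eq0P x : (forall e, 0 < e -> N x <= e) -> x = 0.
Proof. by move=> xe; apply: ipnorm_eq0; apply: le0_eps => e /xe. Qed.

Lemma le_ip_bound x y c e : N x <= c -> N y <= e -> `|h x y| <= c * e.
Proof.
by move=> xc ye; apply: le_trans (cauchy_schwarz _ _) _; rewrite ler_pM ?ipnorm_ge0.
Qed.

Definition ip_complete := forall u : nat -> V,
  (forall e, 0 < e -> exists n0, forall m n, (n0 <= m)%N -> (n0 <= n)%N ->
     N (u m - u n) <= e) ->
  exists l, forall e, 0 < e -> exists n0, forall n, (n0 <= n)%N -> N (u n - l) <= e.

Definition right_lim0 (F : R -> V) (l : V) := forall e, 0 < e ->
  exists2 d, 0 < d & forall t, 0 < t -> t < d -> N (F t - l) <= e.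

End Norm.

Arguments ipnorm {R V} h x.
Arguments ip_ext {R V} h {x y}.
Arguments ipnorm_ge0 {R V} h x.
Arguments ler_ip_dist {R V} h x y z.
Arguments ipnormD {R V h} x y.
Arguments ipDl {R V h}.
Arguments ip0l {R V h}.
Arguments ipZl {R V h}.
Arguments ipNl {R V h}.
Arguments ipBl {R V h}.
Arguments ipDr {R V h}.
Arguments ipZr {R V h}.
Arguments ipNr {R V h}.
Arguments ipBr {R V h}.
Arguments sqr_ipnorm {R V h}.
Arguments ipnormN {R V h}.
Arguments ipnormZ {R V h}.
Arguments ipnormB {R V h}.
Arguments ipnorm0 {R V h}.
Arguments ipnorm_eq0P {R V h x}.
Arguments le_ip_bound {R V h x y c e}.
Arguments right_lim0 {R V} h F l.
Arguments ip_complete {R V} h.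

(** The usual proof that a function with zero derivative is constant, in a uniform
form that can be applied to matrix coefficients of semigroups, whose
difference quotients are controlled uniformly in time. *)
Lemma eps_flat_const (R : realType) (f : R -> R) (t : R) : 0 <= t ->
  (forall e, 0 < e -> exists2 d, 0 < d & forall r s, 0 <= r <= t -> 0 <= s <= t ->
     `|r - s| < d -> `|f r - f s| <= e * `|r - s|) ->
  f t = f 0.
Proof.
rewrite le_eqVlt => /predU1P[<- //|t0 H].
apply/eqP; rewrite -subr_eq0 -normr_le0; apply: le0_eps => e e0.
have [d d0 Hd] := H (e / t) (divr_gt0 e0 t0).
(* Cut [0, t] into n steps shorter than d, each of them contributing at most e / n. *)
pose n := (Num.bound (t / d)).+1.
have n0 : 0 < n%:R :> R by rewrite ltr0n.
have tn : t / n%:R < d.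
  rewrite ltr_pdivrMr // mulrC -ltr_pdivrMr //.
  apply: lt_trans (_ : (Num.bound (t / d))%:R < _); last by rewrite ltr_nat.
  by have := archi_boundP (ltW (divr_gt0 t0 d0)).
pose x k := k%:R * (t / n%:R).
have step k : (k < n)%N -> `|f (x k.+1) - f (x k)| <= e / n%:R.
  move=> kn.
  have xk j : (j <= n)%N -> 0 <= x j <= t.
    move=> jn; rewrite /x mulr_ge0 ?divr_ge0 ?ler0n ?(ltW t0) //=.
    rewrite mulrCA ger_pMr // ler_pdivrMr // mul1r ler_nat //.
  have dx : x k.+1 - x k = t / n%:R by rewrite /x -mulrBl -natrB // subSnn mul1r.
  have := Hd (x k.+1) (x k) (xk _ kn) (xk _ (ltnW kn)).
  rewrite dx ger0_norm ?divr_ge0 ?(ltW t0) ?ler0n // => /(_ tn) /le_trans; apply.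
  by rewrite mulrA divfK ?gt_eqF.
have -> : f t - f 0 = \sum_(0 <= k < n) (f (x k.+1) - f (x k)).
  by rewrite telescope_sumr // /x mul0r mulrC divfK // gt_eqF.
apply: le_trans (ler_norm_sum _ _ _) _.
rewrite big_nat; apply: (@le_trans _ _ (\sum_(0 <= k < n) (e / n%:R))).
  rewrite [leRHS]big_nat; apply: ler_sum => k /andP[_ kn]; exact: step.
by rewrite sumr_const_nat subn0 -[X in X <= _]mulr_natr divfK // gt_eqF.
Qed.

Section Semigroup.
Variables (R : realType) (V : lmodType R) (h : innerProduct R V) (K : V -> V).
Local Notation N := (ipnorm h).
Implicit Types (x y z : V) (c e s t : R).

(** The last field says that the generator is - K^(-1): - K y is in its domain, with
image y, and every element of the domain has this form. *)
Record is_semigroup (S : R -> V -> V) : Prop := {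
  sgL : forall t c x y, 0 <= t -> S t (c *: x + y) = c *: S t x + S t y;
  sgN : forall t x, 0 <= t -> N (S t x) <= N x;
  sg0 : forall x, S 0 x = x;
  sgD : forall s t x, 0 <= s -> 0 <= t -> S (s + t) x = S s (S t x);
  sgC : forall x, right_lim0 h (fun t => S t x) x;
  sgG : forall x y, x = - K y <->
          right_lim0 h (fun t => t^-1 *: (S t x - x)) y }.

Arguments sgL {S} _ t c x y _.
Arguments sgN {S} _ t x _.
Arguments sg0 {S} _ x.
Arguments sgD {S} _ s t x _ _.
Arguments sgC {S} _ x e _.
Arguments sgG {S} _ x y.

Hypothesis Ksym : forall x y, h (K x) y = h x (K y).

Lemma symD x y : K (x + y) = K x + K y.
Proof. by apply: (ip_ext h) => z; rewrite Ksym !ipDl !Ksym. Qed.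

Lemma symZ c x : K (c *: x) = c *: K x.
Proof. by apply: (ip_ext h) => z; rewrite Ksym !ipZl Ksym. Qed.

Lemma symN x : K (- x) = - K x.
Proof. by rewrite -scaleN1r symZ scaleN1r. Qed.

Lemma symB x y : K (x - y) = K x - K y.
Proof. by rewrite symD symN. Qed.

Section One.
Variable S : R -> V -> V.
Hypothesis HS : is_semigroup S.

Lemma sgDl t x y : 0 <= t -> S t (x + y) = S t x + S t y.
Proof. by move=> t0; rewrite -{1}(scale1r x) (sgL HS) // scale1r. Qed.

Lemma sg_zero t : 0 <= t -> S t 0 = 0.
Proof. by move=> t0; apply: (addrI (S t 0)); rewrite -sgDl // !addr0. Qed.

Lemma sgZ t c x : 0 <= t -> S t (c *: x) = c *: S t x.
Proof. by move=> t0; rewrite -(addr0 (c *: x)) (sgL HS) // sg_zero // addr0. Qed.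

Lemma sgNl t x : 0 <= t -> S t (- x) = - S t x.
Proof. by move=> t0; rewrite -scaleN1r sgZ // scaleN1r. Qed.

Lemma sgB t x y : 0 <= t -> S t (x - y) = S t x - S t y.
Proof. by move=> t0; rewrite sgDl // sgNl. Qed.

(** By the semigroup law and contractivity, continuity at 0 of one orbit gives
uniform continuity of that orbit. *)
Lemma sg_ucont x e : 0 < e -> exists2 d, 0 < d & forall s t, 0 <= s -> 0 <= t ->
  `|s - t| < d -> N (S s x - S t x) <= e.
Proof.
move=> e0; have [d d0 H] := sgC HS x e e0; exists d => // s t s0 t0.
wlog st : s t s0 t0 / s <= t => [W|].
  case: (leP s t) => [|/ltW] st; first exact: W.
  by rewrite distrC ipnormB; exact: W.
move: st; rewrite le_eqVlt => /predU1P[->|st] dst.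
  by rewrite subrr ipnorm0 ltW.
have {1}-> : t = s + (t - s) by rewrite addrC subrK.
rewrite ipnormB (sgD HS) ?subr_ge0 ?(ltW st) // -sgB //.
apply: le_trans (sgN HS _ _ s0) _; apply: H; rewrite ?subr_gt0 //.
by rewrite -(gtr0_norm (_ : 0 < t - s)) ?subr_gt0 // distrC.
Qed.

(** K commutes with S because S commutes with its generator, and the generator
is - K^(-1). *)
Lemma sgK s x : 0 <= s -> S s (K x) = K (S s x).
Proof.
move=> s0.
have /(sgG HS) H : K x = - K (- x) by rewrite symN opprK.
suff /(sgG HS) : right_lim0 h (fun t => t^-1 *: (S t (S s (K x)) - S s (K x))) (- S s x).
  by rewrite symN opprK.
move=> e e0; have [d d0 Hd] := H e e0; exists d => // t t0 td.
rewrite -(sgD HS) ?(ltW t0) // (addrC t) (sgD HS) ?(ltW t0) // -sgB // -sgZ // -sgNl // -sgB //.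
exact: le_trans (sgN HS _ _ s0) (Hd t t0 td).
Qed.

(** Orbits starting in the range of K are uniformly differentiable: the
derivative of t |-> S t (K x) is - S t x. *)
Lemma sg_udiff x e : 0 < e -> exists2 d, 0 < d & forall s t, 0 <= s -> 0 <= t ->
  `|s - t| < d -> N (S s (K x) - S t (K x) + (s - t) *: S t x) <= e * `|s - t|.
Proof.
move=> e0; have e20 : 0 < e / 2 by rewrite divr_gt0.
have /(sgG HS) /(_ _ e20) [d1 d10 H1] : K x = - K (- x) by rewrite symN opprK.
have [d2 d20 H2] := sg_ucont x _ e20.
have H r : 0 <= r -> r < d1 -> N (S r (K x) - K x + r *: x) <= e / 2 * r.
  rewrite le_eqVlt => /predU1P[<- _|r0 rd].
    by rewrite (sg0 HS) subrr scale0r addr0 ipnorm0 mulr0.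
  have -> : S r (K x) - K x + r *: x = r *: (r^-1 *: (S r (K x) - K x) - - x).
    by rewrite opprK scalerDr scalerA mulfV ?gt_eqF // scale1r.
  by rewrite ipnormZ gtr0_norm // mulrC ler_pM2r // H1.
exists (Num.min d1 d2); first by rewrite lt_min d10.
move=> s t s0 t0; rewrite lt_min => /andP[st1 st2].
case: (leP t s) => st.
  have r0 : 0 <= s - t by rewrite subr_ge0.
  rewrite (ger0_norm r0) in st1 *.
  have {1}-> : s = t + (s - t) by rewrite addrC subrK.
  rewrite (sgD HS) // -sgB // -sgZ // -sgDl //.
  apply: le_trans (sgN HS _ _ t0) (le_trans (H _ r0 st1) _).
  by rewrite ler_wpM2r // ler_pdivrMr // ler_peMr ?(ltW e0) // ler1n.
have r0 : 0 <= t - s by rewrite subr_ge0 ltW.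
rewrite distrC (ger0_norm r0) in st1 st2 *.
have -> : S s (K x) - S t (K x) + (s - t) *: S t x =
   - (S s (S (t - s) (K x) - K x + (t - s) *: x) + (t - s) *: (S t x - S s x)).
  rewrite sgDl // sgB // -(sgD HS) // sgZ // subrKC.
  by apply: (ip_ext h) => z; rewrite !(ipDl, ipNl, ipZl); ring.
rewrite ipnormN; apply: le_trans (ipnormD _ _) _.
have -> : e * (t - s) = e / 2 * (t - s) + (t - s) * (e / 2) by field.
apply: lerD.
  exact: le_trans (sgN HS _ _ s0) (H _ r0 st1).
by rewrite ipnormZ ger0_norm // ler_wpM2l // H2 // ger0_norm.
Qed.

(** The difference quotients of t |-> S t (K x) at 0 converge to - x, and each of
them is in the range of K. *)
Lemma range_dense x e : 0 < e -> exists y, N (x - K y) <= e.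
Proof.
move=> e0.
have /(sgG HS) /(_ _ e0) [d d0 Hd] : K x = - K (- x) by rewrite symN opprK.
have d20 : 0 < d / 2 by rewrite divr_gt0.
have dd : d / 2 < d by rewrite ltr_pdivrMr // ltr_pMr // ltr1n.
exists (- ((d / 2)^-1 *: (S (d / 2) x - x))).
have := Hd _ d20 dd; rewrite sgK ?(ltW d20) // -symB -symZ.
by rewrite opprK symN opprK addrC.
Qed.

End One.

Arguments sgDl {S} HS t x y _.
Arguments sgZ {S} HS t c x _.
Arguments sgB {S} HS t x y _.
Arguments sgK {S} HS s x _.
Arguments sg_ucont {S} HS x [e] _.
Arguments sg_udiff {S} HS x [e] _.
Arguments range_dense {S} HS x [e] _.

(** The function r |-> <S1 r (K x), S2 (t - r) (K y)> has derivative
- <S1 r x, S2 (t - r) (K y)> + <S1 r (K x), S2 (t - r) y>, which is zero by the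
symmetry of K; compare its values at the end points. *)
Lemma sg_sym_range S1 S2 (H1 : is_semigroup S1) (H2 : is_semigroup S2) t x y :
  0 <= t -> h (S1 t (K x)) (K y) = h (K x) (S2 t (K y)).
Proof.
move=> t0.
pose f r := h (S1 r (K x)) (S2 (t - r) (K y)).
have := @eps_flat_const R f t t0.
rewrite /f subrr (sg0 H2) subr0 (sg0 H1); apply => e e0.
(* A common bound for all vectors in sight, kept positive by the summand 1. *)
pose M := N x + N y + N (K x) + N (K y) + 1.
have M0 : 0 < M by rewrite ltr_wpDl // !addr_ge0 // ipnorm_ge0.
have xM z : z \in [:: x; y; K x; K y] -> N z <= M.
  have := ipnorm_ge0 h x; have := ipnorm_ge0 h y.
  have := ipnorm_ge0 h (K x); have := ipnorm_ge0 h (K y).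
  by rewrite !inE /M => ? ? ? ? /or4P[] /eqP ->; lra.
have e30 : 0 < e / (3 * M) by rewrite divr_gt0 // mulr_gt0.
have [d1 d10 Hd1] := sg_udiff H1 x e30.
have [d2 d20 Hd2] := sg_udiff H2 y e30.
have [d3 d30 Hd3] := sg_ucont H2 (K y) e30.
exists (Num.min d1 (Num.min d2 d3)); first by rewrite !lt_min d10 d20.
move=> s r /andP[s0 st] /andP[r0 rt]; rewrite !lt_min => /and3P[sr1 sr2 sr3].
have ts0 : 0 <= t - s by rewrite subr_ge0.
have tr0 : 0 <= t - r by rewrite subr_ge0.
have E : (t - s) - (t - r) = - (s - r) by ring.
have sr2' : `|t - s - (t - r)| < d2 by rewrite E normrN.
have sr3' : `|t - s - (t - r)| < d3 by rewrite E normrN.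
have B1 := Hd1 s r s0 r0 sr1.
have B2 := Hd2 _ _ ts0 tr0 sr2'.
have B3 := Hd3 _ _ ts0 tr0 sr3'.
rewrite E normrN in B2.
set A1 := S1 s (K x) in B1 *; set A0 := S1 r (K x) in B1 *.
set C1 := S2 (t - s) (K y) in B2 B3 *; set C0 := S2 (t - r) (K y) in B2 B3 *.
set a := S1 r x in B1; set c := S2 (t - r) y in B2.
have ac : h a C0 = h A0 c by rewrite /a /C0 /A0 /c (sgK H2) // -Ksym (sgK H1).
(* The two first-order terms cancel by ac; three second-order terms remain. *)
have -> : h A1 C1 - h A0 C0 = h (A1 - A0 + (s - r) *: a) C1
     + h A0 (C1 - C0 + - (s - r) *: c) - (s - r) * h a (C1 - C0).
  rewrite !ipDl !ipDr !ipNl !ipNr !ipZl !ipZr ac; ring.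
have NA0 : N A0 <= M by apply: le_trans (sgN H1 _ _ r0) (xM _ _); rewrite !inE eqxx ?orbT.
have Na : N a <= M by apply: le_trans (sgN H1 _ _ r0) (xM _ _); rewrite !inE eqxx ?orbT.
have NC1 : N C1 <= M by apply: le_trans (sgN H2 _ _ ts0) (xM _ _); rewrite !inE eqxx ?orbT.
have T1 := le_ip_bound B1 NC1.
have T2 := le_ip_bound NA0 B2.
have T3 : `|(s - r) * h a (C1 - C0)| <= `|s - r| * (M * (e / (3 * M))).
  by rewrite normrM ler_wpM2l // (le_ip_bound Na B3).
apply: le_trans (ler_normB _ _) _.
apply: le_trans (lerD (le_trans (ler_normD _ _) (lerD T1 T2)) T3) _.
rewrite le_eqVlt; apply/orP; left; apply/eqP; field; rewrite gt_eqF //.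
Qed.

Lemma sg_sym S1 S2 (H1 : is_semigroup S1) (H2 : is_semigroup S2) t x y :
  0 <= t -> h (S1 t x) y = h x (S2 t y).
Proof.
move=> t0; apply/eqP; rewrite -subr_eq0 -normr_le0; apply: le0_eps => e e0.
pose M := 2 * (N x + N y + 1).
have Nx := ipnorm_ge0 h x; have Ny := ipnorm_ge0 h y.
have M1 : 1 < M by rewrite /M; lra.
have M0 : 0 < M by apply: lt_trans M1.
pose e' := Num.min 1 (e / M).
have e'0 : 0 < e' by rewrite lt_min ltr01 divr_gt0.
have e'1 : e' <= 1 by rewrite ge_min lexx.
have e'M : e' * M <= e by rewrite -ler_pdivlMr // ge_min lexx orbT.
(* Approximate x and y from the range of K, where the identity is known. *)
have [x0 Hx] := range_dense H1 x e'0; have [y0 Hy] := range_dense H1 y e'0.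
set x' := K x0 in Hx; set y' := K y0 in Hy.
have E : h (S1 t x') y' = h x' (S2 t y') by exact: sg_sym_range.
have -> : h (S1 t x) y - h x (S2 t y) = h (S1 t (x - x')) y + h (S1 t x') (y - y')
    - h (x - x') (S2 t y) - h x' (S2 t (y - y')).
  rewrite (sgB H1) // (sgB H2) // !ipBl !ipBr E; ring.
have Nx' : N x' <= N x + 1.
  have := ler_ip_dist h x' x 0; rewrite !subr0 ipnormB => /le_trans; apply.
  by rewrite addrC lerD2l (le_trans Hx).
have T1 := le_ip_bound (le_trans (sgN H1 _ _ t0) Hx) (lexx (N y)).
have T2 := le_ip_bound (le_trans (sgN H1 _ _ t0) Nx') Hy.
have T3 := le_ip_bound Hx (sgN H2 _ y t0).
have T4 := le_ip_bound Nx' (le_trans (sgN H2 _ _ t0) Hy).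
apply: le_trans (ler_normB _ _) _.
apply: le_trans (lerD (le_trans (ler_normB _ _) (lerD (le_trans (ler_normD _ _)
  (lerD T1 T2)) T3)) T4) _.
apply: le_trans e'M; rewrite /M; lra.
Qed.

Arguments sg_sym {S1 S2} H1 H2 [t] x y _.

Lemma sg_unique S1 S2 (H1 : is_semigroup S1) (H2 : is_semigroup S2) t x :
  0 <= t -> S1 t x = S2 t x.
Proof.
by move=> t0; apply: (ip_ext h) => z; rewrite (sg_sym H1 H2) // (sg_sym H2 H2).
Qed.

Section Smoothing.
Variable S : R -> V -> V.
Hypothesis HS : is_semigroup S.

(** Symmetry gives |S(t/2) x|^2 = <S t x, x> = 0; halve the time repeatedly and let
it tend to 0. *)
Lemma sg_backward t x : 0 < t -> S t x = 0 -> x = 0.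
Proof.
move=> t0 Sx0.
have H n : S (t / 2 ^+ n) x = 0.
  elim: n => [|n IHn]; first by rewrite expr0 divr1.
  have r0 : 0 <= t / 2 ^+ n.+1 by rewrite divr_ge0 ?exprn_ge0 // ltW.
  apply: (ip_eq0 h); rewrite (sg_sym HS HS) // -(sgD HS) //.
  suff -> : t / 2 ^+ n.+1 + t / 2 ^+ n.+1 = t / 2 ^+ n by rewrite IHn ipC ip0l.
  by rewrite exprS; field; rewrite expf_neq0.
apply: (ipnorm_eq0P (h := h)) => e e0; have [d d0 Hd] := sgC HS x e e0.
pose n := Num.bound (t / d).
have n2 : t / 2 ^+ n < d.
  rewrite ltr_pdivrMr ?exprn_gt0 // mulrC -ltr_pdivrMr //.
  apply: lt_le_trans (archi_boundP (ltW (divr_gt0 t0 d0))) _.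
  by rewrite -natrX ler_nat ltnW // ltn_expl.
by have := Hd _ (divr_gt0 t0 (exprn_gt0 n (ltr0Sn _ _))) n2; rewrite H sub0r ipnormN.
Qed.

(** A term of a decreasing sequence is at most the mean of the n terms before it; apply
this to the second differences, whose sums telescope to first differences, and
then to the first differences, whose sums telescope to s. *)
Lemma convex_decay (s : nat -> R) n :
  (forall k, 0 <= s k) -> (forall k, 0 <= s k - s k.+1) ->
  (forall k, 0 <= s k - s k.+1 - (s k.+1 - s k.+2)) ->
  (forall k, s k.+1 - s k.+2 - (s k.+2 - s k.+3) <= s k - s k.+1 - (s k.+1 - s k.+2)) ->
  n%:R ^+ 2 * (s (2 * n)%N - s (2 * n).+1 - (s (2 * n).+1 - s (2 * n).+2)) <= s 0%N.
Proof.
have mono (b : nat -> R) : (forall k, b k.+1 <= b k) -> forall i j, (i <= j)%N -> b j <= b i.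
  by move=> bm i j ij; move/nonincreasing_seqP: bm => /(_ i j ij).
have tele (b : nat -> R) m : (forall k, 0 <= b k) ->
    (forall k, b k.+1 - b k.+2 <= b k - b k.+1) ->
    n%:R * (b (m + n)%N - b (m + n).+1) <= b m.
  move=> b0 bc.
  have D i j := mono (fun k => b k - b k.+1) bc i j.
  have : \sum_(0 <= k < n) (b (m + n)%N - b (m + n).+1) <=
         \sum_(0 <= k < n) (b (m + k)%N - b (m + k).+1).
    rewrite [leLHS]big_nat [leRHS]big_nat; apply: ler_sum => k /andP[_ kn].
    by apply: D; rewrite leq_add2l ltnW.
  rewrite sumr_const_nat subn0 -[X in X <= _]mulr_natl => /le_trans; apply.
  under eq_bigr do rewrite -opprB -addnS.
  rewrite sumrN (telescope_sumr (fun k => b (m + k)%N)) // opprB addn0.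
  by rewrite gerBl b0.
move=> s0 b0 r0 rm.
have T1 := tele (fun k => s k - s k.+1) n b0 rm.
have T0 := tele s 0%N s0 _.
rewrite expr2 -mulrA mul2n -addnn.
apply: le_trans (ler_wpM2l (ler0n _ n) T1) _.
by apply: T0 => k; rewrite -subr_ge0.
Qed.

(** The analyticity estimate |t A S t| <= C in discrete form.  By symmetry,
s k = <S (k d) x, x> is completely monotone, and its second difference at 2n is
the square of the norm of S (n d) x - S ((n + 1) d) x. *)
Lemma sg_step_bound d n x : 0 <= d ->
  n%:R * N (S (n%:R * d) x - S (d + n%:R * d) x) <= N x.
Proof.
move=> d0.
have nd k : 0 <= k%:R * d by rewrite mulr_ge0.
pose s k := h (S (k%:R * d) x) x.
have Sd k y : S (k.+1%:R * d) y = S d (S (k%:R * d) y).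
  by rewrite -(sgD HS) // -natr1 mulrDl mul1r addrC.
have sym := sg_sym HS HS.
have hS k y z : h (S (k%:R * d) y) z = h (S (k%:R * (d / 2)) y) (S (k%:R * (d / 2)) z).
  have kd : 0 <= k%:R * (d / 2) by rewrite mulr_ge0 // divr_ge0.
  have -> : k%:R * d = k%:R * (d / 2) + k%:R * (d / 2) by field.
  by rewrite (sgD HS) // sym.
have contr y : h (S d y) y <= h y y.
  rewrite -sqr_ipnorm; apply: le_trans (ler_norm _) _.
  by rewrite expr2 le_ip_bound // (sgN HS).
have shiftS k y : S d (S (k%:R * d) y) = S (k%:R * d) (S d y).
  by rewrite -!(sgD HS) // addrC.
have sb k : s k - s k.+1 = h (S (k%:R * d) (x - S d x)) x.
  by rewrite /s Sd shiftS -ipBl -(sgB HS).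
have sr k : s k - s k.+1 - (s k.+1 - s k.+2) =
    h (S (k%:R * d) (x - S d x)) (x - S d x).
  rewrite !sb Sd ipBr -(sym d) //.
have := @convex_decay s n.
have B : n%:R ^+ 2 * N (S (n%:R * d) x - S (d + n%:R * d) x) ^+ 2 =
  n%:R ^+ 2 * (s (2 * n)%N - s (2 * n).+1 - (s (2 * n).+1 - s (2 * n).+2)).
  rewrite sr; congr (_ * _); rewrite sqr_ipnorm (sgD HS) // shiftS -(sgB HS) //.
  by rewrite [RHS]hS natrM (_ : 2 * n%:R * (d / 2) = n%:R * d) //; field.
rewrite -B -exprMn => H.
rewrite -ler_sqr ?nnegrE ?mulr_ge0 ?ipnorm_ge0 //.
apply: le_trans (H _ _ _ _) _.
- by move=> k; rewrite /s hS ip_ge0.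
- move=> k; rewrite sb hS (sgB HS) ?mulr_ge0 ?divr_ge0 // ipBl subr_ge0.
  have -> : S (k%:R * (d / 2)) (S d x) = S d (S (k%:R * (d / 2)) x).
    by rewrite -!(sgD HS) ?mulr_ge0 ?divr_ge0 // addrC.
  exact: contr.
- by move=> k; rewrite sr hS ip_ge0.
- move=> k; rewrite !sr !hS -!sqr_ipnorm ler_sqr ?nnegrE ?ipnorm_ge0 //.
  have -> : k.+1%:R * (d / 2) = d / 2 + k%:R * (d / 2) by rewrite -natr1; ring.
  by rewrite (sgD HS) ?mulr_ge0 ?divr_ge0 // (sgN HS) // divr_ge0.
- by rewrite /s mul0r (sg0 HS) sqr_ipnorm.
Qed.

Lemma sg_quotient_bound t r x : 0 < r -> r <= t ->
  N (r^-1 *: (S t x - S (r + t) x)) <= 2 / t * N x.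
Proof.
move=> r0 rt; have t0 := lt_le_trans r0 rt; have t0' := ltW t0; have r0' := ltW r0.
(* The largest number of steps of length r that fit into [0, t]; 2 n r >= t. *)
pose n := Num.trunc (t / r).
have /andP[n1 n2] : n%:R <= t / r < n.+1%:R by rewrite truncn_itv // divr_ge0 // ltW.
have n0 : (0 < n)%N.
  rewrite lt0n; apply/eqP => nz; move: n2; rewrite nz ltr_pdivrMr // mul1r; lra.
rewrite ler_pdivlMr // in n1; rewrite ltr_pdivrMr // in n2.
have n0' : 1 <= n%:R :> R by rewrite ler1n.
have B := sg_step_bound r n x (ltW r0).
have nr : 0 <= n%:R * r by rewrite mulr_ge0 // ltW.
have tnr : 0 <= t - n%:R * r by rewrite subr_ge0.
have -> : r + t = t - n%:R * r + (r + n%:R * r) by ring.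
have {1}-> : t = t - n%:R * r + n%:R * r by ring.
rewrite (sgD HS (t - n%:R * r) (n%:R * r)) // (sgD HS (t - n%:R * r) (r + n%:R * r)) // ?addr_ge0 //.
rewrite -(sgB HS) //.
rewrite ipnormZ gtr0_norm ?invr_gt0 //.
apply: le_trans (ler_wpM2l _ (sgN HS _ _ tnr)) _; first by rewrite invr_ge0 ltW.
rewrite ler_pdivrMl // mulrAC mulrA -mulrA mulrCA.
set M := N _ in B *; have M0 : 0 <= M by exact: ipnorm_ge0.
have Nx : 0 <= N x by exact: ipnorm_ge0.
rewrite -natr1 in n2.
have k : 1 <= n%:R * (r * 2 / t).
  rewrite !mulrA ler_pdivlMr // mul1r; nra.
apply: le_trans (_ : M <= n%:R * M * (r * 2 / t)) _; first by nra.
have : n%:R * M * (r * 2 / t) <= N x * (r * 2 / t).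
  by rewrite ler_wpM2r // divr_ge0 ?mulr_ge0 // ltW.
move/le_trans; apply; rewrite le_eqVlt; apply/orP; left; apply/eqP; ring.
Qed.

(** At time t > 0 the difference quotients are bounded by C / t uniformly in the
initial value, and they converge on the dense range of K; hence they form a
Cauchy family for every initial value. *)
Lemma sg_smoothing t x : ip_complete h -> 0 < t -> exists y, S t x = K y.
Proof.
move=> Hc t0; have t0' := ltW t0.
(* Minus the difference quotient of the orbit of v at time t. *)
pose D r v := r^-1 *: (S t v - S (r + t) v).
have DB r v w : 0 <= r -> D r (v - w) = D r v - D r w.
  move=> r0; have rt := addr_ge0 r0 t0'; rewrite /D !(sgB HS) //.
  by apply: (ip_ext h) => z; rewrite !(ipDl, ipNl, ipZl); ring.
have cau e : 0 < e -> exists2 d, 0 < d & forall r s, 0 < r -> r < d -> 0 < s -> s < d ->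
    N (D r x - D s x) <= e.
  move=> e0.
  have e1 : 0 < e * t / 8 by rewrite !mulr_gt0 ?invr_gt0.
  have e4 : 0 < e / 4 by rewrite divr_gt0.
  have [y Hy] := range_dense HS x e1.
  have /(sgG HS) /(_ _ e4) [d d0 Hd] : K y = - K (- y) by rewrite symN opprK.
  exists (Num.min d t); first by rewrite lt_min d0.
  have P1 r : 0 < r -> r < t -> N (D r x - D r (K y)) <= e / 4.
    move=> r0 rt; rewrite -DB ?(ltW r0) //.
    apply: le_trans (sg_quotient_bound _ _ _ r0 (ltW rt)) _.
    apply: le_trans (ler_wpM2l _ Hy) _; first by rewrite divr_ge0.
    rewrite le_eqVlt; apply/orP; left; apply/eqP; field; by rewrite gt_eqF.
  have P2 r : 0 < r -> r < d -> N (D r (K y) - S t y) <= e / 4.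
    move=> r0 rd; apply: le_trans (Hd r r0 rd).
    rewrite /D (addrC r) (sgD HS) ?(ltW r0) // -(sgB HS) // -(sgZ HS) // -(sgB HS) //.
    apply: le_trans (sgN HS _ _ t0') _; rewrite -ipnormN le_eqVlt.
    apply/orP; left; apply/eqP; congr ipnorm.
    by apply: (ip_ext h) => z; rewrite !(ipDl, ipNl, ipZl); ring.
  move=> r s r0; rewrite lt_min => /andP[rd rt] s0; rewrite lt_min => /andP[sd st].
  apply: le_trans (ler_ip_dist h _ (S t y) _) _.
  have -> : e = (e / 4 + e / 4) + (e / 4 + e / 4) by field.
  apply: lerD; last rewrite ipnormB.
    by apply: le_trans (ler_ip_dist h _ (D r (K y)) _) _; rewrite lerD ?P1 ?P2.
  by apply: le_trans (ler_ip_dist h _ (D s (K y)) _) _; rewrite lerD ?P1 ?P2.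
have un d : 0 < d -> exists n0, forall n, (n0 <= n)%N -> n.+1%:R^-1 < d :> R.
  move=> d0; exists (Num.bound d^-1) => n n0.
  rewrite invf_plt ?posrE // ; apply: lt_le_trans (archi_boundP _) _.
    by rewrite invr_ge0 ltW.
  by rewrite ler_nat ltnW.
have [|l Hl] := Hc (fun n => D n.+1%:R^-1 x).
  move=> e e0; have [d d0 Hd] := cau e e0; have [n0 Hn] := un d d0.
  by exists n0 => m n mn nn; apply: Hd; rewrite ?invr_gt0 // Hn.
exists l.
suff /(sgG HS) : right_lim0 h (fun r => r^-1 *: (S r (S t x) - S t x)) (- l).
  by rewrite symN opprK.
move=> e e0; have e2 : 0 < e / 2 by rewrite divr_gt0.
have [d d0 Hd] := cau _ e2; have [n0 Hn] := un d d0; have [n1 Hn1] := Hl _ e2.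
exists d => // r r0 rd.
have H1 : N (D r x - D (maxn n0 n1).+1%:R^-1 x) <= e / 2.
  by apply: Hd; rewrite ?invr_gt0 // Hn // leq_maxl.
have H2 := Hn1 _ (leq_maxr n0 n1).
rewrite -ipnormN.
apply: le_trans (_ : N (D r x - l) <= e).
  rewrite le_eqVlt; apply/orP; left; apply/eqP; congr ipnorm.
  rewrite /D -(sgD HS) ?(ltW r0) //.
  by apply: (ip_ext h) => z; rewrite !(ipDl, ipNl, ipZl); ring.
apply: le_trans (ler_ip_dist h _ _ _) _; last first.
  by rewrite (splitr e); apply: lerD; [exact: H1|exact: H2].
Qed.

Arguments sg_smoothing [t] x _ _.

Lemma sg_derive t x : ip_complete h -> 0 < t ->
  exists2 y, S t x = K y & forall p, is_derive t (1 : R) (fun s => h (S s x) p) (- h y p).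
Proof.
move=> Hc t0; have t20 : 0 < t / 2 by rewrite divr_gt0.
have t20' := ltW t20.
have [y0 Ey] := sg_smoothing x Hc t20.
have tt : t = t / 2 + t / 2 by exact: splitr.
exists (S (t / 2) y0) => [|p].
  by rewrite {1}tt (sgD HS) // Ey (sgK HS).
have cv : (fun r => r^-1 *: (h (S (r + t) x) p - h (S t x) p)) @ 0^' -->
   (- h (S (t / 2) y0) p).
  apply/cvgrPdist_le => e e0.
  pose e' := e / (N p + 1).
  have Np : 0 < N p + 1 by rewrite ltr_wpDl ?ipnorm_ge0.
  have e'0 : 0 < e' by rewrite divr_gt0.
  have [d d0 Hd] := sg_udiff HS y0 e'0.
  near=> r.
  have r0 : r != 0 by near: r; exact: nbhs_dnbhs_neq.
  have rd : `|r| < d by near: r; apply: dnbhs0_lt.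
  have rt : `|r| < t / 2 by near: r; apply: dnbhs0_lt.
  have rt2 : 0 <= r + t / 2.
    by move: rt; rewrite ltr_norml => /andP[rt _]; rewrite -lerBlDr sub0r ltW.
  have := Hd (r + t / 2) (t / 2) rt2 t20'; rewrite addrK => /(_ rd).
  have rtt : r + t / 2 + t / 2 = r + t by rewrite -addrA -tt.
  rewrite -Ey -!(sgD HS) // rtt -tt => B.
  have -> : - h (S (t / 2) y0) p - r^-1 *: (h (S (r + t) x) p - h (S t x) p) =
     - (r^-1 * h (S (r + t) x - S t x + r *: S (t / 2) y0) p).
    rewrite !(ipDl, ipNl, ipZl) /GRing.scale /=; field; exact: r0.
  rewrite normrN normrM normfV ler_pdivrMl ?normr_gt0 //.
  apply: le_trans (le_ip_bound B (lexx (N p))) _.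
  rewrite mulrAC mulrC ler_wpM2l // /e' mulrAC ler_pdivrMr // ler_wpM2l ?(ltW e0) //.
  by rewrite lerDl.
have cv' : (fun r => r^-1 *: ((fun s => h (S s x) p) (r *: (1 : R) + t) - h (S t x) p)) @ 0^' -->
   (- h (S (t / 2) y0) p).
  by apply: cvg_trans cv; apply: near_eq_cvg; near=> r; rewrite [r *: _]mulr1.
split; first by apply/cvg_ex; exists (- h (S (t / 2) y0) p).
exact: cvg_lim cv'.
Unshelve. all: by end_near. Qed.

End Smoothing.
End Semigroup.

Set Implicit Arguments.
Unset Strict Implicit.
Unset Printing Implicit Defensive.

(** * Square integrable functions on (a, 1) *)

Section Leb.
Variables (R : realType) (a : R).
Hypothesis a1 : a < 1.
Local Notation mu := (@lebesgue_measure R).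
Local Notation I := (`]a, 1[%classic : set R).
Implicit Types (f g : R -> R).

Lemma measurable_open_itv : measurable I. Proof. exact: measurable_itv. Qed.

Lemma leb_compl : leb a (~` I) = 0%E.
Proof. by rewrite /leb /= /mrestr setICl measure0. Qed.

Lemma integral_leb_in (f : R -> \bar R) :
  (\int[leb a]_(x in I) f x = \int[mu]_(x in I) f x)%E.
Proof.
by apply: eq_measure_integral => A mA AI; rewrite /leb /= /mrestr (setIidl AI).
Qed.

Lemma ge0_integral_leb (f : R -> \bar R) : measurable_fun setT f ->
  (forall x, 0 <= f x)%E -> (\int[leb a]_x f x = \int[mu]_(x in I) f x)%E.
Proof.
move=> mf f0; rewrite -integral_leb_in.
rewrite (@ge0_negligible_integral _ _ _ (leb a) setT (~` I)) //.
- by rewrite setTD setCK.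
- by apply: measurableC; exact: measurable_open_itv.
- exact: leb_compl.
Qed.

Lemma integral_leb (f : R -> \bar R) : measurable_fun setT f ->
  (\int[leb a]_x f x = \int[mu]_(x in I) f x)%E.
Proof.
move=> mf; rewrite integralE [RHS]integralE; congr (_ - _)%E; apply: ge0_integral_leb => //.
- exact: measurable_funepos.
- exact: measurable_funeneg.
Qed.

Lemma integrable_leb (f : R -> \bar R) : measurable_fun setT f ->
  (leb a).-integrable setT f <-> mu.-integrable I f.
Proof.
move=> mf.
have mf' : measurable_fun setT (abse \o f) by exact: measurableT_comp.
have E := ge0_integral_leb mf' (fun x => abse_ge0 (f x)).
split=> /integrableP[_ fi]; apply/integrableP; split => //.
- exact: measurable_funTS.
- by rewrite -E.
- by rewrite E.
Qed.

Lemma ae_imp (P Q : set R) : (forall x, P x -> Q x) ->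
  {ae mu, forall x, P x} -> {ae mu, forall x, Q x}.
Proof.
by move=> PQ; apply: filterS; first exact: (ae_filter_ringOfSetsType mu).
Qed.

Lemma ae_leb (P : set R) : {ae leb a, forall x, P x} <-> {ae mu, forall x, I x -> P x}.
Proof.
split=> [[N [mN N0 NP]]|[N [mN N0 NP]]].
- exists (N `&` I); split; [exact: measurableI| exact: N0 |].
  by move=> x /= /not_implyP[Ix Px]; split => //; exact: NP.
- exists (N `|` ~` I); split.
  + by apply: measurableU => //; exact: measurableC.
  + rewrite /leb /= /mrestr setIUl setICl setU0.
    apply/eqP; rewrite eq_le measure_ge0 andbT -N0.
    by apply: le_measure; rewrite ?inE //; exact: measurableI.
  + move=> x /= Px; have [Ix|Ix] := pselect (I x); [left; apply: NP|by right].
    by move=> /(_ Ix).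
Qed.

Definition L1I f := mu.-integrable I (EFin \o f).

Lemma L2P f : (f \in L2 a) <->
  measurable_fun setT f /\ L1I (fun x => f x ^+ 2).
Proof.
split.
- move=> fL; have mf : measurable_fun setT f.
    by move: fL; rewrite inE => /andP[]; rewrite inE.
  split => //; have := Lfun2_integrable_sqr fL.
  by move/integrable_leb; apply; apply/measurable_EFinP; exact: measurable_funX.
- case=> mf fi; rewrite inE; apply/andP; split; first by rewrite inE.
  rewrite inE /= /finite_norm unlock poweR_lty //.
  rewrite integral_leb; last first.
    apply/measurable_EFinP.
    apply: (@measurableT_comp _ _ _ _ _ _ (fun x : R => x `^ 2)%R) => //.
    exact: measurableT_comp.
  move/integrableP : fi => [_]; apply: le_lt_trans.
  by rewrite le_eqVlt; apply/orP; left; apply/eqP; apply: eq_integral => x _ /=;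
    rewrite powR_mulrn // real_normK ?num_real // ger0_norm // sqr_ge0.
Qed.

Lemma L2_measurable f : f \in L2 a -> measurable_fun setT f.
Proof. by move/L2P => []. Qed.

Lemma L1I_le f g : measurable_fun I f -> L1I g -> (forall x, I x -> `|f x| <= g x) -> L1I f.
Proof.
rewrite /L1I => mf gi fg; apply: (le_integrable _ _ _ gi) => //; first exact/measurable_EFinP.
move=> x Ix; rewrite /= lee_fin; apply: le_trans (fg x Ix) (ler_norm _).
Qed.

Lemma L1I_cst c : L1I (fun=> c).
Proof.
apply: measurable_bounded_integrable => //.
- by rewrite /= lebesgue_measure_itv /= lte_fin a1 ltry.
- exists `|c|; split; rewrite ?num_real // => M cM x _; exact: ltW.
Qed.

Lemma L1I_D f g : L1I f -> L1I g -> L1I (fun x => f x + g x).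
Proof. by move=> fi gi; exact: (integrableD _ fi gi). Qed.

Lemma L1I_Z c f : L1I f -> L1I (fun x => c * f x).
Proof. by move=> fi; exact: (integrableZl _ c fi). Qed.

Lemma L1I_B f g : L1I f -> L1I g -> L1I (fun x => f x - g x).
Proof. by move=> fi gi; exact: (integrableB _ fi gi). Qed.

Lemma L1I_meas f : L1I f -> measurable_fun I f.
Proof. by move/integrableP => [/measurable_EFinP]. Qed.

Lemma L2_mul f g : f \in L2 a -> g \in L2 a -> L1I (fun x => f x * g x).
Proof.
move=> /L2P[mf fi] /L2P[mg gi].
apply: (@L1I_le _ (fun x => f x ^+ 2 + g x ^+ 2)); [|exact: L1I_D|].
  by apply: measurable_funTS; exact: measurable_funM.
move=> x _; rewrite ler_norml; have := sqr_ge0 (f x + g x); have := sqr_ge0 (f x - g x).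
have := sqr_ge0 (f x); have := sqr_ge0 (g x); nra.
Qed.

Lemma L2_lin c f g : f \in L2 a -> g \in L2 a -> (fun x => c * f x + g x) \in L2 a.
Proof.
move=> fL gL; have [mf fi] := (L2P f).1 fL; have [mg gi] := (L2P g).1 gL.
apply/L2P; split.
  by apply: measurable_funD => //; exact: measurable_funM.
have := L1I_D (L1I_D (L1I_Z (c ^+ 2) fi) gi) (L1I_Z (2 * c) (L2_mul fL gL)).
by congr L1I; apply/funext => x; ring.
Qed.

Lemma L2_B f g : f \in L2 a -> g \in L2 a -> (fun x => f x - g x) \in L2 a.
Proof.
move=> fL gL; have -> : (fun x => f x - g x) = (fun x => -1 * g x + f x).
  by apply/funext => x; rewrite mulN1r addrC.
exact: L2_lin.
Qed.

Lemma L2_cst c : (fun=> c) \in L2 a.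
Proof. by apply/L2P; split => //; exact: L1I_cst. Qed.

Lemma L2_Z c f : f \in L2 a -> (fun x => c * f x) \in L2 a.
Proof.
move=> fL; have -> : (fun x => c * f x) = (fun x => c * f x + 0).
  by apply/funext => x; rewrite addr0.
by apply: L2_lin => //; exact: L2_cst.
Qed.

Lemma L2_L1 f : f \in L2 a -> L1I f.
Proof.
move=> fL; have := L2_mul fL (L2_cst 1).
by congr L1I; apply/funext => x; rewrite mulr1.
Qed.

Lemma L2_bounded f M : measurable_fun setT f -> (forall x, I x -> `|f x| <= M) -> f \in L2 a.
Proof.
move=> mf fM; apply/L2P; split => //.
apply: (@L1I_le _ (fun=> M ^+ 2)); last 2 first.
- exact: L1I_cst.
- by move=> x Ix; rewrite normrX lerXn2r ?nnegrE // ?fM // (le_trans _ (fM x Ix)).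
- by apply: measurable_funTS; exact: measurable_funX.
Qed.

Definition ipL f g : R := \int[mu]_(x in I) (f x * g x).

Lemma ipL_lin c f g k : f \in L2 a -> g \in L2 a -> k \in L2 a ->
  ipL (fun x => c * f x + g x) k = c * ipL f k + ipL g k.
Proof.
move=> fL gL kL; rewrite /ipL -(RintegralZl _ _ (L2_mul fL kL)) //.
rewrite -RintegralD //; [|exact: L1I_Z (L2_mul fL kL)|exact: L2_mul].
by apply: eq_Rintegral => x _; ring.
Qed.

Lemma ipLC f g : ipL f g = ipL g f.
Proof. by apply: eq_Rintegral => x _; rewrite mulrC. Qed.

Lemma ipL_ge0 f : 0 <= ipL f f.
Proof. by apply: Rintegral_ge0 => x _; rewrite -expr2 sqr_ge0. Qed.

Lemma ipLE f g : f \in L2 a -> g \in L2 a ->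
  (ipL f g)%:E = (\int[mu]_(x in I) (f x * g x)%:E)%E.
Proof.
by move=> fL gL; rewrite fineK // integrable_fin_num //; exact: L2_mul.
Qed.

Lemma L2norm_ipL f : f \in L2 a -> L2norm a f = (Num.sqrt (ipL f f))%:E.
Proof.
move=> fL; have [mf fi] := (L2P f).1 fL.
rewrite /L2norm unlock integral_leb; last first.
    apply/measurable_EFinP.
    apply: (@measurableT_comp _ _ _ _ _ _ (fun x : R => x `^ 2)%R) => //.
    exact: measurableT_comp.
have -> : (\int[mu]_(x in I) (`|(EFin \o f) x| `^ 2) = (ipL f f)%:E)%E.
  rewrite ipLE //; apply: eq_integral => x _ /=.
  by rewrite powR_mulrn // real_normK ?num_real // expr2.
by rewrite poweR_EFin powR12_sqrt // ipL_ge0.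
Qed.

Lemma ae_eq_ipL f g k : f \in L2 a -> g \in L2 a -> k \in L2 a ->
  f = g %[ae leb a] -> ipL f k = ipL g k.
Proof.
move=> fL gL kL /ae_leb fg; rewrite /ipL /Rintegral; congr fine.
apply: ae_eq_integral => //.
- by apply/measurable_EFinP/measurable_funTS/measurable_funM; exact: L2_measurable.
- by apply/measurable_EFinP/measurable_funTS/measurable_funM; exact: L2_measurable.
- by apply: ae_imp fg => x /= + Ix => /(_ Ix Logic.I) ->.
Qed.

Lemma ipL_eq0 f : f \in L2 a -> ipL f f = 0 -> f = (fun=> 0) %[ae leb a].
Proof.
move=> fL f0; apply/ae_leb.
have : (\int[mu]_(x in I) `|(f x * f x)%:E| = 0)%E.
  rewrite -[RHS]/(0%:E) -f0 ipLE //; apply: eq_integral => x _.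
  by rewrite gee0_abs // lee_fin -expr2 sqr_ge0.
have mff : measurable_fun I (fun x => (f x * f x)%:E) := measurable_int _ (L2_mul fL fL).
move/(ae_eq_integral_abs mu measurable_open_itv mff); apply: ae_imp => x H Ix _.
by have /eqP := H Ix; rewrite eqe mulf_eq0 orbb => /eqP.
Qed.
End Leb.

(** * Completeness of L^2(a, 1) *)

Section RF.
Variables (R : realType) (a : R).
Hypothesis a1 : a < 1.
Local Notation mu := (@lebesgue_measure R).
Local Notation I := (`]a, 1[%classic : set R).
Implicit Types (f g : R -> R).

Lemma limn_einf_ub (u : nat -> \bar R) (M : \bar R) :
  (exists k0, forall k, (k0 <= k)%N -> (u k <= M)%E) -> (limn_einf u <= M)%E.
Proof.
move=> [k0 uM]; rewrite limn_einf_lim; apply: lime_le; first exact: is_cvg_einfs.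
near=> n; rewrite /einfs /sdrop /=.
apply: (@le_trans _ _ (u (maxn n k0))); last by apply: uM; rewrite leq_maxr.
by apply: ereal_inf_lbound; exists (maxn n k0) => //=; rewrite leq_maxl.
Unshelve. all: by end_near. Qed.

Lemma cvg_of_total_variation (v : nat -> R) (M : R) :
  (forall n, \sum_(0 <= k < n) `|v k.+1 - v k| <= M) -> cvgn v.
Proof.
move=> H.
have cs : cvgn (series (telescope v)).
  apply: normed_cvg; apply: nondecreasing_is_cvgn.
    apply/nondecreasing_seqP => n; rewrite /series /= [leRHS]big_nat_recr //= lerDl.
    exact: normr_ge0.
  by exists M => _ [n _ <-]; exact: H.
have -> : v = (fun n => v 0%N + series (telescope v) n).
  by apply/funext => n; exact: eq_sum_telescope.
by apply: is_cvgD => //; exact: is_cvg_cst.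
Qed.

Lemma L1I_norm f : L1I a f -> L1I a (fun x => `|f x|).
Proof.
move=> fi; apply: (@L1I_le _ _ _ (fun x => `|f x|)) => //.
- by apply: measurableT_comp => //; exact: L1I_meas.
- move: fi; rewrite /L1I => /integrable_abse; congr (_.-integrable _ _).
- by move=> x _; rewrite normr_id.
Qed.

Lemma L1IE f : L1I a f -> (\int[mu]_(x in I) (f x)%:E = (\int[mu]_(x in I) f x)%:E)%E.
Proof. by move=> fi; rewrite fineK // integrable_fin_num. Qed.

(** Integrate |y| <= (e + y^2 / e) / 2; the choice of e is left to the caller. *)
Lemma Rint_abs_le_ipL f (e : R) : 0 < e -> f \in L2 a ->
  \int[mu]_(x in I) `|f x| <= (e * (1 - a) + e^-1 * ipL a f f) / 2.
Proof.
move=> e0 fL; have ff := L2_mul fL fL.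
have -> : (e * (1 - a) + e^-1 * ipL a f f) / 2 =
   \int[mu]_(x in I) (2^-1 * (e^-1 * (f x * f x) + e)).
  rewrite RintegralZl //; last by apply: L1I_D; [exact: L1I_Z | exact: L1I_cst].
  rewrite RintegralD //; [|exact: L1I_Z|exact: L1I_cst].
  rewrite RintegralZl // Rintegral_cst //= lebesgue_measure_itv /= lte_fin a1 /=.
  by rewrite mulrC [in LHS]addrC.
apply: le_Rintegral => //.
- exact/L1I_norm/L2_L1.
- by apply: L1I_Z; apply: L1I_D; [exact: L1I_Z | exact: L1I_cst].
move=> x _; rewrite -(ler_pM2l (_ : 0 < 2 * e)) ?mulr_gt0 //.
have -> : 2 * e * (2^-1 * (e^-1 * (f x * f x) + e)) = `|f x| ^+ 2 + e ^+ 2.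
  by rewrite real_normK ?num_real //; field; rewrite gt_eqF.
by have := sqr_ge0 (`|f x| - e); nra.
Qed.

(** A subsequence with increments of norm at most 2^(-k) has an almost everywhere
absolutely convergent telescoping series; its sum is the limit, by the lemma of
Fatou. *)
Lemma riesz_fischer (u : nat -> R -> R) : (forall n, u n \in L2 a) ->
  (forall e, 0 < e -> exists n0, forall m n, (n0 <= m)%N -> (n0 <= n)%N ->
     ipL a (fun x => u m x - u n x) (fun x => u m x - u n x) <= e) ->
  exists2 l, l \in L2 a & forall e, 0 < e -> exists n0, forall n, (n0 <= n)%N ->
     ipL a (fun x => u n x - l x) (fun x => u n x - l x) <= e.
Proof.
move=> uL uC.
have uBL m n : (fun x => u m x - u n x) \in L2 a.
  exact: L2_B.
have [phi Hphi] : {phi : nat -> nat & forall k m n, (phi k <= m)%N -> (phi k <= n)%N ->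
    ipL a (fun x => u m x - u n x) (fun x => u m x - u n x) <= (4^-1) ^+ k}.
  have /choice [phi H] : forall k, exists n0, forall m n, (n0 <= m)%N -> (n0 <= n)%N ->
    ipL a (fun x => u m x - u n x) (fun x => u m x - u n x) <= (4^-1) ^+ k.
    by move=> k; apply: uC; rewrite exprn_gt0 // invr_gt0.
  by exists phi.
pose N k := maxn k (\max_(i < k.+1) phi i).
have phiN j k : (j <= k)%N -> (phi j <= N k)%N.
  rewrite -ltnS => jk; apply: leq_trans (leq_maxr _ _).
  exact: (leq_bigmax (Ordinal jk)).
pose v k := u (N k).
pose w k x := v k.+1 x - v k x.
have wL k : w k \in L2 a by exact: uBL.
have vL k : v k \in L2 a by exact: uL.
pose M := (1 - a + 1) / 2.
have wi k : \int[mu]_(x in I) `|w k x| <= M * (2^-1) ^+ k.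
  have e0 : 0 < (2^-1) ^+ k :> R by rewrite exprn_gt0 // invr_gt0.
  apply: le_trans (Rint_abs_le_ipL e0 (wL k)) _.
  have := Hphi k (N k.+1) (N k) (phiN _ _ (leqnSn k)) (phiN _ _ (leqnn k)).
  rewrite -/(w k); set A := ipL _ _ _ => HA.
  have : ((2^-1) ^+ k)^-1 * A <= (2^-1) ^+ k.
    rewrite ler_pdivrMl // -exprMn.
    by apply: le_trans HA _; rewrite le_eqVlt; apply/orP; left; apply/eqP; congr (_ ^+ _); field.
  rewrite /M; lra.
pose G x := (\sum_(k <oo) `|w k x|%:E)%E.
have mw k : measurable_fun I (fun x => `|w k x|%:E).
  by apply/measurable_EFinP; apply: measurableT_comp => //; apply: measurable_funTS;
    exact: L2_measurable.
have Gfin : {ae mu, forall x, I x -> G x \is a fin_num}.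
  apply: integrable_ae => //; apply/integrableP; split.
    apply: (ge0_emeasurable_sum (P := xpredT)); last by move=> k kP; exact: mw.
    by move=> k x Ix kP; rewrite lee_fin.
  have -> : (\int[mu]_(x in I) `|G x| = \int[mu]_(x in I) G x)%E.
    apply: eq_integral => x _; rewrite gee0_abs //.
    by apply: nneseries_ge0 => k _ _; rewrite lee_fin.
  rewrite integral_nneseries //.
  apply: (@le_lt_trans _ _ (\sum_(k <oo) (M * (2^-1) ^+ k)%:E)%E).
    apply: lee_nneseries => k _.
      by move=> _; apply: integral_ge0 => x _; rewrite lee_fin.
    by rewrite L1IE ?lee_fin ?wi //; exact/L1I_norm/L2_L1.
  apply: (@le_lt_trans _ _ (2 * M)%:E); last exact: ltry.
  have M0 : 0 <= M by rewrite /M; move: a1; lra.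
  apply: lime_le.
    by apply: is_cvg_nneseries => k _ _; rewrite lee_fin mulr_ge0 // exprn_ge0 // invr_ge0.
  near=> n; rewrite sumEFin lee_fin.
  have -> : \sum_(0 <= k < n) M * 2^-1 ^+ k = 2 * M * (1 - (2^-1) ^+ n).
    elim: (n) => [|j IHj]; first by rewrite big_geq // expr0 subrr mulr0.
    by rewrite big_nat_recr //= IHj exprS; field.
  by rewrite ger_pMr ?mulr_gt0 ?gerBl ?exprn_ge0 ?invr_ge0 //; rewrite /M; move: a1; lra.
have vl : {ae mu, forall x, I x -> cvgn (fun k => v k x)}.
  apply: ae_imp Gfin => x Gx Ix; have {}Gx := Gx Ix.
  apply: (@cvg_of_total_variation _ (fine (G x))) => n.
  rewrite -lee_fin fineK // -sumEFin.
  by apply: nneseries_lim_ge => k _; rewrite lee_fin.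
pose l x := fine (limn_esup (fun k => (v k x)%:E)).
have ml : measurable_fun setT l.
  apply: measurableT_comp; first exact: fine_measurable.
  apply: measurable_fun_limn_esup => k; apply/measurable_EFinP; exact: L2_measurable (vL k).
have vl' : {ae mu, forall x, I x -> (fun k => v k x) @ \oo --> l x}.
  apply: ae_imp vl => x vx Ix; have {}vx := vx Ix.
  have : (fun k => (v k x)%:E) @ \oo --> (limn (fun k => v k x))%:E by apply: cvg_EFin; [exact: nearW | exact: vx].
  by move/cvg_limn_einf_sup => [_ e]; rewrite /l e.
have key e : 0 < e -> exists n0, forall n, (n0 <= n)%N ->
    (\int[mu]_(x in I) ((u n x - l x) ^+ 2)%:E <= e%:E)%E.
  move=> e0; have [n0 Hn0] := uC e e0.
  exists n0 => n nn0.
  pose f k x := ((u n x - v k x) ^+ 2)%:E.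
  have mf k : measurable_fun I (f k).
    apply/measurable_EFinP/measurable_funTS/measurable_funX.
    by apply: measurable_funB; [exact: L2_measurable (uL n)|exact: L2_measurable (vL k)].
  have f0 k x : I x -> (0 <= f k x)%E by move=> _; rewrite lee_fin sqr_ge0.
  have -> : (\int[mu]_(x in I) ((u n x - l x) ^+ 2)%:E = \int[mu]_(x in I) limn_einf (f^~ x))%E.
    apply: ae_eq_integral => //.
    - apply/measurable_EFinP/measurable_funTS/measurable_funX.
      by apply: measurable_funB => //; exact: L2_measurable (uL n).
    - have -> : (fun x => limn_einf (f^~ x)) = (fun x => - limn_esup (fun k => - f k x))%E.
        by [].
      apply: measurableT_comp => //; apply: measurable_fun_limn_esup => k.
      exact: measurableT_comp (mf k).
    - apply: ae_imp vl' => x + Ix => /(_ Ix) vx.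
      suff : f^~ x @ \oo --> ((u n x - l x) ^+ 2)%:E by move/cvg_limn_einf_sup => [-> _].
      apply: cvg_EFin; first exact: nearW.
      by apply: cvgM; apply: cvgB => //; exact: cvg_cst.
  (* Fatou's lemma is applied with n fixed, along the subsequence v. *)
  apply: le_trans (fatou mu _ mf f0) _ => //.
  apply: limn_einf_ub; exists n0 => k kn0.
  have -> : (\int[mu]_(x in I) f k x = (ipL a (fun x => u n x - v k x) (fun x => u n x - v k x))%:E)%E.
    rewrite ipLE; [by apply: eq_integral => x _; rewrite /f expr2|exact: (uBL n (N k))..].
  by rewrite lee_fin; apply: Hn0 => //; rewrite (leq_trans kn0) // leq_maxl.
have umlL n : (exists2 e, 0 < e & (\int[mu]_(x in I) ((u n x - l x) ^+ 2)%:E <= e%:E)%E) ->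
    (fun x => u n x - l x) \in L2 a.
  move=> [e e0 ie]; apply/L2P; split.
    by apply: measurable_funB => //; exact: L2_measurable (uL n).
  apply/integrableP; split.
    apply/measurable_EFinP/measurable_funTS/measurable_funX.
    by apply: measurable_funB => //; exact: L2_measurable (uL n).
  apply: le_lt_trans (_ : (e%:E < +oo)%E); last exact: ltry.
  apply: le_trans ie; rewrite le_eqVlt; apply/orP; left; apply/eqP.
  by apply: eq_integral => x _; rewrite gee0_abs // lee_fin sqr_ge0.
exists l.
  have [n0 Hn0] := key 1 ltr01.
  have H : (fun x => u n0 x - l x) \in L2 a by apply: umlL; exists 1 => //; exact: Hn0.
  have := L2_B (uL n0) H; suff -> : (fun x => u n0 x - (u n0 x - l x)) = l by [].
  by apply/funext => x; rewrite subKr.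
move=> e e0; have [n0 Hn0] := key e e0; exists n0 => n nn0.
have H : (fun x => u n x - l x) \in L2 a by apply: umlL; exists e => //; exact: Hn0.
by rewrite -lee_fin ipLE //; exact: Hn0.
Unshelve. all: by end_near. Qed.
End RF.

(** * The vector space of classes of square integrable functions *)

Section Dual.
Variables (R : realType) (a : R).

Lemma L2_0 : (fun=> 0 : R) \in L2 a.
Proof.
apply/L2P; split => //; rewrite /L1I (_ : _ \o _ = cst 0%E); first exact: integrable0.
by apply/funext => x /=; rewrite expr0n.
Qed.

(** A class is encoded by the functional that it induces on square integrable
functions: almost everywhere equal functions induce the same functional, so
equality of classes is equality, and the algebraic structure is inherited. *)
Definition L2functional (f : R -> R) : (R -> R) -> R^o :=
  fun k => if k \in L2 a then ipL a f k else 0.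

Definition L2dual : {pred ((R -> R) -> R^o)} :=
  [pred phi | `[< exists2 f, f \in L2 a & phi = L2functional f >]].

Lemma L2functional_lin c f g : f \in L2 a -> g \in L2 a ->
  L2functional (fun x => c * f x + g x) = c *: L2functional f + L2functional g.
Proof.
move=> fL gL; apply/funext => k; rewrite /L2functional.
transitivity (c * (if k \in L2 a then ipL a f k else 0) + (if k \in L2 a then ipL a g k else 0)) => //.
by case: ifPn => kL; rewrite ?ipL_lin // mulr0 addr0.
Qed.

Lemma L2dual_submod_closed : submod_closed L2dual.
Proof.
split=> [|c _ _ /asboolP[f fL ->] /asboolP[g gL ->]]; apply/asboolP.
  exists (fun=> 0); first exact: L2_0.
  apply/funext => k; rewrite /L2functional; case: ifPn => // kL.
  by rewrite /ipL; under eq_Rintegral do rewrite mul0r; rewrite Rintegral_cst // mul0r.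
by exists (fun x => c * f x + g x); [exact: L2_lin | rewrite L2functional_lin].
Qed.

HB.instance Definition _ := GRing.isSubmodClosed.Build R _ L2dual L2dual_submod_closed.

Definition L2V : Type := {phi : (R -> R) -> R^o | phi \in L2dual}.
HB.instance Definition _ := SubChoice.on L2V.
HB.instance Definition _ := [SubChoice_isSubLmodule of L2V by <:].

Lemma L2V_valZ c (v : L2V) : val (c *: v : L2V) = c *: val v.
Proof. exact: GRing.valZ. Qed.

Lemma L2V_valD (v w : L2V) : val (v + w : L2V) = val v + val w.
Proof. exact: GRing.valD. Qed.

Lemma L2V_val_lin c (v w : L2V) : val (c *: v + w : L2V) = c *: val v + val w.
Proof. by rewrite L2V_valD L2V_valZ. Qed.

Lemma L2V_repP (v : L2V) : exists2 f, f \in L2 a & val v = L2functional f.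
Proof. by have /asboolP := valP v. Qed.

Definition rep (v : L2V) : R -> R := projT1 (cid2 (L2V_repP v)).

Lemma rep_L2 v : rep v \in L2 a.
Proof. by rewrite /rep; case: cid2. Qed.

Lemma val_rep v : val v = L2functional (rep v).
Proof. by rewrite /rep; case: cid2. Qed.

Definition cls (f : R -> R) : L2V := insubd 0 (L2functional f).

Lemma val_cls f : f \in L2 a -> val (cls f) = L2functional f.
Proof. by move=> fL; rewrite insubdK //; apply/asboolP; exists f. Qed.

Definition ipV (v w : L2V) : R := ipL a (rep v) (rep w).

Lemma ipV_val v w : ipV v w = val v (rep w).
Proof. by rewrite val_rep /L2functional rep_L2. Qed.

Lemma ipVC v w : ipV v w = ipV w v. Proof. exact: ipLC. Qed.

Lemma ipV_lin c (x y z : L2V) : ipV (c *: x + y) z = c * ipV x z + ipV y z.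
Proof. by rewrite !ipV_val L2V_val_lin. Qed.

Lemma ipV_eq0 x : ipV x x = 0 -> x = 0.
Proof.
move=> /(ipL_eq0 (rep_L2 x)) x0; apply: val_inj; rewrite val_rep raddf0.
apply/funext => k; rewrite /L2functional; case: ifPn => // kL.
rewrite (ae_eq_ipL (rep_L2 x) L2_0 kL x0).
by rewrite /ipL; under eq_Rintegral do rewrite mul0r; rewrite Rintegral_cst // mul0r.
Qed.

Definition ipL2 : innerProduct R L2V :=
  InnerProduct _ _ ipV ipVC ipV_lin (fun x => ipL_ge0 a (rep x)) ipV_eq0.

Lemma ip_cls f g : f \in L2 a -> g \in L2 a -> ipL2 (cls f) (cls g) = ipL a f g.
Proof.
move=> fL gL; rewrite /= ipV_val val_cls // /L2functional rep_L2 ipLC.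
have := val_cls gL; rewrite val_rep => /(congr1 (fun u => u f)).
by rewrite /L2functional fL => ->; rewrite ipLC.
Qed.

Lemma cls_rep v : cls (rep v) = v.
Proof. by apply: val_inj; rewrite val_cls ?rep_L2 // -val_rep. Qed.

Lemma cls_lin c f g : f \in L2 a -> g \in L2 a ->
  cls (fun x => c * f x + g x) = c *: cls f + cls g.
Proof.
move=> fL gL; apply: val_inj; rewrite val_cls ?L2_lin // L2functional_lin //.
by rewrite L2V_val_lin /= !val_cls.
Qed.

Lemma cls_eq f g : f \in L2 a -> g \in L2 a -> (cls f = cls g) <-> (f = g %[ae leb a]).
Proof.
move=> fL gL; split=> [fg|fg]; last first.
  apply: val_inj; rewrite !val_cls //; apply/funext => k; rewrite /L2functional.
  by case: ifPn => // kL; exact: ae_eq_ipL.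
have : ipL a (fun x => f x - g x) (fun x => f x - g x) = 0.
  have E : (fun x => f x - g x) = (fun x => -1 * g x + f x).
    by apply/funext => x; rewrite mulN1r addrC.
  rewrite E -ip_cls ?L2_lin // cls_lin // fg scaleN1r addNr.
  exact: ip0l.
move/(ipL_eq0 (L2_B fL gL)) => /ae_leb H; apply/ae_leb.
by apply: ae_imp H => x + Ix _ => /(_ Ix Logic.I) /eqP; rewrite subr_eq0 => /eqP.
Qed.

Lemma cls_B f g : f \in L2 a -> g \in L2 a -> cls (fun x => f x - g x) = cls f - cls g.
Proof.
move=> fL gL; have -> : (fun x => f x - g x) = (fun x => -1 * g x + f x).
  by apply/funext => x; rewrite mulN1r addrC.
by rewrite cls_lin // scaleN1r addrC.
Qed.

Lemma cls_Z c f : f \in L2 a -> cls (fun x => c * f x) = c *: cls f.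
Proof.
move=> fL; have -> : (fun x => c * f x) = (fun x => c * f x + (f x - f x)).
  by apply/funext => x; rewrite subrr addr0.
by rewrite cls_lin ?L2_B // cls_B // subrr addr0.
Qed.

Lemma ipnorm_cls f : f \in L2 a -> L2norm a f = (ipnorm ipL2 (cls f))%:E.
Proof. by move=> fL; rewrite L2norm_ipL // /ipnorm ip_cls. Qed.

Lemma L2V_complete : a < 1 -> ip_complete ipL2.
Proof.
move=> a1 u uC.
have E m n : ipL a (fun x => rep (u m) x - rep (u n) x) (fun x => rep (u m) x - rep (u n) x)
    = ipnorm ipL2 (u m - u n) ^+ 2.
  by rewrite sqr_ipnorm -ip_cls ?L2_B ?rep_L2 // cls_B ?rep_L2 // !cls_rep.
have [||l lL Hl] := @riesz_fischer R a a1 (fun n => rep (u n)).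
- by move=> n; exact: rep_L2.
- move=> e e0; have [|n0 Hn0] := uC (Num.sqrt e); first by rewrite sqrtr_gt0.
  exists n0 => m n mn nn; rewrite E -[leRHS]sqr_sqrtr ?(ltW e0) //.
  by rewrite lerXn2r ?nnegrE ?ipnorm_ge0 ?sqrtr_ge0 //; exact: Hn0.
exists (cls l) => e e0; have [n0 Hn0] := Hl (e ^+ 2) (exprn_gt0 2 e0).
exists n0 => n nn; apply: ipnorm_le; first exact: ltW.
by rewrite -(cls_rep (u n)) -cls_B ?rep_L2 // ip_cls ?L2_B ?rep_L2 //; exact: Hn0.
Qed.

Lemma ipL_cauchy_schwarz f g : f \in L2 a -> g \in L2 a ->
  `|ipL a f g| <= Num.sqrt (ipL a f f) * Num.sqrt (ipL a g g).
Proof. by move=> fL gL; rewrite -!ip_cls //; exact: cauchy_schwarz. Qed.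

End Dual.

(** * Primitives of integrable functions *)

Section Prim.
Variables (R : realType) (a : R).
Hypothesis a1 : a < 1.
Local Notation mu := (@lebesgue_measure R).
Local Notation I := (`]a, 1[%classic : set R).
Implicit Types (f g : R -> R).

(** Integrating over all of (a, 1) against a cut-off makes the primitive total in x
and keeps a single domain of integration. *)
Definition prim f (x : R) : R := \int[mu]_(y in I) (if y < x then f y else 0).

Lemma L1I_if f x : L1I a f -> L1I a (fun y => if y < x then f y else 0).
Proof.
move=> fi; apply: (@L1I_le _ _ _ (fun y => `|f y|)); last 2 first.
- exact: L1I_norm.
- by move=> y _; case: ifPn => // _; rewrite normr0.
- apply: measurable_fun_if => //.
  + by apply: measurable_fun_ltr => //; exact: measurable_cst.
  + by apply: measurable_funS (L1I_meas fi) => //; exact: subIsetl.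
Qed.

Lemma primE f x : a <= x -> x <= 1 -> prim f x = \int[mu]_(y in `]a, x[) f y.
Proof.
move=> ax x1; rewrite /prim Rintegral_mkcond [RHS]Rintegral_mkcond.
apply: eq_Rintegral => y _; rewrite !patchE.
have [yx|yx] := pselect ((`]a, x[%classic : set R) y).
  have yx' := yx; move: yx'; rewrite /= in_itv /= => /andP[ay xy].
  rewrite mem_set; last by rewrite /= in_itv /= ay (lt_le_trans xy).
  by rewrite xy mem_set.
rewrite (memNset yx); case: ifPn => //; rewrite inE /= in_itv /= => /andP[ay _].
by case: ifPn => // xy; exfalso; apply: yx; rewrite /= in_itv /= ay.
Qed.

Lemma prim_lin c f g x : L1I a f -> L1I a g ->
  prim (fun y => c * f y + g y) x = c * prim f x + prim g x.
Proof.
move=> fi gi; rewrite /prim -RintegralZl //; last exact: L1I_if.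
rewrite -RintegralD //; [|exact/L1I_Z/L1I_if|exact: L1I_if].
by apply: eq_Rintegral => y _; case: ifPn => // _; rewrite mulr0 addr0.
Qed.

Lemma prim_abs f x : L1I a f -> `|prim f x| <= \int[mu]_(y in I) `|f y|.
Proof.
move=> fi; apply: le_trans (le_normr_Rintegral _ (L1I_if x fi)) _ => //.
apply: le_Rintegral => //; [exact/L1I_norm/L1I_if|exact: L1I_norm|].
by move=> y _; case: ifPn => // _; rewrite normr0.
Qed.

Lemma prim_abs_L2 f x : f \in L2 a -> a <= x -> x <= 1 ->
  `|prim f x| <= Num.sqrt (ipL a f f) * Num.sqrt (x - a).
Proof.
move=> fL ax x1.
pose k y : R := if y < x then 1 else 0.
have mk : measurable_fun setT k.
  by apply: measurable_fun_ifT => //; apply: measurable_fun_ltr.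
have kL : k \in L2 a.
  apply: (L2_bounded a1 (M := 1)) => // y _; rewrite /k; case: ifPn => _; rewrite ?normr1 ?normr0 //.
have -> : prim f x = ipL a f k.
  by apply: eq_Rintegral => y _; rewrite /k; case: ifPn; rewrite ?mulr1 ?mulr0.
have <- : ipL a k k = x - a.
  rewrite (_ : ipL a k k = prim (fun=> 1) x); last first.
    by apply: eq_Rintegral => y _; rewrite /k; case: ifPn; rewrite ?mulr1 ?mulr0.
  rewrite primE // Rintegral_cst //= lebesgue_measure_itv /= lte_fin mul1r.
  case: ltP => /=; last by move=> xa; apply/esym/eqP; rewrite subr_eq0 eq_le ax xa.
  by [].
exact: ipL_cauchy_schwarz.
Qed.

(** The integrand of the double integral behind the integration by parts below. *)
Definition kern f g (z : R * R) : R := if z.2 < z.1 then (f \_ I) z.2 * (g \_ I) z.1 else 0.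

Lemma measurable_kern f g : measurable_fun I f -> measurable_fun I g ->
  measurable_fun setT (kern f g).
Proof.
move=> mf mg; apply: measurable_fun_ifT => //.
- by apply: measurable_fun_ltr; [exact: measurable_snd|exact: measurable_fst].
- apply: measurable_funM.
  + by apply: (measurableT_comp (f := f \_ I)); [exact/(measurable_restrictT _ _).1|exact: measurable_snd].
  + by apply: (measurableT_comp (f := g \_ I)); [exact/(measurable_restrictT _ _).1|exact: measurable_fst].
Qed.

Lemma Rint_eq_ae f g : measurable_fun I f -> measurable_fun I g ->
  {ae mu, forall x, I x -> f x = g x} -> \int[mu]_(x in I) f x = \int[mu]_(x in I) g x.
Proof.
move=> mf mg fg; congr fine; apply: ae_eq_integral => //; try exact/measurable_EFinP.
by apply: ae_imp fg => x /= + Ix => /(_ Ix) ->.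
Qed.

Lemma prim1 f : prim f 1 = \int[mu]_(x in I) f x.
Proof.
by apply: eq_Rintegral => x; rewrite inE /= in_itv /= => /andP[_ ->].
Qed.

Lemma prim_tail f y : L1I a f ->
  \int[mu]_(x in I) (if y < x then f x else 0) = prim f 1 - prim f y.
Proof.
move=> fi; have mf := L1I_meas fi.
have mt : measurable_fun I (fun x => if y < x then f x else 0).
  apply: measurable_fun_if => //.
  + by apply: measurable_fun_ltr => //; exact: measurable_cst.
  + by apply: measurable_funS mf => //; exact: subIsetl.
apply/eqP; rewrite -subr_eq opprK prim1 eq_sym; apply/eqP.
rewrite /prim -RintegralD //; last exact: L1I_if.
  apply: Rint_eq_ae => //; first by apply: measurable_funD => //; exact: L1I_meas (L1I_if y fi).
  exists [set y]; split => //; first by rewrite lebesgue_measure_set1.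
  move=> x /= H; apply: contrapT => xy; apply: H => _.
  by case: (ltgtP x y) => [| |//]; rewrite ?add0r ?addr0.
apply: (@L1I_le _ _ _ (fun y => `|f y|)) => //.
- exact: L1I_norm.
- by move=> x _; case: ifPn => // _; rewrite normr0.
Qed.

Lemma nondecreasing_prim f : L1I a f -> (forall x, 0 <= f x) -> {homo prim f : x y / x <= y}.
Proof.
move=> fi f0 x y xy; apply: le_Rintegral => //; [exact: L1I_if..|].
move=> z _; case: ifPn => zx; first by rewrite (lt_le_trans zx xy).
by case: ifPn.
Qed.

Lemma measurable_prim f : L1I a f -> measurable_fun setT (prim f).
Proof.
move=> fi; have ni := L1I_norm fi.
have pi : L1I a (fun y => f y + `|f y|) by exact: L1I_D.
have -> : prim f = (fun x => prim (fun y => f y + `|f y|) x - prim (fun y => `|f y|) x).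
  apply/funext => x; have := prim_lin (-1) x ni pi; rewrite mulN1r addrC => <-.
  by apply: eq_Rintegral => y _; rewrite mulN1r addrC addrK.
apply: measurable_funB; apply: nondecreasing_measurable => //; apply: nondecreasing_prim => //.
by move=> x; rewrite -lerBlDl sub0r lerNl lerNnormlW.
Qed.

Lemma L1I_prim_mul f g : L1I a f -> L1I a g -> L1I a (fun x => prim f x * g x).
Proof.
move=> fi gi; apply: (@L1I_le _ _ _ (fun x => (\int[mu]_(y in I) `|f y|) * `|g x|)).
- apply: measurable_funM; last exact: L1I_meas.
  by apply: measurable_funTS; exact: measurable_prim.
- exact/L1I_Z/L1I_norm.
- by move=> x _; rewrite normrM ler_wpM2r // prim_abs.
Qed.

Lemma kern_y f g x : L1I a f ->
  (\int[mu]_y (kern f g (x, y))%:E = (prim f x * (g \_ I) x)%:E)%E.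
Proof.
move=> fi; rewrite mulrC /prim -RintegralZl //; last exact: L1I_if.
rewrite -L1IE; last exact/L1I_Z/L1I_if.
rewrite [RHS]integral_mkcond; apply: eq_integral => y _; rewrite /kern /= !patchE.
by case: ifPn => yI; case: ifPn => // _; rewrite ?mulr0 ?mul0r // mulrC.
Qed.

Lemma kern_x f g y : L1I a g ->
  (\int[mu]_x (kern f g (x, y))%:E = ((f \_ I) y * (prim g 1 - prim g y))%:E)%E.
Proof.
move=> gi; rewrite -prim_tail //.
have ti : L1I a (fun x => if y < x then g x else 0).
  apply: (@L1I_le _ _ _ (fun y => `|g y|)).
  - apply: measurable_fun_if => //.
    + by apply: measurable_fun_ltr => //; exact: measurable_cst.
    + by apply: measurable_funS (L1I_meas gi) => //; exact: subIsetl.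
  - exact: L1I_norm.
  - by move=> x _; case: ifPn => // _; rewrite normr0.
rewrite -RintegralZl // -L1IE; last exact: L1I_Z.
rewrite [RHS]integral_mkcond; apply: eq_integral => x _; rewrite /kern /= !patchE.
by case: ifPn => yI; case: ifPn => // _; case: ifPn => // _; rewrite ?mulr0 ?mul0r.
Qed.

(** Integration by parts for two absolutely continuous functions: it is the theorem
of Fubini on the triangle y < x. *)
Lemma prim_fubini f g : L1I a f -> L1I a g ->
  \int[mu]_(x in I) (prim f x * g x) = prim f 1 * prim g 1 - \int[mu]_(x in I) (f x * prim g x).
Proof.
move=> fi gi.
have mk : measurable_fun setT (EFin \o kern f g).
  by apply/measurable_EFinP; apply: measurable_kern; exact: L1I_meas.
have ki : (mu \x mu)%E.-integrable setT (EFin \o kern f g).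
  apply/integrable12ltyP => //.
  have -> : (\int[mu]_x \int[mu]_y `|(EFin \o kern f g) (x, y)| =
      \int[mu]_(x in I) (prim (fun y => `|f y|) x * `|g x|)%:E)%E.
    rewrite [RHS]integral_mkcond; apply: eq_integral => x _.
    transitivity (\int[mu]_y (kern (fun y => `|f y|) (fun y => `|g y|) (x, y))%:E)%E.
      apply: eq_integral => y _ /=; congr EFin; rewrite /kern /= !patchE.
      by case: ifPn => _; rewrite ?normr0 // normrM; congr (_ * _); case: ifPn => //; rewrite normr0.
    rewrite kern_y; last exact: L1I_norm.
    by rewrite !patchE; case: ifPn => // _; rewrite mulr0.
  by rewrite L1IE ?ltry //; apply: L1I_prim_mul; exact: L1I_norm.
have := Fubini ki.
under eq_integral do rewrite /= kern_y //.
under [in RHS]eq_integral do rewrite /= kern_x //.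
move=> FF.
have H1 : (\int[mu]_x (prim f x * (g \_ I) x)%:E = (\int[mu]_(x in I) (prim f x * g x))%:E)%E.
  rewrite -L1IE; last exact: L1I_prim_mul.
  rewrite [RHS]integral_mkcond; apply: eq_integral => x _; rewrite !patchE.
  by case: ifPn => // _; rewrite mulr0.
have H2 : (\int[mu]_y ((f \_ I) y * (prim g 1 - prim g y))%:E =
    (\int[mu]_(x in I) (prim g 1 * f x - f x * prim g x))%:E)%E.
  rewrite -L1IE; last first.
    apply: L1I_B; first exact: L1I_Z.
    by under eq_fun do rewrite mulrC; exact: L1I_prim_mul.
  rewrite [RHS]integral_mkcond; apply: eq_integral => x _; rewrite !patchE.
  by case: ifPn => // _; [congr EFin; ring|rewrite mul0r].
move: FF; rewrite H1 H2 => -[->].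
rewrite RintegralB //; last 2 first.
- exact: L1I_Z.
- by rewrite -/(L1I _ _); under eq_fun do rewrite mulrC; exact: L1I_prim_mul.
by rewrite RintegralZl // (prim1 f) mulrC.
Qed.
End Prim.

(** * The inverse of - A *)

Section K.
Variables (R : realType) (a : R).
Hypothesis a1 : a < 1.
Local Notation mu := (@lebesgue_measure R).
Local Notation I := (`]a, 1[%classic : set R).
Implicit Types (f g h : R -> R).

Lemma mem_open_itv x : I x <-> a < x < 1.
Proof. by rewrite /= in_itv. Qed.

Lemma L1I_continuous f : continuous f -> L1I a f.
Proof.
move=> cf; apply: (@integrableS _ _ _ mu (`[a, 1]%classic)) => //.
  exact: subset_itv_oo_cc.
apply: continuous_compact_integrable; first exact: segment_compact.
exact: continuous_subspaceT.
Qed.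

Lemma prim_le_a f x : x <= a -> prim a f x = 0.
Proof.
move=> xa; rewrite /prim (@eq_Rintegral _ _ _ _ _ (fun=> 0)); first by rewrite Rintegral_cst // mul0r.
by move=> y; rewrite inE => /mem_open_itv /andP[ay _]; rewrite ltNge (le_trans xa (ltW ay)) /=.
Qed.

Lemma prim_FTC (F : R -> R) x : (forall y, derivable F y 1) -> continuous (derive1 F) ->
  a <= x -> x <= 1 -> prim a (derive1 F) x = F x - F a.
Proof.
move=> dF cF'; rewrite le_eqVlt => /predU1P[<- _|ax x1].
  by rewrite prim_le_a // subrr.
have cF : continuous F by move=> y; apply: differentiable_continuous; apply/derivable1_diffP.
have i : mu.-integrable `[a, x] (EFin \o derive1 F).
  apply: continuous_compact_integrable; first exact: segment_compact.
  exact: continuous_subspaceT.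
rewrite primE ?(ltW ax) //.
rewrite Rintegral_itv_bndo_bndc; last first.
  by apply: integrableS i => //; exact: subset_itv_oo_cc.
rewrite Rintegral_itv_obnd_cbnd; last first.
  by apply: integrableS i => //; exact: subset_itv_oc_cc.
have cs : {within `[a, x], continuous (derive1 F)} by exact: continuous_subspaceT.
have dd : derivable_oo_LRcontinuous F a x.
  split=> [y _| |]; first exact: dF.
  + by apply: cvg_at_right_filter; exact: cF.
  + by apply: cvg_at_left_filter; exact: cF.
have e : {in `]a, x[, (derive1 F) =1 derive1 F} by [].
by rewrite /Rintegral (continuous_FTC2 ax cs dd e).
Qed.

Lemma test_continuous phi : test_function a phi -> continuous phi.
Proof. by move=> [dp _ _] y; apply: differentiable_continuous; apply/derivable1_diffP. Qed.

Lemma test_bd phi x : test_function a phi -> ~ I x -> phi x = 0.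
Proof. by move=> [_ _ [K [_ KI K0]]] Ix; apply: K0 => Kx; apply: Ix; exact: KI. Qed.

Lemma test_ends phi : test_function a phi -> phi a = 0 /\ phi 1 = 0.
Proof. by move=> tp; split; apply: (test_bd tp) => /mem_open_itv; rewrite ltxx ?andbF. Qed.

Lemma L1I_bounded_mul f g M : L1I a f -> measurable_fun I g -> (forall x, I x -> `|g x| <= M) ->
  L1I a (fun x => f x * g x).
Proof.
move=> fi mg gM; apply: (@L1I_le _ _ _ (fun x => M * `|f x|)).
- by apply: measurable_funM => //; exact: L1I_meas.
- exact/L1I_Z/L1I_norm.
- by move=> x Ix; rewrite normrM mulrC ler_wpM2r // gM.
Qed.

Lemma continuous_bounded g : continuous g -> exists M, forall x, I x -> `|g x| <= M.
Proof.
move=> cg; have : compact (`[a, 1]%classic : set R) by exact: segment_compact.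
have cgn : {within `[a, 1], continuous (fun x => `|g x|)}.
  apply: continuous_subspaceT => x; apply: (@continuous_comp _ _ _ g (fun y : R => `|y|)); first exact: cg.
  exact: norm_continuous.
move=> _; have [c _ H] := EVT_max (ltW a1) cgn.
exists `|g c| => x /mem_open_itv /andP[ax x1]; apply: H.
by rewrite in_itv /= !ltW.
Qed.

Lemma L1I_mul_continuous f g : L1I a f -> continuous g -> L1I a (fun x => f x * g x).
Proof.
move=> fi cg; have [M gM] := continuous_bounded cg.
by apply: (L1I_bounded_mul fi _ gM); apply: measurable_funTS; exact: continuous_measurable_fun.
Qed.

Lemma L1I_prim f : L1I a f -> L1I a (prim a f).
Proof.
move=> fi; have := L1I_prim_mul fi (L1I_cst a1 1).
by congr L1I; apply/funext => x; rewrite mulr1.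
Qed.

Lemma weak_derivative_prim c f : L1I a f -> weak_derivative a (fun x => c + prim a f x) f.
Proof.
move=> fi.
have pi := L1I_prim fi.
split.
- by apply: open_integrable_locally; [exact: itv_open|apply: L1I_D => //; exact: L1I_cst].
- by apply: open_integrable_locally; [exact: itv_open|].
move=> phi tp; have [p0 p1] := test_ends tp; have [dp cp' _] := tp.
have cp := test_continuous tp.
have ip' := L1I_continuous cp'.
have E x : I x -> prim a (derive1 phi) x = phi x.
  by move=> /mem_open_itv /andP[ax x1]; rewrite prim_FTC ?(ltW ax) ?(ltW x1) // p0 subr0.
have E1 : prim a (derive1 phi) 1 = 0 by rewrite prim_FTC ?(ltW a1) // p0 p1 subr0.
transitivity (c * prim a (derive1 phi) 1 + \int[mu]_(x in I) (prim a f x * derive1 phi x)).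
  rewrite prim1 -RintegralZl // -RintegralD //; first by apply: eq_Rintegral => x _; ring.
  - exact: L1I_Z.
  - exact: L1I_mul_continuous.
rewrite prim_fubini // E1 !mulr0 add0r sub0r; congr (- _).
by apply: eq_Rintegral => x; rewrite inE => Ix; rewrite E.
Qed.

(** The integrable majorant of the quotient that defines the inverse operator. *)
Lemma L1I_invsqrt : L1I a (fun x => (Num.sqrt (x - a))^-1).
Proof.
pose f x := (Num.sqrt (x - a))^-1.
have cf x : a < x -> {for x, continuous f}.
  move=> ax; apply: cvgV; first by rewrite gt_eqF // sqrtr_gt0 subr_gt0.
  apply: (@continuous_comp _ _ _ (fun x => x - a) Num.sqrt).
    by apply: cvgB; [exact: cvg_id|exact: cvg_cst].
  exact: sqrt_continuous.
have dF (x : R) : a < x -> is_derive x 1 (fun x => 2 * Num.sqrt (x - a)) (f x).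
  move=> ax; have xa : 0 < x - a by rewrite subr_gt0.
  have := is_derive1_sqrt xa => d1.
  have d2 : is_derive x 1 (fun x : R => x - a) 1.
    have := is_deriveB (is_derive_id x (1 : R)) (is_derive_cst a x (1 : R)).
    by rewrite subr0.
  have d3 := @is_derive1_comp R Num.sqrt (fun x : R => x - a) x _ _ d1 d2.
  have d4 := is_deriveZ 2 d3.
  suff -> : f x = 2 *: ((2 * Num.sqrt (x - a))^-1 * 1) by exact: d4.
  rewrite mulr1 /f invfM [RHS]mulrA mulfV ?mul1r //.
pose F (i : nat) := `[a + (1 - a) / i.+2%:R, 1]%classic.
have pos i : 0 < (1 - a) / i.+2%:R by rewrite divr_gt0 ?subr_gt0.
have Fi i x : F i x -> a < x.
  rewrite /F /= in_itv /= => /andP[+ _]; apply: lt_le_trans.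
  by rewrite ltrDl.
have mf i : measurable_fun (F i) f.
  apply: subspace_continuous_measurable_fun => //; first exact: measurable_itv.
  by apply: continuous_in_subspaceT => x; rewrite inE => /Fi; exact: cf.
have UF : \bigcup_i F i = `]a, 1]%classic.
  apply/seteqP; split=> [x [i _ Fx]|x].
    by have := Fi _ _ Fx; move: Fx; rewrite /F /= !in_itv /= => /andP[_ ->] ->.
  rewrite /= in_itv /= => /andP[ax x1].
  exists (Num.bound ((1 - a) / (x - a))) => //; rewrite /F /= in_itv /= x1 andbT.
  rewrite -lerBrDl ler_pdivrMr // mulrC -ler_pdivrMr ?subr_gt0 //.
  apply: ltW; apply: lt_le_trans (archi_boundP _) _.
    by apply: divr_ge0; rewrite subr_ge0 ltW.
  by rewrite ler_nat -addn2 leq_addr.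
have f0 x : 0 <= f x by rewrite invr_ge0 sqrtr_ge0.
have mf1 : measurable_fun `]a, 1] f.
  apply: subspace_continuous_measurable_fun => //.
  by apply: continuous_in_subspaceT => x; rewrite inE /= in_itv /= => /andP[ax _]; exact: cf.
apply: (@integrableS _ _ _ mu `]a, 1]%classic) => //; first exact: subset_itv_oo_oc.
apply/integrableP; split; first exact/measurable_EFinP.
apply: (@le_lt_trans _ _ (2 * Num.sqrt (1 - a))%:E); last exact: ltry.
have -> : (\int[mu]_(x in `]a, 1%R]) `|(EFin \o f) x| = \int[mu]_(x in `]a, 1%R]) (f x)%:E)%E.
  by apply: eq_integral => x _; rewrite /= ger0_norm.
rewrite -UF.
have cvF : (\int[mu]_(x in F i) (f x)%:E)%E @[i --> \oo] --> (\int[mu]_(x in \bigcup_i F i) (f x)%:E)%E.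
  apply: ge0_nondecreasing_set_cvg_integral.
  - move=> m n mn; apply/subsetPset => x; rewrite /F /= !in_itv /= => /andP[h1 ->].
    rewrite andbT; apply: le_trans h1; rewrite lerD2l ler_wpM2l ?subr_ge0 ?(ltW a1) //.
    by rewrite lef_pV2 ?posrE // ler_nat.
  - by move=> i; exact: measurable_itv.
  - by move=> i; apply/measurable_EFinP; exact: mf.
  - by move=> i x _; rewrite lee_fin.
rewrite -(cvg_lim _ cvF) //; apply: lime_le; first by apply/cvg_ex; eexists; exact: cvF.
near=> i.
have bi : a + (1 - a) / i.+2%:R < 1.
  rewrite -ltrBrDl ltr_pdivrMr // ltr_pMr ?subr_gt0 // ltr1n //.
have cs : {within F i, continuous f}.
  by apply: continuous_in_subspaceT => x; rewrite inE => /Fi; exact: cf.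
have cG x : a < x -> {for x, continuous (fun x => 2 * Num.sqrt (x - a))}.
  move=> ax; have [d _] := dF x ax.
  by apply: differentiable_continuous; apply/derivable1_diffP.
have ai : a < a + (1 - a) / i.+2%:R by rewrite ltrDl.
have dd : derivable_oo_LRcontinuous (fun x => 2 * Num.sqrt (x - a)) (a + (1 - a) / i.+2%:R) 1.
  split=> [y| |].
  + by rewrite in_itv /= => /andP[iy _]; have [] := dF y (lt_trans ai iy).
  + by apply: cvg_at_right_filter; exact: cG.
  + by apply: cvg_at_left_filter; exact: cG.
have e : {in `](a + (1 - a) / i.+2%:R), 1[, derive1 (fun x : R => 2 * Num.sqrt (x - a) : R) =1 f}.
  move=> y; rewrite in_itv /= => /andP[iy _]; have d := dF y (lt_trans ai iy).
  by rewrite derive1E; exact: derive_val.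
rewrite /F (continuous_FTC2 bi cs dd e).
by rewrite -EFinB lee_fin gerBl mulr_ge0 // sqrtr_ge0.
Unshelve. all: by end_near. Qed.

(** With K the operator defined next and P f the primitive of f, (K f)_x = - P f / (x - a),
that is, the weighted derivative (x - a) (K f)_x is - P f. *)
Definition quot f x := prim a f x / (x - a).
Definition Kop f x := prim a (quot f) 1 - prim a (quot f) x.

(** By the Cauchy-Schwarz inequality, P f (x) = O(sqrt (x - a)). *)
Lemma quot_bound f x : f \in L2 a -> I x ->
  `|quot f x| <= Num.sqrt (ipL a f f) * (Num.sqrt (x - a))^-1.
Proof.
move=> fL /mem_open_itv /andP[ax x1]; have xa : 0 < x - a by rewrite subr_gt0.
rewrite /quot normrM normfV (gtr0_norm xa) ler_pdivrMr //.
apply: le_trans (prim_abs_L2 a1 fL (ltW ax) (ltW x1)) _.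
rewrite -mulrA -[X in _^-1 * X](sqr_sqrtr (ltW xa)) expr2 mulKf //.
by rewrite gt_eqF // sqrtr_gt0.
Qed.

Lemma measurable_quot f : L1I a f -> measurable_fun I (quot f).
Proof.
move=> fi; apply: measurable_funM.
  by apply: measurable_funTS; exact: measurable_prim.
apply: subspace_continuous_measurable_fun => //.
apply: continuous_in_subspaceT => x; rewrite inE => /mem_open_itv /andP[ax _].
apply: cvgV; first by rewrite gt_eqF // subr_gt0.
by apply: cvgB; [exact: cvg_id|exact: cvg_cst].
Qed.

Lemma L1I_quot f : f \in L2 a -> L1I a (quot f).
Proof.
move=> fL; apply: (@L1I_le _ _ _ (fun x => Num.sqrt (ipL a f f) * (Num.sqrt (x - a))^-1)).
- exact: measurable_quot (L2_L1 a1 fL).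
- exact/L1I_Z/L1I_invsqrt.
- by move=> x; exact: quot_bound.
Qed.

Lemma L2_prim c f : L1I a f -> (fun x => c + prim a f x) \in L2 a.
Proof.
move=> fi; apply: (L2_bounded a1 (M := `|c| + \int[mu]_(y in I) `|f y|)).
  by apply: measurable_funD => //; exact: measurable_prim.
by move=> x _; apply: le_trans (ler_normD _ _) _; rewrite lerD2l prim_abs.
Qed.

Lemma KopE f : f \in L2 a -> Kop f = fun x => prim a (quot f) 1 + prim a (fun y => - quot f y) x.
Proof.
move=> fL; apply/funext => x; rewrite /Kop; congr (_ + _).
have := prim_lin (-1) x (L1I_quot fL) (L1I_cst a1 0).
rewrite mulN1r (_ : prim a (fun=> 0) x = 0); last first.
  rewrite /prim (@eq_Rintegral _ _ _ _ _ (fun=> 0)); first by rewrite Rintegral_cst // mul0r.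
  by move=> y _; case: ifP.
by rewrite addr0 => <-; congr (prim a _ x); apply/funext => y; rewrite mulN1r addr0.
Qed.

Lemma L1I_N f : L1I a f -> L1I a (fun x => - f x).
Proof. by move=> /(L1I_Z (-1)); congr L1I; apply/funext => x; rewrite mulN1r. Qed.

Lemma Kop_L2 f : f \in L2 a -> Kop f \in L2 a.
Proof. by move=> fL; rewrite KopE //; apply: L2_prim; exact/L1I_N/L1I_quot. Qed.

(** The bilinear form of K; its integrand is P f P g / (x - a), which makes the
symmetry of K visible. *)
Lemma Kop_form f g : f \in L2 a -> g \in L2 a ->
  ipL a (Kop f) g = \int[mu]_(x in I) (quot f x * prim a g x).
Proof.
move=> fL gL; have qi := L1I_quot fL; have gi := L2_L1 a1 gL.
rewrite /ipL /Kop.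
transitivity (\int[mu]_(x in I) (prim a (quot f) 1 * g x - prim a (quot f) x * g x)).
  by apply: eq_Rintegral => x _; rewrite mulrBl.
rewrite RintegralB //; last 2 first.
- exact: L1I_Z.
- exact: L1I_prim_mul.
by rewrite RintegralZl // -prim1 prim_fubini // opprB addrC subrK.
Qed.

Lemma Kop_sym f g : f \in L2 a -> g \in L2 a -> ipL a (Kop f) g = ipL a f (Kop g).
Proof.
move=> fL gL; rewrite (Kop_form fL gL) ipLC (Kop_form gL fL).
by apply: eq_Rintegral => x _; rewrite /quot; ring.
Qed.

Lemma Kop1 f : Kop f 1 = 0. Proof. by rewrite /Kop subrr. Qed.

Lemma prim_continuous f : L1I a f -> {within `[a, 1], continuous (prim a f)}.
Proof.
move=> fi; pose F := f \_ I.
have Fi : mu.-integrable setT (EFin \o F).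
  rewrite (_ : EFin \o F = (EFin \o f) \_ I); last by rewrite restrict_EFin.
  by rewrite -integrable_mkcond.
have Fi' A : measurable A -> mu.-integrable A (EFin \o F).
  by move=> mA; exact: integrableS Fi.
have := parameterized_integral_continuous (ltW a1) (Fi' _ (measurable_itv `[a, 1])).
apply: subspace_eq_continuous => x; rewrite inE /= in_itv /= => /andP[ax x1].
rewrite /from_subspace /parameterized_integral.
rewrite -Rintegral_itv_obnd_cbnd; last exact: Fi'.
rewrite -Rintegral_itv_bndo_bndc; last exact: Fi'.
rewrite primE //; apply: eq_Rintegral => y; rewrite inE /= in_itv /= => /andP[ay yx].
by rewrite /F patchE mem_set //; apply/mem_open_itv; rewrite ay (lt_le_trans yx).
Qed.

Lemma Kop_continuous h : h \in L2 a -> {within `]a, 1], continuous (Kop h)}.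
Proof.
move=> hL; have cp : {within `]a, 1], continuous (prim a (quot h))}.
  by apply: continuous_subspaceW (prim_continuous (L1I_quot hL)); exact: subset_itv_oc_cc.
by move=> x; apply: cvgB; [exact: cvg_cst|exact: cp].
Qed.

Lemma L2_N f : f \in L2 a -> (fun x => - f x) \in L2 a.
Proof. by move=> /(L2_Z a1 (-1)); under eq_fun do rewrite mulN1r. Qed.

Lemma quot_prim f x : (x - a) * quot f x = prim a f x.
Proof.
rewrite /quot; have [->|xa] := eqVneq x a; first by rewrite subrr mul0r prim_le_a.
by rewrite mulrCA mulfV ?mulr1 // subr_eq0.
Qed.

Lemma prim_N f x : L1I a f -> prim a (fun y => - f y) x = - prim a f x.
Proof.
move=> fi; rewrite -mulN1r /prim -RintegralZl //; last exact: L1I_if.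
by apply: eq_Rintegral => y _; case: ifPn => // _; rewrite ?mulr0 ?mulN1r.
Qed.

Lemma opA_Kop h : h \in L2 a -> opA a (Kop h) (fun x => - h x).
Proof.
move=> hL; have hi := L2_L1 a1 hL; have qi := L1I_quot hL.
split; first exact: Kop_L2.
exists (fun x => - quot h x); split.
- by rewrite KopE //; apply: weak_derivative_prim; exact: L1I_N.
- suff H : L1I a (fun x => (x - a) * `|- quot h x| ^+ 2) by rewrite L1IE // ltry.
  apply: (@L1I_le _ _ _ (fun=> ipL a h h)); last 2 first.
  + exact: L1I_cst.
  + move=> x Ix; have /mem_open_itv/andP[ax x1] := Ix; have xa : 0 < x - a by rewrite subr_gt0.
    rewrite normrN ger0_norm; last by rewrite mulr_ge0 ?exprn_ge0 // ltW.
    rewrite -ler_pdivlMl // -[leRHS]mulrC.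
    have := quot_bound hL Ix; rewrite -ler_sqr ?nnegrE ?mulr_ge0 ?sqrtr_ge0 ?invr_ge0 ?sqrtr_ge0 //.
    by rewrite exprMn exprVn !sqr_sqrtr ?ipL_ge0 // ltW.
  + apply: measurable_funM.
      by apply: measurable_funTS; apply: measurable_funB.
    apply: measurable_funX; apply: measurableT_comp => //; apply: measurableT_comp => //.
    exact: measurable_quot.
- exists (Kop h); last exact: Kop1.
  by split; [exact: Kop_continuous|exact: ae_eq_refl].
- have -> : (fun x => (x - a) * - quot h x) = (fun x => 0 + prim a (fun y => - h y) x).
    by apply/funext => x; rewrite add0r mulrN quot_prim prim_N.
  split; first by apply: L2_prim; exact: L1I_N.
    exact: L2_N.
  by apply: weak_derivative_prim; exact: L1I_N.
Qed.
End K.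

(** * Weak derivatives and the graph of A *)

Lemma ae_exists (R : realType) (b c : R) (P : set R) : b < c ->
  {ae (@lebesgue_measure R), forall x, P x} -> exists2 x, b < x < c & P x.
Proof.
move=> bc [N [mN N0 PN]]; apply: contrapT => nP.
have : `]b, c[%classic `<=` N.
  move=> x; rewrite /= in_itv /= => xbc; apply: PN => /= Px; apply: nP.
  by exists x.
move=> /(le_measure (@lebesgue_measure R)); rewrite !inE => /(_ (measurable_itv _) mN).
rewrite [X in (_ <= X)%E]N0 /= lebesgue_measure_itv /= lte_fin bc -EFinD lee_fin.
by rewrite leNgt subr_gt0 bc.
Qed.

Lemma within_cont_ball (R : realType) (A : set R) (f : R -> R) x e :
  {within A, continuous f} -> A x -> 0 < e ->
  exists2 d, 0 < d & forall y, A y -> `|x - y| < d -> `|f x - f y| < e.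
Proof.
move=> cf Ax e0; have /cvgrPdist_lt /(_ _ e0) := cf x.
move=> /(nbhs_subspace_ex _ Ax) [V /nbhs_ballP [d d0 HV] UV]; exists d => // y Ay xy.
have : (V `&` A) y by split => //; exact: HV.
by rewrite -UV => -[].
Qed.

(** Continuity at 1 from the left is included, so the boundary value at 1 of a class
is well defined. *)
Lemma continuous_ae_eq (R : realType) (a : R) (f g : R -> R) :
  a < 1 -> {within `]a, 1], continuous f} -> {within `]a, 1], continuous g} ->
  f = g %[ae leb a] -> forall x, a < x -> x <= 1 -> f x = g x.
Proof.
move=> a1 cf cg /ae_leb fg x ax x1.
apply/eqP; rewrite -subr_eq0 -normr_le0; apply: le0_eps => e e0.
have Ax : (`]a, 1]%classic : set R) x by rewrite /= in_itv /= ax.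
have e2 : 0 < e / 2 by rewrite divr_gt0.
have [d1 d10 H1] := within_cont_ball cf Ax e2.
have [d2 d20 H2] := within_cont_ball cg Ax e2.
pose b := Num.max a (Num.max (x - d1) (x - d2)).
have bx : b < x by rewrite !gt_max ax !gtrBl d10.
have [y /andP[yb yx] fgy] := ae_exists bx fg.
move: yb; rewrite !gt_max => /and3P[ay y1 y2].
have Ay : (`]a, 1]%classic : set R) y by rewrite /= in_itv /= ay (le_trans (ltW yx)).
have {}fgy : f y = g y by apply: fgy => //; rewrite /= in_itv /= ay (lt_le_trans yx).
have dxy : `|x - y| = x - y by rewrite gtr0_norm // subr_gt0.
have := H1 y Ay; have := H2 y Ay; rewrite dxy ltrBlDr -ltrBlDl y2 => /(_ isT) B2.
rewrite ltrBlDr -ltrBlDl y1 => /(_ isT) B1.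
have -> : f x - g x = (f x - f y) - (g x - g y) by rewrite fgy; ring.
apply: le_trans (ler_normB _ _) _; rewrite (splitr e); exact: lerD (ltW B1) (ltW B2).
Qed.

Lemma is_derive_quadratic (R : realType) (f : R -> R) x d C :
  (forall k, `|f (k + x) - f x - k * d| <= C * k ^+ 2) -> is_derive x (1 : R) f d.
Proof.
move=> H.
have C0 : 0 <= C by have := le_trans (normr_ge0 _) (H 1); rewrite expr1n mulr1.
have cv : (fun k => k^-1 *: (f (k *: (1 : R) + x) - f x)) @ 0^' --> d.
  apply/cvgrPdist_le => e e0; near=> k.
  have k0 : k != 0 by near: k; exact: nbhs_dnbhs_neq.
  have ke : `|k| < e / (C + 1) by near: k; apply: dnbhs0_lt; rewrite divr_gt0 // ltr_wpDl.
  have -> : d - k^-1 *: (f (k *: (1 : R) + x) - f x) = - (k^-1 * (f (k + x) - f x - k * d)).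
    by rewrite [k *: _]mulr1 /GRing.scale /=; field.
  rewrite normrN normrM normfV ler_pdivrMl ?normr_gt0 //.
  apply: le_trans (H k) _; rewrite -real_normK ?num_real // expr2 mulrA mulrC ler_wpM2l //.
  rewrite ltr_pdivlMr ?ltr_wpDl // in ke.
  by apply: le_trans (ltW ke); rewrite mulrC ler_wpM2l // lerDl.
split; first by apply/cvg_ex; exists d.
exact: cvg_lim cv.
Unshelve. all: by end_near. Qed.

Section Step.
Variable R : realType.
Implicit Types (x y k p q d : R).

Definition pos y : R := Num.max y 0.
(** A C^1 transition from 0 to 1 on [0, 2], the primitive of the tent function bump.
Differences of two translates are test functions. *)
Definition step y : R := (pos y ^+ 2 - 2 * pos (y - 1) ^+ 2 + pos (y - 2) ^+ 2) / 2.
Definition bump y : R := pos y - 2 * pos (y - 1) + pos (y - 2).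

Lemma pos_case y : (0 <= y /\ pos y = y) \/ (y <= 0 /\ pos y = 0).
Proof.
rewrite /pos; case: (leP y 0) => y0; [right|left]; split => //; first exact: ltW.
Qed.

Lemma pos_sqr_quadratic k y : `|pos (k + y) ^+ 2 - pos y ^+ 2 - k * (2 * pos y)| <= k ^+ 2.
Proof.
rewrite ler_norml.
by have [[h1 ->]|[h1 ->]] := pos_case (k + y); have [[h2 ->]|[h2 ->]] := pos_case y;
  apply/andP; split; nra.
Qed.

Lemma step_quadratic k y : `|step (k + y) - step y - k * bump y| <= 2 * k ^+ 2.
Proof.
have H0 := pos_sqr_quadratic k y.
have H1 := pos_sqr_quadratic k (y - 1).
have H2 := pos_sqr_quadratic k (y - 2).
move: H0 H1 H2; rewrite /step /bump -!addrA.
set A := pos (k + y); set B := pos y; set C := pos (k + (y - 1)); set D := pos (y - 1).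
set E := pos (k + (y - 2)); set F := pos (y - 2).
rewrite !ler_norml => /andP[? ?] /andP[? ?] /andP[? ?]; apply/andP; split; lra.
Qed.

Lemma bump_bound y : 0 <= bump y <= 1.
Proof.
rewrite /bump; have [[h1 ->]|[h1 ->]] := pos_case y;
have [[h2 ->]|[h2 ->]] := pos_case (y - 1);
have [[h3 ->]|[h3 ->]] := pos_case (y - 2); apply/andP; split; lra.
Qed.

Lemma bump_out y : y <= 0 \/ 2 <= y -> bump y = 0.
Proof.
move=> h; rewrite /bump; have [[h1 ->]|[h1 ->]] := pos_case y;
have [[h2 ->]|[h2 ->]] := pos_case (y - 1);
have [[h3 ->]|[h3 ->]] := pos_case (y - 2); case: h => h; lra.
Qed.

Lemma step_left y : y <= 0 -> step y = 0.
Proof.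
move=> h; rewrite /step; have [[h1 ->]|[h1 ->]] := pos_case y;
have [[h2 ->]|[h2 ->]] := pos_case (y - 1);
have [[h3 ->]|[h3 ->]] := pos_case (y - 2); nra.
Qed.

Lemma step_right y : 2 <= y -> step y = 1.
Proof.
move=> h; rewrite /step; have [[h1 ->]|[h1 ->]] := pos_case y;
have [[h2 ->]|[h2 ->]] := pos_case (y - 1);
have [[h3 ->]|[h3 ->]] := pos_case (y - 2); nra.
Qed.

Lemma bump_continuous : continuous bump.
Proof.
have pc : continuous pos by move=> y; apply: continuous_max; [exact: cvg_id|exact: cvg_cst].
have pcs c : continuous (fun y => pos (y - c)).
  move=> y; apply: (@continuous_comp _ _ _ (fun y => y - c) pos); last exact: pc.
  by apply: cvgB; [exact: cvg_id|exact: cvg_cst].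
move=> y; apply: cvgD; last exact: pcs.
by apply: cvgB; [exact: pc|apply: cvgM; [exact: cvg_cst|exact: pcs]].
Qed.

Lemma is_derive_step p d x : 0 < d ->
  is_derive x (1 : R) (fun x => step ((x - p) / d)) (bump ((x - p) / d) / d).
Proof.
move=> d0; apply: (@is_derive_quadratic _ _ _ _ (2 / d ^+ 2)) => k.
have := step_quadratic (k / d) ((x - p) / d).
have -> : k / d + (x - p) / d = (k + x - p) / d by field; rewrite gt_eqF.
have -> : k / d * bump ((x - p) / d) = k * (bump ((x - p) / d) / d) by field; rewrite gt_eqF.
move/le_trans; apply; rewrite le_eqVlt; apply/orP; left; apply/eqP.
by field; rewrite gt_eqF.
Qed.
End Step.

Section DBR.
Variables (R : realType) (a : R).
Hypothesis a1 : a < 1.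
Local Notation mu := (@lebesgue_measure R).
Local Notation I := (`]a, 1[%classic : set R).
Implicit Types (f g h u : R -> R).

Definition bump_avg u p d := \int[mu]_(x in I) (u x * (bump ((x - p) / d) / d)).

Lemma step_continuous p d : 0 < d ->
  (forall x, derivable (fun x : R => step ((x - p) / d)) x 1) /\
  derive1 (fun x : R => step ((x - p) / d)) = (fun x => bump ((x - p) / d) / d).
Proof.
move=> d0; split=> [x|]; first by have [] := is_derive_step p x d0.
apply/funext => x; rewrite derive1E; have D := is_derive_step p x d0; exact: derive_val.
Qed.

Lemma bumpd_continuous p d : continuous (fun x : R => bump ((x - p) / d) / d).
Proof.
move=> x; apply: cvgM; last exact: cvg_cst.
apply: (@continuous_comp _ _ _ (fun x => (x - p) / d) (@bump R)); last exact: bump_continuous.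
by apply: cvgM; [apply: cvgB; [exact: cvg_id|exact: cvg_cst]|exact: cvg_cst].
Qed.

(** Averages of u with respect to two translated tents differ by the integral of u
against the derivative of a test function. *)
Lemma bump_avg_shift u p q d : L1I a u ->
  (forall phi, test_function a phi -> \int[mu]_(x in I) (u x * derive1 phi x) = 0) ->
  0 < d -> a < p -> p <= q -> q + 2 * d < 1 -> bump_avg u p d = bump_avg u q d.
Proof.
move=> ui H d0 ap pq q1.
have [dp ep] := step_continuous p d0; have [dq eq] := step_continuous q d0.
pose phi x := step ((x - p) / d) - step ((x - q) / d).
have dphi x : derivable phi x 1 by apply: derivableB.
have ephi : derive1 phi = (fun x => bump ((x - p) / d) / d - bump ((x - q) / d) / d).
  apply/funext => x; rewrite derive1E deriveB //; congr (_ - _).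
    by rewrite -derive1E ep.
  by rewrite -derive1E eq.
have : test_function a phi.
  split; [exact: dphi| |].
    by rewrite ephi => x; apply: cvgB; exact: bumpd_continuous.
  exists (`[p, q + 2 * d]%classic); split; first exact: segment_compact.
    move=> x; rewrite /= !in_itv /= => /andP[px xq].
    by rewrite (lt_le_trans ap px) (le_lt_trans xq q1).
  move=> x; rewrite /= in_itv /= => /negP; rewrite negb_and -!ltNge => /orP[xp|xq].
    by rewrite /phi !step_left ?subrr // pmulr_lle0 ?invr_gt0 // subr_le0 ltW // (lt_le_trans xp).
  by rewrite /phi !step_right ?subrr // ler_pdivlMr //; move: pq xq; lra.
move/H; rewrite ephi => E; apply/eqP; rewrite -subr_eq0 -E; apply/eqP.
rewrite /bump_avg -RintegralB //; last 2 first.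
- exact: L1I_mul_continuous (@bumpd_continuous p d).
- exact: L1I_mul_continuous (@bumpd_continuous q d).
by apply: eq_Rintegral => x _; rewrite mulrBr.
Qed.

Lemma bump_avg_one p d : 0 < d -> a <= p -> p + 2 * d <= 1 -> bump_avg (fun=> 1) p d = 1.
Proof.
move=> d0 ap p1; have [dp ep] := step_continuous p d0.
transitivity (prim a (derive1 (fun x : R => step ((x - p) / d))) 1).
  by rewrite prim1 ep; apply: eq_Rintegral => x _; rewrite mul1r.
have cp : continuous (derive1 (fun x : R => step ((x - p) / d))).
  by rewrite ep; exact: bumpd_continuous.
rewrite (prim_FTC dp cp (ltW a1) (lexx 1)).
rewrite step_right; last by rewrite ler_pdivlMr //; move: p1; lra.
by rewrite step_left ?subr0 // pmulr_lle0 ?invr_gt0 // subr_le0.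
Qed.

Lemma lebesgue_avg u p e : L1I a u -> lebesgue_pt (u \_ I) p -> I p -> 0 < e ->
  exists2 d, 0 < d & forall r, 0 < r -> r < d ->
    (\int[mu]_(x in I) (if `|x - p| < r then `|u x - u p| else 0)%:E <= (2 * r * e)%:E)%E.
Proof.
move=> ui lp Ip e0.
have : \forall r \near 0^'+, (davg (u \_ I) p r < e%:E)%E.
  have /fine_cvgP[fn /cvgrPdist_lt /(_ _ e0) fl] := lp.
  near=> r; have dfin : davg (u \_ I) p r \is a fin_num by near: r.
  rewrite -(fineK dfin) lte_fin; apply: le_lt_trans (ler_norm _) _.
  by rewrite -[X in `|X|]opprK normrN -sub0r; near: r.
move=> [d d0 Hd]; exists d => // r r0 rd.
have /Hd : ball 0 d r by rewrite /ball /= sub0r normrN gtr0_norm.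
move=> /(_ r0); rewrite /davg /iavg lebesgue_measure_ball ?(ltW r0) //.
have -> : (\int[mu]_(x in I) (if `|x - p| < r then `|u x - u p| else 0)%:E =
   \int[mu]_(x in I `&` ball p r) `|((center ((u \_ I) p) \o (u \_ I)) x)%:E|)%E.
  rewrite [RHS]integral_mkcondr; apply: eq_integral => x xI; rewrite patchE.
  have [xp|xp] := boolP (`|x - p| < r).
    rewrite mem_set; last by rewrite /ball /= distrC.
    by rewrite /shift /= !patchE xI mem_set.
  by rewrite memNset // => h; move/negP: xp; apply; rewrite distrC.
set J := (\int[_]_(_ in _) _)%E => HJ.
apply: (@le_trans _ _ J).
  apply: ge0_subset_integral => //.
  - by apply: measurableI => //; exact: measurable_ball.
  - exact: measurable_ball.
  - apply: measurableT_comp => //; apply/measurable_EFinP; apply: measurable_funTS.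
    apply: measurable_funB => //.
    by apply/(measurable_restrictT _ _).1 => //; exact: L1I_meas.
have r2 : 0 < r *+ 2 by rewrite mulrn_wgt0.
move: HJ; rewrite inver gt_eqF // lte_pdivrMl // => /ltW.
by rewrite -EFinM mulr_natl.
Unshelve. all: by end_near. Qed.

Lemma bump_avg_cvg u p e : L1I a u -> lebesgue_pt (u \_ I) p -> I p -> 0 < e ->
  exists2 d, 0 < d & forall r, 0 < r -> r < d -> `|bump_avg u p r - u p| <= e.
Proof.
move=> ui lp Ip e0; have /mem_open_itv /andP[ap p1] := Ip.
have e6 : 0 < e / 6 by rewrite divr_gt0.
have [d d0 Hd] := lebesgue_avg ui lp Ip e6.
exists (Num.min (d / 3) ((1 - p) / 2)); first by rewrite lt_min !divr_gt0 // subr_gt0.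
move=> r r0; rewrite lt_min => /andP[rd rp].
have r30 : 0 < 3 * r by rewrite mulr_gt0.
have r3d : 3 * r < d by move: rd; lra.
have := Hd _ r30 r3d.
pose k x := if `|x - p| < 3 * r then `|u x - u p| else 0.
have mk : measurable_fun I k.
  apply: measurable_fun_if => //.
  - by apply: measurable_fun_ltr => //; apply: measurableT_comp => //; apply: measurable_funB.
  - apply: measurableT_comp => //; apply: measurable_funB => //.
    by apply: measurable_funS (L1I_meas ui) => //; exact: subIsetl.
have ki : L1I a k.
  apply: (@L1I_le _ _ _ (fun x => `|u x - u p|)) => //.
    by apply: L1I_norm; apply: L1I_B => //; exact: L1I_cst.
  by move=> x _; rewrite /k; case: ifPn => _; rewrite ?normr_id ?normr0.
rewrite (L1IE ki) lee_fin => Hk.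
have cb := @bumpd_continuous p r.
have upi : L1I a (fun x => (u x - u p) * (bump ((x - p) / r) / r)).
  by apply: L1I_mul_continuous => //; apply: L1I_B => //; exact: L1I_cst.
have -> : bump_avg u p r - u p = \int[mu]_(x in I) ((u x - u p) * (bump ((x - p) / r) / r)).
  have one : bump_avg (fun=> 1) p r = 1 by apply: bump_avg_one => //; [exact: ltW|move: rp; lra].
  transitivity (bump_avg u p r - u p * bump_avg (fun=> 1) p r); first by rewrite one mulr1.
  rewrite /bump_avg -RintegralZl //; last first.
    by apply: L1I_mul_continuous => //; exact: L1I_cst.
  rewrite -RintegralB //.
  - by apply: eq_Rintegral => x _; ring.
  - exact: L1I_mul_continuous.
  - by apply: L1I_Z; apply: L1I_mul_continuous => //; exact: L1I_cst.
apply: le_trans (le_normr_Rintegral _ upi) _ => //.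
apply: (@le_trans _ _ (\int[mu]_(x in I) (r^-1 * k x))).
  apply: le_Rintegral => //; [exact: L1I_norm|exact: L1I_Z|].
  move=> x _; rewrite normrM mulrC /k; have /andP[b0 b1] := bump_bound ((x - p) / r).
  case: ifPn => [_|].
    rewrite ler_wpM2r // ger0_norm ?mulr_ge0 ?invr_ge0 ?(ltW r0) //.
    by rewrite ger_pMl ?invr_gt0.
  rewrite -leNgt => xp; rewrite bump_out; first by rewrite mul0r normr0 mul0r mulr0.
  move: xp; rewrite ler_normr => /orP[xp|xp].
    by right; rewrite ler_pdivlMr //; lra.
  by left; rewrite pmulr_lle0 ?invr_gt0 //; lra.
rewrite RintegralZl // ler_pdivrMl //; apply: le_trans Hk _.
by rewrite le_eqVlt; apply/orP; left; apply/eqP; field.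
Qed.

(** The averages of u over small tents do not depend on the position of the tent, and
at Lebesgue points they converge to the values of u. *)
Lemma du_bois_reymond u : L1I a u ->
  (forall phi, test_function a phi -> \int[mu]_(x in I) (u x * derive1 phi x) = 0) ->
  exists c, {ae mu, forall x, I x -> u x = c}.
Proof.
move=> ui H.
have Ui : locally_integrable setT (u \_ I) by exact: integrable_locally.
have leb := lebesgue_differentiation Ui.
have [q aq lq] := ae_exists a1 leb.
have Iq : I q by apply/mem_open_itv.
exists (u q); apply: ae_imp leb => p lp Ip.
apply/eqP; rewrite -subr_eq0 -normr_le0; apply: le0_eps => e e0.
have e2 : 0 < e / 2 by rewrite divr_gt0.
have [d1 d10 H1] := bump_avg_cvg ui lp Ip e2.
have [d2 d20 H2] := bump_avg_cvg ui lq Iq e2.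
have /mem_open_itv/andP[ap p1] := Ip; have /andP[aq' q1] := aq.
pose d := Num.min (Num.min d1 d2) (Num.min ((1 - p) / 2) ((1 - q) / 2)).
have d0 : 0 < d by rewrite !lt_min d10 d20 !divr_gt0 ?subr_gt0.
have hd : 0 < d / 2 by rewrite divr_gt0.
have : d / 2 < d by rewrite ltr_pdivrMr // ltr_pMr // ltr1n.
rewrite {2}/d !lt_min => /andP[/andP[dd1 dd2] /andP[dp dq]].
have E : bump_avg u p (d / 2) = bump_avg u q (d / 2).
  have [pq|qp] := leP p q.
    by apply: bump_avg_shift => //; move: dq; lra.
  by apply/esym; apply: bump_avg_shift => //; [exact: ltW|move: dp; lra].
have -> : u p - u q = (bump_avg u q (d / 2) - u q) - (bump_avg u p (d / 2) - u p).
  by rewrite E; ring.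
apply: le_trans (ler_normB _ _) _; rewrite (splitr e); apply: lerD.
  exact: H2.
exact: H1.
Qed.
End DBR.

Section OpA.
Variables (R : realType) (a : R).
Hypothesis a1 : a < 1.
Local Notation mu := (@lebesgue_measure R).
Local Notation I := (`]a, 1[%classic : set R).
Implicit Types (f g h u : R -> R).

Lemma ae_and (P Q : set R) : {ae mu, forall x, P x} -> {ae mu, forall x, Q x} ->
  {ae mu, forall x, P x /\ Q x}.
Proof.
move=> [N [mN N0 NP]] [M [mM M0 MP]]; exists (N `|` M); split.
- exact: measurableU.
- by apply/eqP; rewrite eq_le measure_ge0 andbT -(adde0 0%E) -{1}N0 -M0 measureU2.
- move=> x /= /not_andP[nP|nQ]; [left; exact: NP|right; exact: MP].
Qed.

Lemma weak_derivative_eq_prim u g g' : L1I a u -> L1I a g' -> weak_derivative a u g ->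
  {ae mu, forall x, I x -> g x = g' x} ->
  exists c, {ae mu, forall x, I x -> u x = prim a g' x + c}.
Proof.
move=> ui g'i [_ [mg _ _] H] gg'.
have pi := L1I_prim a1 g'i.
have [|phi tp|c Hc] := @du_bois_reymond R a a1 (fun x => u x - prim a g' x).
- exact: L1I_B.
- have [_ cp _] := tp; have cphi := test_continuous tp.
  have [_ _ /(_ phi tp)] := weak_derivative_prim a1 0 g'i.
  have E0 : \int[mu]_(x in I) ((0 + prim a g' x) * derive1 phi x) =
     \int[mu]_(x in I) (prim a g' x * derive1 phi x).
    by apply: eq_Rintegral => x _; rewrite add0r.
  rewrite E0 => E1.
  have E2 := H phi tp.
  have E3 : \int[mu]_(x in I) (g x * phi x) = \int[mu]_(x in I) (g' x * phi x).
    apply: Rint_eq_ae.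
    + by apply: measurable_funM => //; apply: measurable_funTS; exact: continuous_measurable_fun.
    + by apply: measurable_funM; [exact: L1I_meas|apply: measurable_funTS; exact: continuous_measurable_fun].
    + by apply: ae_imp gg' => x Hx Ix; rewrite Hx.
  transitivity (\int[mu]_(x in I) (u x * derive1 phi x) - \int[mu]_(x in I) (prim a g' x * derive1 phi x)).
    rewrite -RintegralB //.
    + by apply: eq_Rintegral => x _; rewrite mulrBl.
    + exact: L1I_mul_continuous.
    + exact: L1I_mul_continuous.
  by rewrite E1 E2 E3 subrr.
exists c; apply: ae_imp Hc => x Hx Ix; rewrite -(Hx Ix); ring.
Qed.

Lemma ae_all (P : set R) : (forall x, P x) -> {ae mu, forall x, P x}.
Proof. by move=> H; exists set0; split => // x /= /(_ (H x)). Qed.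

Lemma prim_cst c x : a <= x -> x <= 1 -> prim a (fun=> c) x = c * (x - a).
Proof.
move=> ax x1; rewrite primE // Rintegral_cst //= lebesgue_measure_itv /= lte_fin.
case: ltP => //= xa; congr (_ * _).
by apply/esym/eqP; rewrite subr_eq0 eq_le ax xa.
Qed.

(** A continuous primitive of 1 / (x - a) cannot exist near a: over (a, a + s) the
integral is at least 1 for every s. *)
Lemma inv_not_L1I : ~ L1I a (fun x => (x - a)^-1).
Proof.
move=> hi.
have Aa : (`[a, 1]%classic : set R) a by rewrite /= in_itv /= lexx ltW.
have [d d0 Hd] := within_cont_ball (prim_continuous a1 hi) Aa ltr01.
pose s := Num.min (d / 2) (1 - a).
have s0 : 0 < s by rewrite lt_min divr_gt0 // subr_gt0.
have sd : s < d by rewrite gt_min ltr_pdivrMr // ltr_pMr // ltr1n.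
have s1 : a + s <= 1 by rewrite -lerBrDl ge_min lexx orbT.
have ys : a <= a + s by rewrite lerDl ltW.
have := Hd (a + s); rewrite /= in_itv /= ys s1 => /(_ isT).
rewrite opprD addrA subrr sub0r normrN (gtr0_norm s0) => /(_ sd).
rewrite (prim_le_a _ (lexx a)) // sub0r normrN ltNge => /negP; apply.
apply: le_trans (ler_norm _).
have -> : 1 = prim a (fun=> s^-1) (a + s).
  by rewrite prim_cst // addrAC subrr add0r mulVf // gt_eqF.
apply: le_Rintegral => //; [exact/L1I_if/L1I_cst|exact: L1I_if|].
move=> x /mem_open_itv /andP[ax x1]; case: ifPn => // xs.
by rewrite lef_pV2 ?posrE ?subr_gt0 // lerBlDl ltW.
Qed.

(** From A u = f, (x - a) u_x = P f + c almost everywhere.  The weighted energy of u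
is finite only if c = 0, since otherwise 1 / (x - a) would be integrable; this is
where the boundary condition at a comes from.  Then u_x = P f / (x - a), and
u(1) = 0 fixes the remaining constant. *)
Lemma opA_inv u f : opA a u f -> f \in L2 a /\ u = (fun x => - Kop a f x) %[ae leb a].
Proof.
move=> [uL [g [wu iw [w [cw wu'] w1] [vL fL wv]]]]; split => //.
have fi := L2_L1 a1 fL; have ui := L2_L1 a1 uL; have vi := L2_L1 a1 vL.
have qi := L1I_quot a1 fL.
have [c Hc] := weak_derivative_eq_prim vi fi wv (ae_all (fun x _ => erefl)).
have mg : measurable_fun I g by case: wu => _ [].
have mpc : measurable_fun I (fun x => prim a f x + c).
  by apply: measurable_funTS; apply: measurable_funD => //; exact: measurable_prim.
have minv : measurable_fun I (fun x => (x - a)^-1).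
  apply: subspace_continuous_measurable_fun => //.
  apply: continuous_in_subspaceT => x; rewrite inE => /mem_open_itv /andP[ax _].
  apply: cvgV; first by rewrite gt_eqF // subr_gt0.
  by apply: cvgB; [exact: cvg_id|exact: cvg_cst].
pose k x := (prim a f x + c) ^+ 2 / (x - a).
have mk : measurable_fun I k.
  by apply: measurable_funM => //; exact: measurable_funX.
have k0 x : I x -> 0 <= k x.
  by move=> /mem_open_itv /andP[ax _]; rewrite divr_ge0 ?sqr_ge0 // subr_ge0 ltW.
have ki : L1I a k.
  apply/integrableP; split; first exact/measurable_EFinP.
  apply: le_lt_trans iw; rewrite le_eqVlt; apply/orP; left; apply/eqP.
  apply: ae_eq_integral => //.
  - by apply: measurableT_comp => //; exact/measurable_EFinP.
  - apply/measurable_EFinP; apply: measurable_funM.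
      by apply: measurable_funTS; apply: measurable_funB.
    by apply: measurable_funX; exact: measurableT_comp.
  - apply: ae_imp Hc => x Hx Ix; rewrite /= ger0_norm ?k0 // /k -(Hx Ix).
    have /mem_open_itv/andP[ax _] := Ix; have xa : x - a != 0 by rewrite gt_eqF // subr_gt0.
    by congr EFin; rewrite real_normK ?num_real //; field.
(* Otherwise c^2 / (x - a) <= 2 (P f + c)^2 / (x - a) + 2 (P f)^2 / (x - a), where the last
   term is bounded. *)
have c0 : c = 0.
  apply: contrapT => /eqP c0; apply: inv_not_L1I.
  have c2 : 0 < c ^+ 2 by rewrite lt_neqAle eq_sym expf_neq0 // sqr_ge0.
  apply: (@L1I_le _ _ _ (fun x => 2 / c ^+ 2 * (k x + ipL a f f))) => //.
    by apply: L1I_Z; apply: L1I_D => //; exact: L1I_cst.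
  move=> x Ix; have /mem_open_itv/andP[ax x1] := Ix; have xa : 0 < x - a by rewrite subr_gt0.
  rewrite ger0_norm ?invr_ge0 ?(ltW xa) //.
  have B := prim_abs_L2 a1 fL (ltW ax) (ltW x1).
  have {}B : prim a f x ^+ 2 <= ipL a f f * (x - a).
    rewrite -real_normK ?num_real // -[ipL a f f]sqr_sqrtr ?ipL_ge0 //.
    rewrite -{1}(sqr_sqrtr (ltW xa)) -exprMn lerXn2r ?nnegrE ?mulr_ge0 ?sqrtr_ge0 //.
  rewrite -(ler_pM2r (mulr_gt0 c2 xa)).
  have -> : (x - a)^-1 * (c ^+ 2 * (x - a)) = c ^+ 2 by field; rewrite gt_eqF.
  have -> : 2 / c ^+ 2 * (k x + ipL a f f) * (c ^+ 2 * (x - a)) =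
      2 * ((prim a f x + c) ^+ 2 + ipL a f f * (x - a)).
    by rewrite /k; field; rewrite c0 gt_eqF.
  by have := sqr_ge0 (2 * prim a f x + c); move: B; nra.
have gq : {ae mu, forall x, I x -> g x = quot a f x}.
  apply: ae_imp Hc => x Hx Ix; have /mem_open_itv/andP[ax _] := Ix.
  have xa : x - a != 0 by rewrite gt_eqF // subr_gt0.
  by rewrite /quot -[prim a f x]addr0 -c0 -(Hx Ix) mulrC mulKf.
(* The constant of integration is fixed by the continuous version, which vanishes at 1. *)
have [c' Hc'] := weak_derivative_eq_prim ui qi wu gq.
have wp : w = (fun x => prim a (quot a f) x + c') %[ae leb a].
  apply/ae_leb; move/ae_leb: wu' => wu'.
  by apply: ae_imp (ae_and Hc' wu') => x [h1 h2] Ix _; rewrite (h2 Ix) // h1.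
have cp : {within `]a, 1], continuous (fun x => prim a (quot a f) x + c')}.
  have cp : {within `]a, 1], continuous (prim a (quot a f))}.
    by apply: continuous_subspaceW (prim_continuous a1 qi); exact: subset_itv_oc_cc.
  by move=> x; apply: cvgD; [exact: cp|exact: cvg_cst].
have := continuous_ae_eq a1 cw cp wp a1 (lexx 1); rewrite w1 => /esym/eqP.
rewrite addr_eq0 => /eqP E.
apply/ae_leb; apply: ae_imp Hc' => x Hx Ix _; rewrite (Hx Ix) /Kop E; ring.
Qed.
End OpA.

(** * The semigroup on classes and the boundary flux *)

Lemma right_lim0_ereal (R : realType) (F : R -> \bar R) (G : R -> R) :
  (forall t, 0 < t -> F t = (G t)%:E) -> (forall t, 0 <= G t) ->
  (F t @[t --> 0^'+] --> 0%E) <->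
  (forall e, 0 < e -> exists2 d, 0 < d & forall t, 0 < t -> t < d -> G t <= e).
Proof.
move=> FG G0; split.
- move=> /fine_cvgP[_ /cvgrPdist_le H] e e0; have [d d0 Hd] := H e e0.
  exists d => // t t0 td; have := Hd t.
  rewrite /ball_ /= sub0r normrN gtr0_norm // => /(_ td t0).
  by rewrite sub0r normrN FG //= ger0_norm.
- move=> H; apply/fine_cvgP; split.
    by near=> t; rewrite FG.
  apply/cvgrPdist_le => e e0; have [d d0 Hd] := H e e0; near=> t.
  rewrite sub0r normrN /= FG //= ger0_norm // Hd //.
  Unshelve. all: by end_near. Qed.

Lemma factr_neq0 (R : realType) k : (k`!%:R : R) != 0.
Proof. by rewrite pnatr_eq0 -lt0n fact_gt0. Qed.

Lemma natrS_neq0 (R : realType) k : 1 + k%:R != 0 :> R.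
Proof. by rewrite nat1r pnatr_eq0. Qed.

Section Interface.
Variables (R : realType) (a : R).
Hypothesis a1 : a < 1.
Local Notation mu := (@lebesgue_measure R).
Local Notation I := (`]a, 1[%classic : set R).
Local Notation V := (L2V a).
Local Notation ip := (ipL2 a).
Implicit Types (f g h u : R -> R).

Definition KV (v : V) : V := cls a (Kop a (rep v)).

Lemma KV_sym (x y : V) : ip (KV x) y = ip x (KV y).
Proof.
transitivity (ip (KV x) (cls a (rep y))); first by rewrite cls_rep.
transitivity (ip (cls a (rep x)) (KV y)); last by rewrite cls_rep.
rewrite /KV (ip_cls (Kop_L2 a1 (rep_L2 x)) (rep_L2 y)).
rewrite (ip_cls (rep_L2 x) (Kop_L2 a1 (rep_L2 y))).
exact: (Kop_sym a1 (rep_L2 x) (rep_L2 y)).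
Qed.

Lemma KV_cls f : f \in L2 a -> KV (cls a f) = cls a (Kop a f).
Proof.
move=> fL; apply: (ip_ext ip) => z; apply: etrans (KV_sym _ z) _.
transitivity (ip (cls a (Kop a f)) (cls a (rep z))); last by rewrite cls_rep.
rewrite /KV (ip_cls (Kop_L2 a1 fL) (rep_L2 z)) (ip_cls fL (Kop_L2 a1 (rep_L2 z))).
exact: (esym (Kop_sym a1 fL (rep_L2 z))).
Qed.

Section S.
Variable S : R -> (R -> R) -> (R -> R).
Hypothesis HS : semigroup_generated_by_A a S.

Definition SV (t : R) (v : V) : V := cls a (S t (rep v)).

Lemma S_L2 t f : 0 <= t -> f \in L2 a -> S t f \in L2 a.
Proof. by move=> t0 fL; case: HS => /(_ t f t0 fL) []. Qed.

Lemma S_contr t f : 0 <= t -> f \in L2 a ->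
  ipnorm ip (cls a (S t f)) <= ipnorm ip (cls a f).
Proof.
move=> t0 fL; case: HS => /(_ t f t0 fL) [SL +] _ _ _ _.
by rewrite (ipnorm_cls SL) (ipnorm_cls fL) lee_fin.
Qed.

Lemma S_lin t c f g : 0 <= t -> f \in L2 a -> g \in L2 a ->
  cls a (S t (fun x => c * f x + g x)) = c *: cls a (S t f) + cls a (S t g).
Proof.
move=> t0 fL gL; case: HS => _ /(_ t c f g t0 fL gL) H _ _ _.
have SfL := S_L2 t0 fL; have SgL := S_L2 t0 gL.
rewrite -(cls_lin c SfL SgL).
by apply/(cls_eq (S_L2 t0 (L2_lin c fL gL)) (L2_lin c SfL SgL)).
Qed.

Lemma SV_cls t f : 0 <= t -> f \in L2 a -> SV t (cls a f) = cls a (S t f).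
Proof.
move=> t0 fL; rewrite /SV; set g := rep _.
have gL : g \in L2 a by exact: rep_L2.
have gf : cls a g = cls a f by rewrite cls_rep.
apply/eqP; rewrite -subr_eq0; apply/eqP.
have -> : cls a (S t g) - cls a (S t f) = cls a (S t (fun x => -1 * f x + g x)).
  by rewrite (S_lin _ t0 fL gL) scaleN1r addrC.
apply: (@ipnorm_eq0 _ _ ip).
apply: le_trans (S_contr t0 (L2_lin _ fL gL)) _.
by rewrite (cls_lin _ fL gL) gf scaleN1r addNr ipnorm0.
Qed.

Lemma SV_quotient f g : f \in L2 a -> g \in L2 a ->
  (L2norm a (fun x => (S t f x - f x) / t - g x) @[t --> 0^'+] --> 0%E) <->
  right_lim0 ip (fun t => t^-1 *: (SV t (cls a f) - cls a f)) (cls a g).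
Proof.
move=> fL gL; apply: right_lim0_ereal => t; last exact: ipnorm_ge0.
move=> t0; have StL := S_L2 (ltW t0) fL.
have E : (fun x => (S t f x - f x) / t - g x) = (fun x => (t^-1 * (S t f x - f x)) - g x).
  by apply/funext => x; rewrite mulrC.
have dL := L2_Z a1 t^-1 (L2_B StL fL).
rewrite E (ipnorm_cls (L2_B dL gL)) (cls_B dL gL) (cls_Z _ (L2_B StL fL)) (cls_B StL fL).
by rewrite (SV_cls (ltW t0) fL).
Qed.

Lemma cls_N f : f \in L2 a -> cls a (fun x => - f x) = - cls a f.
Proof.
move=> fL; rewrite -scaleN1r -(cls_Z (-1) fL); congr cls.
by apply/funext => x; rewrite mulN1r.
Qed.

Lemma SV_continuous0 (x : V) : right_lim0 ip (fun t => SV t x) x.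
Proof.
have [_ _ _ SC _] := HS; have := SC _ (rep_L2 x).
apply: (proj1 (@right_lim0_ereal _ _ (fun t => ipnorm ip (SV t x - x)) _ _)) => t; last exact: ipnorm_ge0.
move=> t0; have SL := S_L2 (ltW t0) (rep_L2 x).
by rewrite (ipnorm_cls (L2_B SL (rep_L2 x))) (cls_B SL (rep_L2 x)) cls_rep.
Qed.

Lemma SV_generator (x y : V) :
  right_lim0 ip (fun t => t^-1 *: (SV t x - x)) y <-> x = - KV y.
Proof.
have [_ _ _ _ SG] := HS; have yL := rep_L2 y; have xL := rep_L2 x.
have kL := Kop_L2 a1 yL.
split.
  rewrite -{1 2}(cls_rep x) -{1}(cls_rep y).
  move=> /(SV_quotient xL yL) /(SG _ _ xL yL) /(opA_inv a1) [_ E].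
  by rewrite -[LHS]cls_rep /KV -(cls_N kL); apply/(cls_eq xL (L2_N a1 kL)).
move=> xy.
have nyL := L2_N a1 yL.
have nkL := Kop_L2 a1 nyL.
have -> : x = cls a (Kop a (fun s => - rep y s)).
  by rewrite xy -(KV_cls nyL) (cls_N yL) cls_rep (symN _ _ _ _ KV_sym).
rewrite -[X in right_lim0 _ _ X](cls_rep y); apply/(SV_quotient nkL yL)/(SG _ _ nkL yL).
have := opA_Kop a1 nyL; congr opA.
by apply/funext => s; rewrite opprK.
Qed.

Lemma SV_semigroup : is_semigroup R V ip KV SV.
Proof.
have [_ _ [S0 SD] _ _] := HS.
split.
- move=> t c x y t0; have xL := rep_L2 x; have yL := rep_L2 y.
  rewrite -{1}(cls_rep x) -{1}(cls_rep y) -(cls_lin _ xL yL).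
  by rewrite (SV_cls t0 (L2_lin _ xL yL)) (S_lin _ t0 xL yL).
- by move=> t x t0; rewrite -{2}(cls_rep x); exact: (S_contr t0 (rep_L2 x)).
- move=> x; rewrite -[RHS]cls_rep.
  apply/(cls_eq (S_L2 (lexx _) (rep_L2 x)) (rep_L2 x)); exact: (S0 _ (rep_L2 x)).
- move=> s t x s0 t0; have xL := rep_L2 x; have SL := S_L2 t0 xL.
  rewrite /SV -/(SV s _) (SV_cls s0 SL).
  apply/(cls_eq (S_L2 (addr_ge0 s0 t0) xL) (S_L2 s0 SL)).
  exact: (SD _ _ _ s0 t0 xL).
- exact: SV_continuous0.
- by move=> x y; split => /SV_generator.
Qed.
End S.

Lemma quot_cont1 h e : h \in L2 a -> 0 < e ->
  exists2 d, 0 < d & forall y, a < y -> y <= 1 -> 1 - d < y -> `|quot a h 1 - quot a h y| < e.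
Proof.
move=> hL e0.
have A1 : (`]a, 1]%classic : set R) 1 by rewrite /= in_itv /= a1 lexx.
have cq : {within `]a, 1], continuous (quot a h)}.
  have cp : {within `]a, 1], continuous (prim a h)}.
    by apply: continuous_subspaceW (prim_continuous a1 (L2_L1 a1 hL)); exact: subset_itv_oc_cc.
  have ci : {within `]a, 1], continuous (fun x => (x - a)^-1)}.
    apply: continuous_in_subspaceT => x; rewrite inE /= in_itv /= => /andP[ax _].
    apply: cvgV; first by rewrite gt_eqF // subr_gt0.
    by apply: cvgB; [exact: cvg_id|exact: cvg_cst].
  by move=> x; apply: cvgM; [exact: cp|exact: ci].
have [d d0 Hd] := within_cont_ball cq A1 e0.
exists d => // y ay y1 dy; apply: Hd; first by rewrite /= in_itv /= ay.
by rewrite ger0_norm ?subr_ge0 // ltrBlDr -ltrBlDl.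
Qed.

(** By the fundamental theorem at 1: K h has derivative - P h / (x - a) there, which
is continuous up to 1. *)
Lemma flux f w h : h \in L2 a -> f = Kop a h %[ae leb a] -> continuous_version a f w ->
  left_derivative w 1 = - (prim a h 1 / (1 - a)).
Proof.
move=> hL fK [cw wf].
have qi := L1I_quot a1 hL.
have wK : w = Kop a h %[ae leb a].
  apply/ae_leb; move/ae_leb: fK => fK; move/ae_leb: wf => wf.
  by apply: ae_imp (ae_and wf fK) => x [h1 h2] Ix _; rewrite h1 // h2.
have E := continuous_ae_eq a1 cw (Kop_continuous a1 hL) wK.
apply/cvg_lim => //; apply/cvgrPdist_le => e e0.
have [d d0 Hd] := quot_cont1 hL e0.
near=> k.
have k0 : k < 0 by near: k; exact: nbhs_left_lt.
have kd : - d < k by near: k; apply: nbhs_left_gt; rewrite oppr_lt0.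
have ka : a - 1 < k by near: k; apply: nbhs_left_gt; rewrite subr_lt0.
have ak : a < 1 + k by rewrite -ltrBlDl.
have k1 : 1 + k <= 1 by rewrite gerDl ltW.
rewrite !E // Kop1 subr0 /Kop -prim_tail //.
have -> : prim a h 1 / (1 - a) = quot a h 1 by [].
have ci : L1I a (fun x => if 1 + k < x then quot a h 1 else 0).
  apply: (@L1I_le _ _ _ (fun x => `|quot a h 1|)) => //.
  - by apply: measurable_fun_if => //; apply: measurable_fun_ltr.
  - exact: L1I_cst.
  - by move=> x _; case: ifPn => // _; rewrite normr0.
have qti : L1I a (fun x => if 1 + k < x then quot a h x else 0).
  apply: (@L1I_le _ _ _ (fun y => `|quot a h y|)).
  - apply: measurable_fun_if => //; first by apply: measurable_fun_ltr.
    by apply: measurable_funS (L1I_meas qi) => //; exact: subIsetl.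
  - exact: L1I_norm.
  - by move=> x _; case: ifPn => // _; rewrite normr0.
have eq1 : quot a h 1 = (- k)^-1 * \int[mu]_(x in I) (if 1 + k < x then quot a h 1 else 0).
  rewrite (prim_tail _ (L1I_cst a1 _)) !prim_cst ?(ltW a1) ?(ltW ak) //.
  by field; rewrite lt_eqF.
rewrite {1}eq1.
set A := \int[mu]_(x in I) _; set B := \int[mu]_(x in I) _.
have -> : - ((- k)^-1 * A) - B / k = (- k)^-1 * (B - A) by field; rewrite lt_eqF.
rewrite normrM gtr0_norm ?invr_gt0 ?oppr_gt0 // ler_pdivrMl ?oppr_gt0 //.
rewrite /A /B -RintegralB //.
have -> : - k * e = \int[mu]_(x in I) (if 1 + k < x then e else 0).
  rewrite (prim_tail _ (L1I_cst a1 _)) !prim_cst ?(ltW a1) ?(ltW ak) //; ring.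
apply: le_trans (le_normr_Rintegral _ (L1I_B qti ci)) _ => //.
apply: le_Rintegral => //.
- exact/L1I_norm/L1I_B.
- apply: (@L1I_le _ _ _ (fun x => `|e|)) => //.
  + by apply: measurable_fun_if => //; apply: measurable_fun_ltr.
  + exact: L1I_cst.
  + by move=> x _; case: ifPn => // _; rewrite normr0.
move=> x /mem_open_itv/andP[ax x1]; case: ifPn => kx; last by rewrite subrr normr0.
by rewrite distrC ltW // Hd ?ltW //; rewrite (lt_trans _ kx) // ltrD2l.
Unshelve. all: by end_near. Qed.

(** Normalised so that A sends each of these functions to the preceding one. *)
Definition mono (k : nat) (x : R) : R := (x - a) ^+ k / (k`!%:R) ^+ 2.

Lemma is_derive_mono k x : is_derive x (1 : R) (mono k.+1) ((x - a) ^+ k / (k.+1%:R * (k`!%:R) ^+ 2)).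
Proof.
have d2 : is_derive x 1 (fun x : R => x - a) 1.
  have := is_deriveB (is_derive_id x (1 : R)) (is_derive_cst a x (1 : R)).
  by rewrite subr0.
have d3 := is_deriveZ ((k.+1`!%:R ^+ 2)^-1) (is_deriveX k.+1 d2).
have -> : mono k.+1 = (k.+1`!%:R ^- 2 \*: (fun x : R => x - a) ^+ k.+1).
  by apply/funext => y; rewrite /mono mulrC /= fctE.
apply: is_derive_eq d3 _; rewrite /= /GRing.scale /= factS natrM; field.
by rewrite factr_neq0 natrS_neq0.
Qed.

Lemma mono_L2 k : mono k \in L2 a.
Proof.
apply: (L2_bounded a1 (M := (1 - a) ^+ k / (k`!%:R) ^+ 2)).
  by apply: measurable_funM => //; apply: measurable_funX; apply: measurable_funB.
move=> x /mem_open_itv/andP[ax x1]; rewrite /mono ger0_norm; last first.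
  by rewrite divr_ge0 ?exprn_ge0 // subr_ge0 ltW.
rewrite ler_wpM2r ?invr_ge0 ?exprn_ge0 // lerXn2r ?nnegrE ?subr_ge0 ?(ltW ax) ?(ltW a1) //.
by rewrite lerD2r ltW.
Qed.

(** Integration by parts twice: A p_(k+1) = p_k with K = - A^(-1), the function
p_(k+1) violating only the boundary condition at 1. *)
Lemma Kop_mono h k : h \in L2 a ->
  ipL a (Kop a h) (mono k) = ipL a h (fun=> 1) * mono k.+1 1 - ipL a h (mono k.+1).
Proof.
move=> hL.
have dm j : derive1 (mono j.+1) = (fun x => (x - a) ^+ j / (j.+1%:R * (j`!%:R) ^+ 2)).
  by apply/funext => x; rewrite derive1E; have D := is_derive_mono j x; exact: derive_val.
have ddm j x : derivable (mono j.+1) x 1 by have [] := is_derive_mono j x.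
have cm j : continuous (derive1 (mono j.+1)).
  rewrite dm => x; apply: cvgM; last exact: cvg_cst.
  apply: (@continuous_comp R R R (fun x => x - a) (fun y => y ^+ j)); last exact: exprn_continuous.
  by apply: cvgB; [exact: cvg_id|exact: cvg_cst].
have m0 j : mono j.+1 a = 0 by rewrite /mono subrr expr0n mul0r.
have P1 x : I x -> prim a (derive1 (mono k.+1)) x = mono k.+1 x.
  by move=> /mem_open_itv/andP[ax x1]; rewrite prim_FTC ?(ltW ax) ?(ltW x1) // m0 subr0.
have P11 : prim a (derive1 (mono k.+1)) 1 = mono k.+1 1.
  by rewrite prim_FTC ?(ltW a1) // m0 subr0.
have P0 x : I x -> prim a (mono k) x = k.+1%:R * mono k.+1 x.
  move=> Ix; rewrite -P1 // dm /prim -RintegralZl //; last first.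
    apply: L1I_if; rewrite -dm; exact: L1I_continuous.
  apply: eq_Rintegral => y _; case: ifPn => // _; rewrite ?mulr0 // /mono.
  by field; rewrite factr_neq0 natrS_neq0.
rewrite Kop_form ?mono_L2 //.
have hi := L2_L1 a1 hL.
have -> : ipL a h (fun=> 1) = prim a h 1.
  by rewrite prim1; apply: eq_Rintegral => x _; rewrite mulr1.
rewrite -P11.
have -> : ipL a h (mono k.+1) = \int[mu]_(x in I) (h x * prim a (derive1 (mono k.+1)) x).
  by apply: eq_Rintegral => x; rewrite inE => Ix; rewrite P1.
rewrite -prim_fubini //; last exact: L1I_continuous.
apply: eq_Rintegral => x; rewrite inE => Ix; rewrite P0 // dm /quot /mono.
have /mem_open_itv/andP[ax _] := Ix; have xa : x - a != 0 by rewrite gt_eqF // subr_gt0.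
rewrite exprS factS natrM; field.
by rewrite xa factr_neq0 natrS_neq0.
Qed.

(** For positive times the solution is K h, h being minus its time derivative, so the
flux is a pairing of h with the constant function 1. *)
Lemma solution_evolution v (u : R -> R -> R) : v \in L2 a -> solution a v u ->
  exists2 S, semigroup_generated_by_A a S & 
  forall t, 0 < t -> exists h : V,
    [/\ SV S t (cls a v) = KV h,
        forall p, is_derive t (1 : R) (fun s => ip (SV S s (cls a v)) p) (- ip h p) &
        left_derivative (u t) 1 = - (ip h (cls a (fun=> 1)) / (1 - a))].
Proof.
move=> vL [S HS Hu]; exists S => // t t0.
have [h e d] := sg_derive _ _ _ _ KV_sym _ (SV_semigroup HS) _ (cls a v) (L2V_complete a1) t0.
exists h; split=> //.
have hL := rep_L2 h; have kL := Kop_L2 a1 hL; have SL := S_L2 HS (ltW t0) vL.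
have E : S t v = Kop a (rep h) %[ae leb a].
  by apply/(cls_eq SL kL); rewrite -(SV_cls HS (ltW t0) vL) e.
rewrite (flux hL E (Hu t t0)) -{2}(cls_rep h) (ip_cls hL (L2_cst a1 1)).
by rewrite prim1; congr (- (_ / _)); apply: eq_Rintegral => x _; rewrite mulr1.
Qed.
End Interface.

(** * Chains of derivatives *)

Section Chain.
Variable R : realType.
Implicit Types (F : nat -> R -> R) (l r t h c M C B : R).

Lemma mvt_open (f df : R -> R) l r s t : (forall x, l < x < r -> is_derive x 1 f (df x)) ->
  l < s -> s < t -> t < r -> exists2 x, l < x < r & f t - f s = df x * (t - s).
Proof.
move=> fd ls st tr.
have inlr x : s <= x <= t -> l < x < r.
  by move=> /andP[sx xt]; rewrite (lt_le_trans ls sx) (le_lt_trans xt tr).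
have [] := @MVT R f df s t st.
- by move=> x; rewrite in_itv /= => /andP[sx xt]; apply/fd/inlr; rewrite !ltW.
- apply: derivable_within_continuous => x; rewrite in_itv /= => /inlr /fd D.
  exact: ex_derive.
by move=> x; rewrite in_itv /= => /andP[sx xt] E; exists x => //; apply: inlr; rewrite !ltW.
Qed.

(** A k-fold difference with step h of F k equals c h^k exactly, because F k is a
k-fold primitive of c; it is at most 2^k times the supremum of F k. *)
Lemma chain_bound k : forall F l r h c M, 0 < h -> l + k%:R * h < r ->
  (forall t, l < t < r -> F 0%N t = c) ->
  (forall j t, l < t < r -> is_derive t 1 (F j.+1) (F j t)) ->
  (forall t, l < t < r -> `|F k t| <= M) -> `|c| * h ^+ k <= 2 ^+ k * M.
Proof.
elim: k => [|k IH] F l r h c M h0 lr F0 FD FM.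
  move: lr; rewrite mul0r addr0 => lr.
  have ml := midf_lt lr.
  have mi : l < (l + r) / 2 < r by rewrite !midf_lt.
  by rewrite !expr0 mulr1 mul1r -(F0 _ mi) FM.
have lrh : l < r - h.
  rewrite ltrBrDr; apply: le_lt_trans lr; rewrite lerD2l -[leLHS]mul1r ler_wpM2r ?(ltW h0) //.
  by rewrite ler1n.
have sh t : l < t < r - h -> (l < t + h < r) && (l < t < r).
  move=> /andP[lt tr]; rewrite lt -ltrBrDr tr /= ltr_wpDr ?(ltW h0) //=.
  by rewrite (lt_trans tr) // gtrBl.
rewrite exprS mulrA -{1}(gtr0_norm h0) -normrM [2 ^+ _]exprSr -mulrA.
(* The differences form a chain again, with one function less, bound 2 M and constant c h. *)
apply: (IH (fun j s => F j.+1 (s + h) - F j.+1 s) l (r - h)) => //.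
- by rewrite ltrBrDr; move: lr; rewrite -natr1 mulrDl mul1r addrA.
- move=> t /sh /andP[/andP[_ thr] /andP[lt tr]].
  have tth : t < t + h by rewrite ltrDl.
  have [x xi ->] := mvt_open (FD 0%N) lt tth thr.
  by rewrite F0 // addrC addKr.
- move=> j t /sh /andP[th tt].
  have D1 : is_derive (t + h) (1 : R) (F j.+2) (F j.+1 (t + h)) := FD j.+1 _ th.
  have D2 : is_derive t (1 : R) (fun s => s + h) 1.
    by have := is_deriveD (is_derive_id t (1 : R)) (is_derive_cst h t (1 : R)); rewrite addr0.
  have D3 := @is_derive1_comp _ (F j.+2) (fun s => s + h) t _ _ D1 D2.
  have D4 := is_deriveB D3 (FD j.+1 t tt).
  by move: D4; rewrite mulr1.
- move=> t /sh /andP[th tt]; apply: le_trans (ler_normB _ _) _.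
  by rewrite mulr2n mulrDl mul1r lerD // FM.
Qed.

Lemma leq_bin_exp2 n k : (k <= n)%N -> ('C(n, k) <= 2 ^ n)%N.
Proof.
move=> kn; rewrite -(addn1 1) Pascal (bigD1 (Ordinal (kn : (k < n.+1)%N))) //=.
by rewrite !exp1n !muln1 leq_addr.
Qed.

Lemma leq_exp_ffact n m : (n ^ m <= (n + m) ^_ m)%N.
Proof.
elim: m => [|m IH]; first by rewrite expn0 ffactn0.
by rewrite addnS ffactSS expnS leq_mul // leqW // leq_addr.
Qed.

(** From k^k <= (2k)! / k! = C(2k, k) k! and C(2k, k) <= 4^k. *)
Lemma powerV_fact k : (k%:R : R) ^+ k <= 4 ^+ k * k`!%:R.
Proof.
rewrite -natrX -[4 in leRHS]/(4%:R) -natrX -natrM ler_nat.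
apply: leq_trans (leq_exp_ffact k k) _; rewrite -bin_ffact leq_mul2r.
by rewrite addnn -mul2n -[4%N]/(2 ^ 2)%N -expnM leq_bin_exp2 ?orbT // mul2n -addnn leq_addr.
Qed.

Lemma exp_coeff_small (q : R) : q ^+ k / k`!%:R @[k --> \oo] --> (0 : R).
Proof. exact: (cvg_series_cvg_0 (is_cvg_series_exp_coeff q)). Qed.

(** Take differences with step h = (r - l) / (2k).  Then h^k is at least
((r - l) / 8)^k / k!, whereas the bound on F k decays like B^k / k!^2. *)
Lemma chain_zero0 F l r c C B : l < r -> 0 <= C -> 0 <= B ->
  (forall t, l < t < r -> F 0%N t = c) ->
  (forall j t, l < t < r -> is_derive t 1 (F j.+1) (F j t)) ->
  (forall k t, l < t < r -> `|F k t| <= C * B ^+ k / k`!%:R ^+ 2) -> c = 0.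
Proof.
move=> lr C0 B0 F0 FD FM.
pose q := 16 * B / (r - l).
have rl : 0 < r - l by rewrite subr_gt0.
have key k : `|c| <= C * (q ^+ k / k`!%:R).
  have [->|k0] := posnP k.
    rewrite expr0 fact0 invr1 !mulr1.
    have mi : l < (l + r) / 2 < r by rewrite !midf_lt.
    by have := FM 0%N _ mi; rewrite (F0 _ mi) fact0 expr0 expr1n invr1 !mulr1.
  have kR : (0 : R) < k%:R by rewrite ltr0n.
  pose h := (r - l) / (2 * k%:R).
  have h0 : 0 < h by rewrite divr_gt0 // mulr_gt0.
  have := @chain_bound k F l r h c (C * B ^+ k / k`!%:R ^+ 2) h0 _ F0 FD (FM k).
  have -> : l + k%:R * h = (l + r) / 2 by rewrite /h; field; rewrite gt_eqF.
  rewrite (midf_lt lr).2 => /(_ isT) H.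
  have f0 : (0 : R) < k`!%:R by rewrite ltr0n fact_gt0.
  have hk : 0 < h ^+ k by rewrite exprn_gt0.
  rewrite -(ler_pM2r hk); apply: le_trans H _.
  have := powerV_fact k; set P := _ ^+ k; set f := k`!%:R => Pf.
  have -> : 2 ^+ k * (C * B ^+ k / f ^+ 2) = C * (2 * B) ^+ k / f ^+ 2 by rewrite exprMn; ring.
  have P0 : 0 < P by rewrite exprn_gt0.
  have -> : C * (q ^+ k / f) * h ^+ k = C * (2 * B) ^+ k / f ^+ 2 * (4 ^+ k * f / P).
    rewrite /q /h /P; have -> : 16 = 2 * 2 * 4 :> R by ring.
    rewrite !(exprMn, exprVn); field.
    by rewrite !expf_neq0 ?gt_eqF.
  apply: ler_peMr; last by rewrite ler_pdivlMr // mul1r.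
  by rewrite divr_ge0 ?exprn_ge0 ?mulr_ge0 ?exprn_ge0 ?mulr_ge0 // ltW.
apply/eqP; rewrite -normr_le0.
have lim0 : C * (q ^+ k / k`!%:R) @[k --> \oo] --> (0 : R).
  by rewrite -[X in _ --> X](mulr0 C); apply: cvgM; [exact: cvg_cst|exact: exp_coeff_small].
rewrite -(cvg_lim _ lim0) //; apply: limr_ge; first by apply/cvg_ex; exists 0.
by near=> k; exact: key.
Unshelve. all: by end_near. Qed.

Lemma zero_derive_cst f l r : l < r -> (forall t, l < t < r -> is_derive t 1 f 0) ->
  exists c, forall t, l < t < r -> f t = c.
Proof.
move=> lr fd; exists (f ((l + r) / 2)) => t /andP[lt tr].
have [ml mr] := midf_lt lr.
have [tm|mt|->//] := ltgtP t ((l + r) / 2).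
  have [x _] := mvt_open (df := fun=> 0) fd lt tm mr.
  by rewrite mul0r => /eqP; rewrite subr_eq0 => /eqP.
have [x _] := mvt_open (df := fun=> 0) fd ml mt tr.
by rewrite mul0r => /eqP; rewrite subr_eq0 => /eqP.
Qed.

Lemma chain_zero F l r C B : l < r -> 0 <= C -> 0 <= B ->
  (forall t, l < t < r -> is_derive t 1 (F 0%N) 0) ->
  (forall j t, l < t < r -> is_derive t 1 (F j.+1) (F j t)) ->
  (forall k t, l < t < r -> `|F k t| <= C * B ^+ k / k`!%:R ^+ 2) ->
  forall k t, l < t < r -> F k t = 0.
Proof.
move=> lr C0 B0 F0 FD FM.
(* The chain starting at F n satisfies the same hypotheses, with C B^n instead of C. *)
have step n : (forall t, l < t < r -> is_derive t 1 (F n) 0) ->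
    forall t, l < t < r -> F n t = 0.
  move=> Fn; have [c Hc] := zero_derive_cst lr Fn.
  suff -> : 0 = c by [].
  apply/esym/(@chain_zero0 (fun j => F (n + j)%N) l r c (C * B ^+ n) B) => //.
  - by rewrite mulr_ge0 // exprn_ge0.
  - by move=> t; rewrite addn0; exact: Hc.
  - by move=> j t; rewrite addnS; exact: FD.
  move=> k t /(FM (n + k)%N) /le_trans; apply.
  rewrite exprD mulrA; apply: ler_wpM2l; first by rewrite !mulr_ge0 // exprn_ge0.
  rewrite lef_pV2 ?posrE ?exprn_gt0 ?ltr0n ?fact_gt0 //.
  by rewrite lerXn2r ?nnegrE ?ler0n // ler_nat leq_fact // leq_addl.
elim=> [|k IH] t tlr; first exact: step.
by apply: step => // s slr; rewrite -(IH s slr); exact: FD.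
Qed.
End Chain.

(** * Entire power series and convolution *)
Section Entire.
Variable R : realType.
Implicit Types (f g : nat -> R) (M c x : R).

(** These are coefficient sequences of entire functions of exponential type; the
estimates below are the ones for the exponential series. *)
Definition entire_bound M c f := forall k, `|f k| <= M * (c ^+ k / k`!%:R).

Definition convol f g k := \sum_(j < k.+1) f j * g (k - j)%N.

Lemma entire_M_ge0 M c f : entire_bound M c f -> 0 <= M.
Proof. by move=> /(_ 0%N); rewrite expr0 fact0 invr1 !mulr1; apply: le_trans. Qed.

Lemma exp_partial_le c n : 0 <= c -> \sum_(k < n) c ^+ k / k`!%:R <= expR c.
Proof.
move=> c0; rewrite -(big_mkord xpredT (fun k => c ^+ k / k`!%:R)).
apply: (nondecreasing_cvgn_le _ (is_cvg_series_exp_coeff c) n).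
by apply: nondecreasing_series => k _ _; rewrite divr_ge0 ?exprn_ge0.
Qed.

Lemma entire_cvg M c f : 0 <= c -> entire_bound M c f -> cvgn (series f).
Proof.
move=> c0 fM; apply: normed_cvg.
apply: (@series_le_cvg _ _ (fun k => M * (c ^+ k / k`!%:R))) => //.
- by move=> k; exact: normr_ge0.
- by move=> k; apply: le_trans (normr_ge0 _) (fM k).
by apply: is_cvg_seriesZ; exact: is_cvg_series_exp_coeff.
Qed.

Lemma fact_mul_le m k : (m`! * k`! <= (m + k)`!)%N.
Proof. by rewrite -(bin_fact (leq_addr k m)) addKn leq_pmull // bin_gt0 leq_addr. Qed.

Lemma entire_tail M c f m : 0 <= c -> entire_bound M c f ->
  `|limn (series f) - series f m| <= M * expR c * (c ^+ m / m`!%:R).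
Proof.
move=> c0 fM; have M0 := entire_M_ge0 fM.
have cv := entire_cvg c0 fM.
have cv' : `|series f n - series f m| @[n --> \oo] --> `|limn (series f) - series f m|.
  by apply: cvg_norm; apply: cvgB; [exact: cv|exact: cvg_cst].
rewrite -(cvg_lim _ cv') //; apply: limr_le; first by apply/cvg_ex; eexists; exact: cv'.
near=> n.
have mn : (m <= n)%N by near: n; exact: nbhs_infty_ge.
rewrite sub_series_geq // -{1}[m]add0n big_addn big_mkord.
apply: le_trans (ler_norm_sum _ _ _) _.
apply: (@le_trans _ _ (\sum_(k < n - m) M * (c ^+ m / m`!%:R) * (c ^+ k / k`!%:R))).
  apply: ler_sum => k _; apply: le_trans (fM _) _.
  rewrite -mulrA; apply: ler_wpM2l => //.
  rewrite mulrACA -exprD addnC -invfM; apply: ler_wpM2l; first exact: exprn_ge0.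
  by rewrite lef_pV2 ?posrE -?natrM ?ltr0n ?muln_gt0 ?fact_gt0 // ler_nat fact_mul_le.
rewrite -mulr_sumr [leRHS]mulrAC; apply: ler_wpM2l; last exact: exp_partial_le.
by rewrite mulr_ge0 // divr_ge0 // exprn_ge0.
Unshelve. all: by end_near. Qed.

Lemma entire_approx M c (F : R) f : 0 <= c ->
  (forall m, `|F - series f m| <= M * (c ^+ m / m`!%:R)) -> series f @ \oo --> F.
Proof.
move=> c0 H; apply/cvgrPdist_le => e e0.
have L : M * (c ^+ m / m`!%:R) @[m --> \oo] --> (0 : R).
  by rewrite -[X in _ --> X](mulr0 M); apply: cvgM; [exact: cvg_cst|exact: exp_coeff_small].
move/cvgrPdist_le : L => /(_ e e0) [N _ HN]; exists N => // m Nm.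
apply: le_trans (H m) _; have := HN m Nm; rewrite /= sub0r normrN.
exact/le_trans/ler_norm.
Qed.

Lemma binomial_exp_sum c n : \sum_(j < n.+1) c ^+ j / j`!%:R * (c ^+ (n - j) / (n - j)`!%:R)
   = (2 * c) ^+ n / n`!%:R.
Proof.
have f0 k : (k`!%:R : R) != 0 by rewrite pnatr_eq0 -lt0n fact_gt0.
rewrite mulr2n mulrDl !mul1r exprDn mulr_suml; apply: eq_bigr => j _.
have jn : (j <= n)%N by rewrite -ltnS.
rewrite -(bin_fact jn) !natrM -mulr_natr; field.
by rewrite !f0 pnatr_eq0 -lt0n bin_gt0 jn.
Qed.

Lemma series_convol f g n :
  series (convol f g) n = \sum_(j < n) f j * series g (n - j)%N.
Proof.
elim: n => [|n IH]; first by rewrite /series /= big_ord0 big_geq.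
rewrite seriesSr IH big_ord_recr /= subSnn.
have -> : series g 1 = g 0%N by rewrite /series /= big_nat1.
rewrite /convol big_ord_recr /= subnn addrA -big_split /=; congr (_ + _).
apply: eq_bigr => j _; rewrite -mulrDr; congr (_ * _).
by rewrite subSn 1?ltnW // seriesSr.
Qed.

(** The tail bound of the second series has the same shape as the terms of the
first, so the error of the truncated product is a term of the binomial formula,
(2c)^n / n!, which tends to 0. *)
Lemma entire_mul M c M' f g : 0 <= c -> entire_bound M c f -> entire_bound M' c g ->
  series (convol f g) @ \oo --> limn (series f) * limn (series g).
Proof.
move=> c0 fM gM; have M0 := entire_M_ge0 fM.
set G := limn (series g).
have M'0 := entire_M_ge0 gM.
have A n : series f n * G - series (convol f g) n =
    \sum_(j < n) f j * (G - series g (n - j)%N).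
  rewrite series_convol {1}/series /= big_mkord mulr_suml -sumrB.
  by apply: eq_bigr => j _; rewrite mulrBr.
have B n : `|series f n * G - series (convol f g) n| <=
    M * (M' * expR c) * ((2 * c) ^+ n / n`!%:R).
  rewrite A; apply: le_trans (ler_norm_sum _ _ _) _.
  rewrite -binomial_exp_sum big_ord_recr /= mulrDr ler_wpDr //.
    by rewrite !mulr_ge0 ?expR_ge0 ?exprn_ge0 ?invr_ge0.
  rewrite mulr_sumr; apply: ler_sum => j _; rewrite normrM [leRHS]mulrACA.
  by apply: ler_pM => //; exact: entire_tail.
have {}A n : `|limn (series f) * G - series (convol f g) n| <=
    (M * expR c * `|G| + M * (M' * expR c)) * ((2 * c) ^+ n / n`!%:R).
  rewrite -[X in `|X|](subrKA (series f n * G)) mulrDl; apply: le_trans (ler_normD _ _) _.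
  apply: lerD (B n); rewrite -mulrBl normrM mulrAC; apply: ler_wpM2r => //.
  apply: le_trans (entire_tail n c0 fM) _; apply: ler_wpM2l.
    by rewrite mulr_ge0 ?expR_ge0.
  apply: ler_wpM2r; first by rewrite invr_ge0.
  rewrite lerXn2r ?nnegrE ?mulr_ge0 //; by rewrite ler_peMl // ler1n.
apply: (entire_approx _ A); by rewrite mulr_ge0.
Qed.
Lemma convol_sym f g k : convol f g k = convol g f k.
Proof.
rewrite /convol (reindex_inj rev_ord_inj) /=; apply: eq_bigr => j _.
by rewrite subSS subKn 1?mulrC // -ltnS.
Qed.

(** Since sum_j 1 / (j! (k - j)!) = 2^k / k!, and a sum of squares of nonnegative
numbers is at most the square of their sum. *)
Lemma convol_bound M f g k : (forall j, `|f j| <= M / j`!%:R ^+ 2) ->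
  (forall j, `|g j| <= 1 / j`!%:R ^+ 2) -> `|convol f g k| <= M * 4 ^+ k / k`!%:R ^+ 2.
Proof.
move=> fM g1.
have M0 : 0 <= M by have := le_trans (normr_ge0 _) (fM 0%N); rewrite fact0 expr1n invr1 mulr1.
pose x (j : 'I_k.+1) : R := 1 ^+ j / j`!%:R * (1 ^+ (k - j) / (k - j)`!%:R).
have x0 j : 0 <= x j by rewrite /x !expr1n !mulr_ge0 ?invr_ge0.
have Sx := binomial_exp_sum 1 k; rewrite -/x mulr1 in Sx.
have xS j : x j <= 2 ^+ k / k`!%:R.
  by rewrite -Sx (bigD1 j) //= ler_wpDr // sumr_ge0.
have -> : M * 4 ^+ k / k`!%:R ^+ 2 = M * (2 ^+ k / k`!%:R * (2 ^+ k / k`!%:R)).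
  by rewrite -[4 in LHS]/(4%:R) (natrM _ 2 2) exprMn invfM; ring.
apply: le_trans (ler_norm_sum _ _ _) _.
rewrite -{2}Sx mulr_sumr mulr_sumr; apply: ler_sum => j _; rewrite normrM.
apply: (@le_trans _ _ (M * (x j * x j))).
  apply: le_trans (ler_pM _ _ (fM j) (g1 _)) _ => //.
  rewrite /x !expr1n !mul1r -mulrA; apply: ler_wpM2l => //.
  by rewrite mulrACA -!invfM -!expr2.
by apply: ler_wpM2l => //; apply: ler_wpM2r.
Qed.

Lemma convol_derive (m : nat -> R -> R) (dm d : nat -> R) (t : R) k :
  (forall j, is_derive t (1 : R) (m j) (dm j)) ->
  is_derive t (1 : R) (fun s => convol (m^~ s) d k) (convol dm d k).
Proof.
move=> D.
have -> : (fun s => convol (m^~ s) d k) = \sum_(j < k.+1) (d (k - j)%N \*: m j).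
  apply/funext => s; rewrite /convol fct_sumE; apply: eq_bigr => j _.
  by rewrite /= mulrC.
have -> : convol dm d k = \sum_(j < k.+1) (d (k - j)%N *: dm j).
  by apply: eq_bigr => j _; rewrite mulrC.
by apply: is_derive_sum => j; exact: is_deriveZ.
Qed.

Section Cross.
Variables (l r M : R) (m1 m2 : nat -> R -> R) (d1 d2 : nat -> R) (q : R -> R).
Definition shift_seq (m : nat -> R -> R) (t : R) k := if k is j.+1 then m j t else 0.
Hypothesis lr : l < r.
Hypothesis m1D : forall k t, l < t < r -> is_derive t 1 (m1 k) (shift_seq m1 t k + q t * d1 k).
Hypothesis m2D : forall k t, l < t < r -> is_derive t 1 (m2 k) (shift_seq m2 t k + q t * d2 k).
Hypothesis m1M : forall k t, l < t < r -> `|m1 k t| <= M / k`!%:R ^+ 2.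
Hypothesis m2M : forall k t, l < t < r -> `|m2 k t| <= M / k`!%:R ^+ 2.
Hypothesis d1M : forall k, `|d1 k| <= 1 / k`!%:R ^+ 2.
Hypothesis d2M : forall k, `|d2 k| <= 1 / k`!%:R ^+ 2.

Let e k t := convol (m1^~ t) d2 k - convol (m2^~ t) d1 k.

(** The common forcing q enters through d1 * d2 in the first convolution and through
d2 * d1 in the second one, and cancels. *)
Lemma cross_derive k t : l < t < r ->
  is_derive t 1 (e k) (shift_seq e t k).
Proof.
move=> tlr; apply: is_derive_eq.
  by apply: is_deriveB; apply: convol_derive => j; [exact: m1D|exact: m2D].
have S m d d' : convol (fun j => shift_seq m t j + q t * d j) d' k =
    shift_seq (fun k t => convol (m^~ t) d' k) t k + q t * convol d d' k.
  rewrite /convol mulr_sumr.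
  under eq_bigr do rewrite mulrDl -mulrA.
  rewrite big_split /=; congr (_ + _); rewrite big_ord_recl mul0r add0r.
  by case: k => [|k] /=; rewrite ?big_ord0.
rewrite !S (convol_sym d1); rewrite /e; case: k {S} => [|k] /=; ring.
Qed.

Lemma cross_zero k t : l < t < r -> convol (m1^~ t) d2 k = convol (m2^~ t) d1 k.
Proof.
move=> tlr; apply/eqP; rewrite -subr_eq0; apply/eqP.
have M0 : 0 <= M.
  by have := le_trans (normr_ge0 _) (m1M 0%N tlr); rewrite fact0 expr1n invr1 mulr1.
apply: (@chain_zero _ e l r (2 * M) 4) tlr => //; first by rewrite mulr_ge0.
- by move=> s slr; exact: (cross_derive 0 slr).
- by move=> j s slr; exact: (cross_derive j.+1 slr).
move=> {}k s slr; apply: le_trans (ler_normB _ _) _.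
rewrite -!mulrA mulr2n mulrDl mul1r !mulrA; apply: lerD; apply: convol_bound => // j; [exact: m1M|exact: m2M].
Qed.
End Cross.
End Entire.

(** * The substitution x = a + k s^2 *)

Import HBNNSimple.

Section Density.
Context (R : realType) (c : R).
Local Notation mu := (@lebesgue_measure R).

(** The absolute value of the derivative of s |-> a + k s |s|, for c = 2 k. *)
Definition absd (s : R) : R := `|c * s|.

Lemma measurable_absd D : measurable D -> measurable_fun D absd.
Proof. by move=> mD; apply: measurableT_comp => //; apply: measurable_funM. Qed.

Lemma absd_ge0 s : 0 <= absd s. Proof. exact: normr_ge0. Qed.

Definition absd_measure : set (measurableTypeR R) -> \bar R :=
  fun E => (\int[mu]_(s in E) (absd s)%:E)%E.

Let absd0 : absd_measure set0 = 0%E.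
Proof. by rewrite /absd_measure integral_set0. Qed.

Let absd_measure_ge0 E : (0 <= absd_measure E)%E.
Proof. by apply: integral_ge0 => x _; rewrite lee_fin absd_ge0. Qed.

Let absd_sigma_additive : semi_sigma_additive absd_measure.
Proof.
move=> /= F mF tF mUF; rewrite /absd_measure; apply: cvg_toP.
  apply: ereal_nondecreasing_is_cvgn => m n mn.
  by apply: lee_sum_nneg_natr => // k _ _; exact: absd_measure_ge0.
rewrite ge0_integral_bigcup //=.
- by apply: measurableT_comp => //; exact: measurable_absd.
- by move=> x _; rewrite lee_fin absd_ge0.
Qed.

HB.instance Definition _ := isMeasure.Build _ _ _
  absd_measure absd0 absd_measure_ge0 absd_sigma_additive.

Lemma integral_absd_nnsfun (f : {nnsfun (measurableTypeR R) >-> R}) :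
  (\int[absd_measure]_x (f x)%:E = \int[mu]_x ((f x)%:E * (absd x)%:E))%E.
Proof.
have mw : measurable_fun setT (EFin \o absd).
  by apply: measurableT_comp => //; exact: measurable_absd.
under eq_integral do rewrite fimfunE -fsumEFin//.
rewrite ge0_integral_fsum//; last 2 first.
  - by move=> r; exact/measurable_EFinP/measurableT_comp.
  - by move=> n x _; rewrite EFinM nnfun_muleindic_ge0.
under [RHS]eq_integral.
  move=> x xD; rewrite fimfunE -fsumEFin// ge0_mule_fsuml; last first.
    by move=> r; rewrite EFinM nnfun_muleindic_ge0.
  over.
rewrite [RHS]ge0_integral_fsum//; last 2 first.
  - move=> r; apply: emeasurable_funM => //.
    by apply/measurable_EFinP; apply/measurableT_comp.
  - move=> n x _; rewrite mule_ge0//; last by rewrite lee_fin absd_ge0.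
    by rewrite EFinM nnfun_muleindic_ge0.
apply: eq_fsbigr => r /set_mem [x _ fxr].
have r0 : 0 <= r by rewrite -fxr.
have mA : measurable (f @^-1` [set r]) by apply: measurable_funPTI; exact: measurable_set1.
rewrite integralZl_indic_nnsfun//= integral_indic//= setIT.
transitivity (\int[mu]_x (r%:E * ((absd \_ (f @^-1` [set r])) x)%:E))%E.
  rewrite ge0_integralZl//.
  - congr (_ * _)%E; rewrite /absd_measure [LHS]integral_mkcond; apply: eq_integral => y _.
    by rewrite restrict_EFin.
  - by apply/measurable_EFinP; apply/(measurable_restrictT _ mA); exact: measurable_absd.
  - by move=> y _; rewrite lee_fin patchE; case: ifP => // _; exact: absd_ge0.
apply: eq_integral => y _; rewrite patchE indicE -!EFinM.
by case: ifP => _; rewrite ?mulr1 // !(mulr0, mul0r).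
Qed.

Lemma integral_absd (f : measurableTypeR R -> \bar R) :
  measurable_fun setT f -> (forall x, 0 <= f x)%E ->
  (\int[absd_measure]_x f x = \int[mu]_x (f x * (absd x)%:E))%E.
Proof.
move=> mf f0.
have mw : measurable_fun setT (EFin \o absd).
  by apply: measurableT_comp => //; exact: measurable_absd.
pose f_ := nnsfun_approx measurableT mf.
transitivity (lim (\int[absd_measure]_x (f_ n x)%:E @[n --> \oo])%E).
  rewrite -monotone_convergence//=.
  - apply: eq_integral => ? /[!inE] xD; apply/esym/cvg_lim => //=.
    exact: cvg_nnsfun_approx.
  - by move=> n; exact/measurable_EFinP/measurable_funTS.
  - by move=> n ? _; rewrite lee_fin.
  - by move=> ? _ ? ? mn; rewrite lee_fin; exact/lefP/nd_nnsfun_approx.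
under eq_fun do rewrite integral_absd_nnsfun.
rewrite -monotone_convergence//=.
- apply: eq_integral => x _; apply/cvg_lim => //.
  apply: cvgeMr => //; exact: cvg_nnsfun_approx.
- by move=> n; apply: emeasurable_funM => //; exact/measurable_EFinP.
- by move=> n x _; rewrite mule_ge0 ?lee_fin ?absd_ge0.
- move=> x _ m n mn; apply: lee_wpmul2r; first by rewrite lee_fin absd_ge0.
  by rewrite lee_fin; exact/lefP/nd_nnsfun_approx.
Qed.
End Density.

Section SquareSubst.
Context (R : realType) (a k : R).
Hypothesis k0 : 0 < k.
Local Notation mu := (@lebesgue_measure R).

(** The odd extension of s |-> a + k s^2 is an increasing bijection of the line, so
that measures on the line can be compared on all bounded intervals, without
boundary cases. *)
Definition sqmap (s : R) : R := a + k * (s * `|s|).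
Local Notation sqmapm := (sqmap : measurableTypeR R -> measurableTypeR R).
Definition sqinv (x : R) : R := Num.sg (x - a) * Num.sqrt (`|x - a| / k).

Lemma sqinvK x : sqmap (sqinv x) = x.
Proof.
rewrite /sqmap /sqinv normrM normr_sg (ger0_norm (sqrtr_ge0 _)).
have [E|xa] := eqVneq (x - a) 0.
  rewrite E sgr0 !mul0r mulr0 addr0.
  by apply/esym/eqP; rewrite -subr_eq0 E.
rewrite mul1r -mulrA -expr2 sqr_sqrtr ?divr_ge0 ?(ltW k0) //.
have -> : k * (Num.sg (x - a) * (`|x - a| / k)) = Num.sg (x - a) * `|x - a|.
  by field; rewrite gt_eqF.
by rewrite -numEsg addrC subrK.
Qed.

Lemma sqmap_mono : {mono sqmap : s t / s <= t}.
Proof.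
apply: le_mono => s t st; rewrite /sqmap ltrD2l ltr_pM2l //.
case: (leP 0 s) => s0.
  have t0 : 0 < t by exact: le_lt_trans st.
  by rewrite (ger0_norm s0) (gtr0_norm t0) -!expr2 ltrXn2r.
rewrite (ltr0_norm s0); case: (leP 0 t) => t0.
  rewrite (ger0_norm t0); apply: (@lt_le_trans _ _ 0); last by rewrite mulr_ge0.
  by rewrite nmulr_rlt0 // oppr_gt0.
rewrite (ltr0_norm t0) !mulrN ltrN2 -!expr2 -(sqrrN t) -(sqrrN s).
by rewrite ltrXn2r ?nnegrE ?oppr_ge0 ?ltW ?ltrN2.
Qed.

Lemma sq_quadratic (s h : R) : `|(h + s) * `|h + s| - s * `|s| - h * (2 * `|s|)| <= h ^+ 2.
Proof.
by case: (ger0P s) => s0; case: (ger0P (h + s)) => h0; rewrite ler_norml expr2; apply/andP; split; nra.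
Qed.

Lemma is_derive_sqmap s : is_derive s (1 : R) (sqmap : R -> R) (absd (2 * k) s).
Proof.
apply: (@is_derive_quadratic _ _ _ _ k) => h.
rewrite /sqmap /absd !normrM (gtr0_norm k0) (ger0_norm (ler0n _ 2)).
have -> : a + k * ((h + s) * `|h + s|) - (a + k * (s * `|s|)) - h * (2 * k * `|s|) =
  k * ((h + s) * `|h + s| - s * `|s| - h * (2 * `|s|)) by ring.
by rewrite normrM (gtr0_norm k0) ler_pM2l // sq_quadratic.
Qed.

Lemma continuous_sqmap : continuous (sqmap : R -> R).
Proof. by move=> s; apply/differentiable_continuous/derivable1_diffP; have [] := is_derive_sqmap s. Qed.

Lemma measurable_sqmap : measurable_fun setT sqmap.
Proof. exact: (continuous_measurable_fun continuous_sqmap). Qed.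

(** The image of the measure |2 k s| ds is Lebesgue measure: by the fundamental
theorem the two agree on intervals. *)
Lemma sqmap_lebesgue E : measurable E ->
  mu E = pushforward (absd_measure (2 * k)) sqmapm E.
Proof.
apply: (@lebesgue_measure_unique R (pushforward (absd_measure (2 * k)) sqmapm)).
  exact: measurable_sqmap.
move=> ? _ [[x y] /= _ <-].
rewrite /pushforward.
have -> : sqmap @^-1` `]x, y]%classic = `]sqinv x, sqinv y]%classic.
  have Es s : (x < sqmap s <= y) = (sqinv x < s <= sqinv y).
    by rewrite -{1}(sqinvK x) -{1}(sqinvK y) (leW_mono sqmap_mono) sqmap_mono.
  by apply/seteqP; split => s; rewrite /= !in_itv /= Es.
rewrite /absd_measure.
have [xy|yx] := ltP x y; last first.
  rewrite !set_itv_ge ?measure0 ?integral_set0 // bnd_simp -leNgt //.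
  by rewrite -sqmap_mono !sqinvK.
have sxy : sqinv x < sqinv y by rewrite -(leW_mono sqmap_mono) !sqinvK.
have cd : continuous (absd (2 * k)).
  by move=> s; apply: cvg_norm; apply: cvgM; [exact: cvg_cst|exact: cvg_id].
have md : measurable_fun `]sqinv x, sqinv y] (EFin \o absd (2 * k)).
  by apply: measurableT_comp => //; exact: measurable_absd.
rewrite integral_itv_obnd_cbnd //.
rewrite (@continuous_FTC2 R (absd (2 * k)) sqmap _ _ sxy).
- by rewrite !sqinvK lebesgue_measure_itv /= lte_fin xy.
- exact: continuous_subspaceT.
- split.
  + by move=> s _; have [] := is_derive_sqmap s.
  + exact/cvg_at_right_filter/continuous_sqmap.
  + exact/cvg_at_left_filter/continuous_sqmap.
- by move=> s _; rewrite derive1E; have D := is_derive_sqmap s; exact: derive_val.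
Qed.

Lemma ge0_integral_sqmap (f : R -> \bar R) : measurable_fun setT f -> (forall x, 0 <= f x)%E ->
  (\int[mu]_x f x = \int[mu]_s (f (sqmap s) * (absd (2 * k) s)%:E))%E.
Proof.
move=> mf f0.
have ms := measurable_sqmap.
have mfs : measurable_fun setT (f \o sqmap) by exact: measurableT_comp.
have := @integral_absd R (2 * k) (f \o sqmap) mfs (fun x => f0 _) => /= <-.
rewrite -(preimage_setT sqmapm) -(@ge0_integral_pushforward _ _ _ _ _ sqmapm measurable_sqmap _ setT f) //.
by apply: eq_measure_integral => E mE _; exact: sqmap_lebesgue.
Qed.
End SquareSubst.

Section RealSubst.
Variables (R : realType) (a j : R).
Hypotheses (a1 : a < 1) (j0 : 0 < j).
Local Notation mu := (@lebesgue_measure R).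
Let k := (1 - a) / j ^+ 2.
Let k0 : 0 < k. Proof. by rewrite divr_gt0 ?subr_gt0 ?exprn_gt0. Qed.

Lemma sqmap_itv s : (a < sqmap a k s < 1) = (0 < s < j).
Proof.
have E0 : sqmap a k 0 = a by rewrite /sqmap mul0r mulr0 addr0.
have E1 : sqmap a k j = 1.
  by rewrite /sqmap gtr0_norm // /k; field; rewrite gt_eqF.
have H := leW_mono (sqmap_mono a k0).
have -> : (a < sqmap a k s) = (0 < s) by rewrite -{1}E0 H.
by have -> : (sqmap a k s < 1) = (s < j) by rewrite -{1}E1 H.
Qed.

Lemma ge0_integral_square (f : R -> \bar R) : measurable_fun setT f -> (forall x, 0 <= f x)%E ->
  (\int[mu]_(x in `]a, 1%R[) f x =
   \int[mu]_(s in `]0%R, j[) (f (a + (1 - a) * (s ^+ 2 / j ^+ 2))%R * (2 * k * s)%:E))%E.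
Proof.
move=> mf f0; rewrite integral_mkcond (@ge0_integral_sqmap _ a _ k0); last first.
- by move=> x; rewrite patchE; case: ifP.
- by apply/(measurable_restrictT _ _).1 => //; exact: measurable_funS mf.
rewrite [RHS]integral_mkcond; apply: eq_integral => s _; rewrite !patchE.
have -> : (sqmap a k s \in `]a, 1[%classic) = (s \in `]0, j[%classic).
  by apply/idP/idP; rewrite !inE /= !in_itv /= sqmap_itv.
case: ifPn; last by rewrite mul0e.
rewrite inE /= in_itv /= => /andP[s0 sj]; congr (f _ * _%:E)%E.
  by rewrite /sqmap gtr0_norm // /k; field; rewrite gt_eqF.
by rewrite /absd ger0_norm //; apply: mulr_ge0 (ltW s0); rewrite mulr_ge0 // ltW.
Qed.

(** The two parts of g are transported separately, so that the identity holds for the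
extended integrals and both sides share the same convention when these diverge. *)
Lemma Rintegral_square (g : R -> R) : measurable_fun setT g ->
  \int[mu]_(x in `]a, 1[) g x =
  \int[mu]_(s in `]0, j[) (g (a + (1 - a) * (s ^+ 2 / j ^+ 2)) * (2 * k * s)).
Proof.
move=> mg; rewrite /Rintegral; congr fine.
have mE : measurable_fun setT (EFin \o g) by apply/measurable_EFinP.
rewrite integralE [RHS]integralE.
rewrite (ge0_integral_square (measurable_funepos mE)) //.
rewrite (ge0_integral_square (measurable_funeneg mE)) //.
have w0 s : `]0, j[%classic s -> 0 <= 2 * k * s.
  by rewrite /= in_itv /= => /andP[s0 _]; apply: mulr_ge0 (ltW s0); rewrite mulr_ge0 // ltW.
congr (_ - _)%E; apply: eq_integral => s; rewrite inE => /w0 ws.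
- by rewrite !funeposE /= maxe_pMl ?lee_fin // mul0e -EFinM.
- by rewrite !funenegE /= maxe_pMl ?lee_fin // mul0e -EFinM mulNr.
Qed.
End RealSubst.

(** * Continuous functions with vanishing moments *)

Section Moments.
Variables (R : realType) (a : R).
Hypothesis a1 : a < 1.
Local Notation mu := (@lebesgue_measure R).
Local Notation I := (`]a, 1[%classic : set R).
Implicit Types (f g w : R -> R).

Lemma ipL_sum w (c : nat -> R) (f : nat -> R -> R) n : w \in L2 a -> (forall i, f i \in L2 a) ->
  (fun x => \sum_(i < n) c i * f i x) \in L2 a /\
  ipL a w (fun x => \sum_(i < n) c i * f i x) = \sum_(i < n) c i * ipL a w (f i).
Proof.
move=> wL fL; elim: n => [|n [IL IE]].
  have -> : (fun x => \sum_(i < 0) c i * f i x) = (fun=> 0) by apply/funext => x; rewrite big_ord0.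
  split; first exact: L2_cst.
  rewrite big_ord0 /ipL.
  by rewrite (@eq_Rintegral _ _ _ _ _ (fun=> 0)) ?Rintegral_cst ?mul0r // => x _; rewrite mulr0.
have -> : (fun x => \sum_(i < n.+1) c i * f i x) =
    (fun x => c n * f n x + \sum_(i < n) c i * f i x).
  by apply/funext => x; rewrite big_ord_recr /= addrC.
split; first exact: (L2_lin (c n) (fL n) IL).
by rewrite ipLC (ipL_lin (c n) (fL n) IL wL) ipLC [X in _ + X]ipLC IE big_ord_recr /= addrC.
Qed.

Lemma Rintegral_window c d K : a <= c -> c <= d -> d <= 1 ->
  \int[mu]_(x in I) (if c < x then (if x < d then K else 0) else 0) = K * (d - c).
Proof.
move=> ac cd d1; have ad := le_trans ac cd; have c1 := le_trans cd d1.
rewrite (prim_tail _ (L1I_if d (L1I_cst a1 K))) prim1 -/(prim a (fun=> K) d).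
have -> : prim a (fun x => if x < d then K else 0) c = prim a (fun=> K) c.
  by apply: eq_Rintegral => x _; case: ifP => // xc; rewrite (lt_le_trans xc cd).
by rewrite !prim_cst //; ring.
Qed.

(** If w(c) is not 0, take the polynomial Q(x) = 1 + d^2 - (x - c)^2 for a small d.
It is at least 1 + 3 d^2 / 4 for |x - c| < d / 2, at least 1 for |x - c| < d, where
w keeps its sign, and between 0 and 1 elsewhere on (a, 1).  The integral of w Q^n
then grows at least linearly in n by the inequality of Bernoulli, although it is 0. *)
Lemma moments_zero w : w \in L2 a -> {within `]a, 1], continuous w} ->
  (forall k, ipL a w (mono a k) = 0) -> 0 <= a -> forall x, I x -> w x = 0.
Proof.
move=> wL cw w0 a0 c Ic; apply/eqP/negPn/negP => wc.
have [ac c1] := andP ((mem_open_itv a c).1 Ic).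
have wi := L2_L1 a1 wL.
pose e := `|w c| / 2.
have e0 : 0 < e by rewrite divr_gt0 // normr_gt0.
have Ac : (`]a, 1]%classic : set R) c by rewrite /= in_itv /= ac ltW.
have [d1 d10 Hd1] := within_cont_ball cw Ac e0.
pose d := Num.min d1 (Num.min (c - a) (1 - c)).
have d0 : 0 < d by rewrite /d !lt_min d10 !subr_gt0 ac.
have [dd1 dca d1c] : [/\ d <= d1, d <= c - a & d <= 1 - c].
  by rewrite /d !ge_min !lexx !orbT.
have near_c x : `|x - c| < d -> e <= Num.sg (w c) * w x.
  move=> xd; have : `|c - x| < d1 by rewrite distrC (lt_le_trans xd).
  move: xd; rewrite ltr_norml => /andP[x1 x2].
  have Ax : (`]a, 1]%classic : set R) x by rewrite /= in_itv /=; apply/andP; split; lra.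
  move=> /(Hd1 x Ax); rewrite /e; have := numEsg (w c).
  case: (ltgtP (w c) 0) wc => // wc _ _.
    by rewrite (ltr0_norm wc) (ltr0_sg wc) ltr_norml => /andP[]; lra.
  by rewrite (gtr0_norm wc) (gtr0_sg wc) ltr_norml => /andP[]; lra.
pose Q x := 1 + d ^+ 2 - (x - c) ^+ 2.
have wQ n : ipL a w (fun x => Q x ^+ n) = 0.
  pose p := ((1 + d ^+ 2)%:P - ('X - (c - a)%:P) ^+ 2) ^+ n.
  have EQ x : Q x ^+ n = \sum_(i < size p) (p`_i * i`!%:R ^+ 2) * mono a i x.
    have -> : Q x ^+ n = p.[x - a].
      by rewrite /p !hornerE /=; congr (_ ^+ _); rewrite /Q; ring.
    rewrite horner_coef; apply: eq_bigr => i _; rewrite /mono.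
    by field; exact: factr_neq0.
  have -> : (fun x => Q x ^+ n) = (fun x => \sum_(i < size p) (p`_i * i`!%:R ^+ 2) * mono a i x).
    exact/funext.
  rewrite (ipL_sum (fun i => p`_i * i`!%:R ^+ 2) _ wL (mono_L2 a1)).2.
  by rewrite big1 // => i _; rewrite w0 mulr0.
have cQ n : continuous (fun x => Q x ^+ n).
  move=> x; apply: (@continuous_comp R R R Q (fun y => y ^+ n)); last exact: exprn_continuous.
  apply: cvgB; first exact: cvg_cst.
  apply: (@continuous_comp R R R (fun x => x - c) (fun y => y ^+ 2)); last exact: exprn_continuous.
  by apply: cvgB; [exact: cvg_id|exact: cvg_cst].
pose al := 3 / 4 * d ^+ 2.
have al0 : 0 < al by rewrite mulr_gt0 ?exprn_gt0 // divr_gt0.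
have bern n : 1 + n%:R * al <= (1 + al) ^+ n.
  elim: n => [|n IH]; first by rewrite mul0r addr0 expr0.
  rewrite exprS -natr1; apply: (@le_trans _ _ ((1 + al) * (1 + n%:R * al))).
    have : 0 <= n%:R * al * al by rewrite !mulr_ge0 // ltW.
    lra.
  by rewrite ler_pM2l // addr_gt0.
set N1 := \int[mu]_(x in I) `|w x|.
have key n : e * (1 + n%:R * al) * d <= N1.
  pose K := e * (1 + n%:R * al).
  have K0 : 0 <= K by rewrite mulr_ge0 ?addr_ge0 ?mulr_ge0 // ltW.
  pose g x := if c - d / 2 < x then (if x < c + d / 2 then K else 0) else 0.
  have E : K * d = \int[mu]_(x in I) g x.
    by rewrite Rintegral_window; lra.
  have gi : L1I a g.
    apply: (@L1I_le _ _ _ (fun=> K)).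
    - apply: measurable_fun_if => //; first exact: measurable_fun_ltr.
      by apply: measurable_fun_if => //; exact: measurable_fun_ltr.
    - exact: L1I_cst.
    - by move=> x _; rewrite /g; case: ifP => _; [case: ifP => _|]; rewrite ?normr0 // ger0_norm.
  have wQi : L1I a (fun x => Num.sg (w c) * (w x * Q x ^+ n)).
    by apply: L1I_Z; exact: (L1I_mul_continuous a1 wi (cQ n)).
  have wn := L1I_norm wi.
  rewrite -/K E -[leRHS]add0r -(mulr0 (Num.sg (w c))) -(wQ n) /ipL -RintegralZl //; last first.
    exact: (L1I_mul_continuous a1 wi (cQ n)).
  rewrite -RintegralD //.
  suff pt (x : R) : I x -> g x <= Num.sg (w c) * (w x * Q x ^+ n) + `|w x|.
    by apply: le_Rintegral => //; exact: L1I_D.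
  move=> /mem_open_itv/andP[ax x1].
  have sgw : `|Num.sg (w c)| = 1 by rewrite normr_sg wc.
  have sqN M : `|x - c| <= M -> (x - c) ^+ 2 <= M ^+ 2.
    move=> xM; have M0 := le_trans (normr_ge0 _) xM.
    by rewrite -(real_normK (num_real (x - c))) lerXn2r ?nnegrE.
  have [xd|xd] := ltP `|x - c| d.
    have Q1 : 1 <= Q x by rewrite /Q; have := sqN d (ltW xd); lra.
    have h1 := near_c x xd.
    have h0 : 0 <= Num.sg (w c) * (w x * Q x ^+ n) - (if `|x - c| < d / 2 then K else 0).
      rewrite mulrA; case: ltP => xd2; rewrite ?subr0.
        rewrite subr_ge0; apply: ler_pM => //; first exact: ltW.
          by rewrite addr_ge0 // mulr_ge0 // ltW.
        apply: le_trans (bern n) _; apply: lerXn2r; rewrite ?nnegrE; try lra.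
        by rewrite /Q /al; have := sqN (d / 2) (ltW xd2); lra.
      by rewrite mulr_ge0 ?exprn_ge0 //; lra.
    have gE : g x = (if `|x - c| < d / 2 then K else 0).
      rewrite /g; have -> : (`|x - c| < d / 2) = (c - d / 2 < x) && (x < c + d / 2).
        by rewrite ltr_norml; congr (_ && _); apply/idP/idP; lra.
      by case: ifP => // _; case: ifP.
    have := normr_ge0 (w x); rewrite gE; lra.
  have -> : g x = 0.
    rewrite /g; case: ifP => // h1; case: ifP => // h2; exfalso.
    by move: xd; rewrite leNgt ltr_norml => /negP; apply; apply/andP; split; lra.
  have Q01 : 0 <= Q x <= 1.
    have : `|x - c| <= 1 by rewrite ler_norml; apply/andP; split; lra.
    move=> /sqN; rewrite /Q expr1n => h; have d2 := sqr_ge0 d.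
    have : d ^+ 2 <= (x - c) ^+ 2.
      by rewrite -(real_normK (num_real (x - c))) lerXn2r ?nnegrE ?(ltW d0).
    by move=> h2; apply/andP; split; lra.
  have : `|Num.sg (w c) * (w x * Q x ^+ n)| <= `|w x|.
    rewrite !normrM sgw mul1r; apply: ler_piMr => //.
    case/andP: Q01 => q0 q1; by rewrite normrX (ger0_norm q0) exprn_ile1.
  by rewrite ler_norml => /andP[h _]; lra.
have ead0 : 0 < e * al * d := mulr_gt0 (mulr_gt0 e0 al0) d0.
have N10 : 0 <= N1 by apply: Rintegral_ge0.
have := archi_boundP (divr_ge0 N10 (ltW ead0)).
rewrite ltr_pdivrMr //; set n := Num.Def.archi_bound _ => Hn.
have := key n; apply/negP; rewrite -ltNge; apply: lt_trans Hn _.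
have ed0 : 0 < e * d := mulr_gt0 e0 d0.
have -> : e * (1 + n%:R * al) * d = e * d + n%:R * (e * al * d) by ring.
by rewrite ltrDr.
Qed.
End Moments.

(** * Moments of a solution and the eigenfunction series *)

Lemma series_ord (R : realType) (f : nat -> R) n : series f n = \sum_(k < n) f k.
Proof. by rewrite /series /= big_mkord. Qed.

Lemma series_recl (R : realType) (f : nat -> R) n : series f n.+1 = f 0%N + series (f \o S) n.
Proof. by rewrite !series_ord big_ord_recl. Qed.

Lemma series_shift (R : realType) (s H : R) (A B M : nat -> R) n :
  (forall k, A k = H * M k.+1 - B k.+1) -> M 0%N = 1 -> B 0%N = H ->
  s * series (fun k => s ^+ k * A k) n =
  H * series (fun k => s ^+ k * M k) n.+1 - series (fun k => s ^+ k * B k) n.+1.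
Proof.
move=> AE M0 B0; rewrite !series_recl !series_ord !expr0 !mul1r M0 B0.
rewrite mulrDr mulr1 opprD addrACA subrr add0r !mulr_sumr -sumrB.
by apply: eq_bigr => k _; rewrite /= AE exprS; ring.
Qed.

Section Psi.
Variables (R : realType) (a : R).
Hypotheses (a0 : 0 < a) (a1 : a < 1).
Local Notation mu := (@lebesgue_measure R).
Local Notation I := (`]a, 1[%classic : set R).
Local Notation V := (L2V a).
Local Notation ip := (ipL2 a).
Implicit Types (s x t : R) (k n : nat).

(** The solution of A psi = s psi that is regular at a, normalised by psi(a) = 1. *)
Definition psi s x : R := limn (series (fun k => s ^+ k * mono a k x)).

Lemma psi_entire s x : entire_bound 1 (`|s| * `|x - a|) (fun k => s ^+ k * mono a k x).
Proof.
move=> k; rewrite mul1r /mono exprMn mulrA !normrM !normrX -!mulrA.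
rewrite ler_wpM2l ?exprn_ge0 // ler_wpM2l ?exprn_ge0 // normfV normrX ger0_norm //.
have f0 : (0 : R) < k`!%:R by rewrite ltr0n fact_gt0.
rewrite lef_pV2 ?posrE ?exprn_gt0 // expr2 ler_peMl ?(ltW f0) //.
by rewrite ler1n fact_gt0.
Qed.

Lemma psi_cvg s x : series (fun k => s ^+ k * mono a k x) @ \oo --> psi s x.
Proof. exact: (entire_cvg (mulr_ge0 (normr_ge0 _) (normr_ge0 _)) (psi_entire s x)). Qed.

Definition psi_partial s n x : R := \sum_(k < n) s ^+ k * mono a k x.

Lemma psi_partialE s n x : psi_partial s n x = series (fun k => s ^+ k * mono a k x) n.
Proof. by rewrite series_ord. Qed.

Lemma psi_partial_L2 s n : psi_partial s n \in L2 a.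
Proof. exact: (ipL_sum a1 (fun k => s ^+ k) n (L2_cst a1 0) (mono_L2 a1)).1. Qed.

Lemma measurable_psi s : measurable_fun setT (psi s).
Proof.
apply: (@measurable_fun_cvg _ _ _ _ (psi_partial s)).
  by move=> n; exact: L2_measurable (psi_partial_L2 s n).
move=> x _; under eq_fun do rewrite psi_partialE.
exact: psi_cvg.
Qed.

Lemma psi_tail s n x : a <= x -> x <= 1 ->
  `|psi s x - psi_partial s n x| <= expR `|s| * (`|s| ^+ n / n`!%:R).
Proof.
move=> ax x1; rewrite psi_partialE.
have H : entire_bound 1 `|s| (fun k => s ^+ k * mono a k x).
  move=> k; apply: le_trans (psi_entire s x k) _; rewrite !mul1r.
  rewrite ler_wpM2r ?invr_ge0 // lerXn2r ?nnegrE ?mulr_ge0 //.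
  rewrite ler_piMr // ger0_norm ?subr_ge0 //.
  by rewrite (le_trans _ x1) // gerBl ltW.
by have := entire_tail n (normr_ge0 s) H; rewrite mul1r.
Qed.

Lemma psi_L2 s : psi s \in L2 a.
Proof.
apply: (L2_bounded a1 (measurable_psi s) (M := expR `|s| * (`|s| ^+ 0 / 0`!%:R))).
move=> x /mem_open_itv/andP[ax x1]; have := psi_tail s 0 (ltW ax) (ltW x1).
by rewrite /psi_partial big_ord0 subr0.
Qed.

Lemma ipnorm_cls_le f M : f \in L2 a -> (forall x, I x -> `|f x| <= M) ->
  ipnorm ip (cls a f) <= M.
Proof.
move=> fL fM.
have M0 : 0 <= M.
  have mi : I ((a + 1) / 2) by apply/mem_open_itv; rewrite !midf_lt.
  exact: le_trans (normr_ge0 _) (fM _ mi).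
apply: ipnorm_le => //; rewrite (ip_cls fL fL).
apply: (@le_trans _ _ (\int[mu]_(x in I) M ^+ 2)).
  apply: le_Rintegral => //; [exact: (L2_mul fL fL)|exact: L1I_cst|].
  move=> x Ix; rewrite -expr2 -(real_normK (num_real (f x))) lerXn2r ?nnegrE //.
  exact: fM.
rewrite -(prim1 a (fun=> M ^+ 2)) prim_cst ?(ltW a1) // ler_piMr ?sqr_ge0 //.
by rewrite gerBl ltW.
Qed.

Lemma ip_rep (y : V) f : f \in L2 a -> ip y (cls a f) = ipL a (rep y) f.
Proof. by move=> fL; rewrite -(ip_cls (rep_L2 y) fL) cls_rep. Qed.

Lemma ip_psi (y : V) s :
  series (fun k => s ^+ k * ip y (cls a (mono a k))) @ \oo --> ip y (cls a (psi s)).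
Proof.
apply: (@entire_approx _ (ipnorm ip y * expR `|s|) `|s|) => // n.
have mL := mono_L2 a1; have yL := rep_L2 y.
have -> : series (fun k => s ^+ k * ip y (cls a (mono a k))) n = ip y (cls a (psi_partial s n)).
  rewrite series_ord (ip_rep y (psi_partial_L2 s n)).
  rewrite /psi_partial (ipL_sum a1 (fun k => s ^+ k) n yL mL).2.
  by apply: eq_bigr => k _; rewrite (ip_rep y (mL k)).
rewrite -ipBr -(cls_B (psi_L2 s) (psi_partial_L2 s n)).
apply: le_trans; first exact: cauchy_schwarz.
rewrite -mulrA.
apply: ler_wpM2l; first exact: ipnorm_ge0.
apply: ipnorm_cls_le; first exact: (L2_B (psi_L2 s) (psi_partial_L2 s n)).
by move=> x /mem_open_itv/andP[ax x1]; apply: psi_tail; exact: ltW.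
Qed.

Lemma psi_bessel s x z : s * (x - a) = - (z ^+ 2 / 4) -> psi s x = besselJ0 z.
Proof.
move=> E; rewrite /psi /besselJ0; congr (limn (series _)); apply/funext => k.
rewrite /mono mulrA -exprMn E.
have -> : - (z ^+ 2 / 4) = -1 * (z / 2) ^+ 2 by field.
by rewrite exprMn exprM; ring.
Qed.

Lemma mono0 : mono a 0 = fun=> 1.
Proof. by apply/funext => x; rewrite /mono expr0 fact0 expr1n divr1. Qed.

Lemma KV_mono (h : V) k : ip (KV h) (cls a (mono a k)) =
  ip h (cls a (mono a 0)) * mono a k.+1 1 - ip h (cls a (mono a k.+1)).
Proof.
have hL := rep_L2 h; have mL := mono_L2 a1.
rewrite /KV (ip_cls (Kop_L2 a1 hL) (mL k)) (Kop_mono a1 k hL).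
by rewrite mono0 (ip_rep h (L2_cst a1 1)) (ip_rep h (mL k.+1)).
Qed.

(** Apply K to the series term by term: A psi = s psi with psi(1) = 0 means
K psi = - psi / s. *)
Lemma KV_psi (h : V) s : psi s 1 = 0 -> s * ip (KV h) (cls a (psi s)) = - ip h (cls a (psi s)).
Proof.
move=> s1.
pose H := ip h (cls a (mono a 0)).
have c1 := @ip_psi (KV h) s; have c2 := @ip_psi h s; have c3 := @psi_cvg s 1.
rewrite s1 in c3.
have L1 : s * series (fun k => s ^+ k * ip (KV h) (cls a (mono a k))) n @[n --> \oo] -->
    s * ip (KV h) (cls a (psi s)).
  by apply: cvgM; [exact: cvg_cst|exact: c1].
have L2 : H * series (fun k => s ^+ k * mono a k 1) n.+1 -
   series (fun k => s ^+ k * ip h (cls a (mono a k))) n.+1 @[n --> \oo] -->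
     H * 0 - ip h (cls a (psi s)).
  apply: cvgB; last by rewrite -(cvg_shiftS (series _)) in c2.
  by apply: cvgM; [exact: cvg_cst|rewrite -(cvg_shiftS (series _)) in c3].
have E : (fun n => s * series (fun k => s ^+ k * ip (KV h) (cls a (mono a k))) n) =
    (fun n => H * series (fun k => s ^+ k * mono a k 1) n.+1 -
       series (fun k => s ^+ k * ip h (cls a (mono a k))) n.+1); last first.
  by rewrite E in L1; rewrite -[RHS]sub0r -(mulr0 H); exact: (cvg_unique _ L1 L2).
apply/funext => n.
apply: (@series_shift R s H (fun k => ip (KV h) (cls a (mono a k)))
  (fun k => ip h (cls a (mono a k))) (fun k => mono a k 1)) => //.
- by move=> k; exact: KV_mono.
- by rewrite mono0.
Qed.

Lemma mono_le k x : a <= x -> x <= 1 -> `|mono a k x| <= 1 / k`!%:R ^+ 2.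
Proof.
move=> ax x1; rewrite /mono normrM normfV normrX; apply: ler_pM => //.
  rewrite exprn_ile1 // ger0_norm ?subr_ge0 //.
  by rewrite (le_trans _ x1) // gerBl ltW.
by rewrite ger0_norm ?exprn_ge0.
Qed.

Lemma moment_alg0 (A b : R) : b^-1 * - A = 0 + - (A / b) * 1.
Proof. ring. Qed.

Lemma moment_alg (A B M b : R) : b^-1 * - B = (A * M - B) / b + - (A / b) * M.
Proof. ring. Qed.

Section Solution.
Variables (v : R -> R) (u : R -> R -> R) (S : R -> (R -> R) -> (R -> R)).
Hypothesis vL : v \in L2 a.
Hypothesis HS : semigroup_generated_by_A a S.
Hypothesis evol : forall t, 0 < t -> exists h : V,
  [/\ SV S t (cls a v) = KV h,
     forall p, is_derive t (1 : R) (fun s => ip (SV S s (cls a v)) p) (- ip h p) &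
     left_derivative (u t) 1 = - (ip h (cls a (fun=> 1)) / (1 - a))].

Definition moment k t := ip (SV S t (cls a v)) (cls a (mono a k)) / (1 - a).

(** The normalisation by 1 - a makes the coefficient of the flux equal to p_k(1). *)
Lemma moment_derive k t : 0 < t ->
  is_derive t (1 : R) (moment k)
    (shift_seq moment t k + left_derivative (u t) 1 * mono a k 1).
Proof.
move=> t0; have [h [E D q]] := evol t0.
have a10 : 1 - a != 0 by rewrite subr_eq0 gt_eqF.
have D1 := is_deriveZ (1 - a)^-1 (D (cls a (mono a k))).
have -> : moment k = (1 - a)^-1 \*: (fun s => ip (SV S s (cls a v)) (cls a (mono a k))).
  by apply/funext => s; rewrite /moment mulrC.
apply: is_derive_eq D1 _.
pose A := ip h (cls a (mono a 0)).
have E1 : ip h (cls a (fun=> 1)) = A by rewrite /A mono0.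
rewrite q E1; case: k => [|k].
  have -> : mono a 0 1 = 1 by rewrite mono0.
  exact: moment_alg0.
have -> : shift_seq moment t k.+1 =
    (A * mono a k.+1 1 - ip h (cls a (mono a k.+1))) / (1 - a).
  by rewrite -(KV_mono h k) -E.
exact: moment_alg.
Qed.

Lemma moment_le k t : 0 < t -> `|moment k t| <= ipnorm ip (cls a v) / (1 - a) / k`!%:R ^+ 2.
Proof.
move=> t0; have a10 : 0 < 1 - a by rewrite subr_gt0.
rewrite /moment normrM normfV (gtr0_norm a10) mulrAC; apply: ler_pM => //.
  by rewrite invr_ge0 ltW.
apply: le_trans; first exact: cauchy_schwarz.
apply: ler_pM; [exact: ipnorm_ge0|exact: ipnorm_ge0| |].
  by rewrite (SV_cls HS (ltW t0) vL); exact: (S_contr HS (ltW t0) vL).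
rewrite -[leRHS]mul1r; apply: (ipnorm_cls_le (mono_L2 a1 k)).
by move=> x /mem_open_itv/andP[ax x1]; apply: mono_le; exact: ltW.
Qed.

(** The pairing with an eigenfunction evolves by an exponential factor; so it
vanishes for all positive times, and, in the limit t -> 0, for the initial value. *)
Lemma psi_initial t s : 0 < t -> psi s 1 = 0 -> ip (SV S t (cls a v)) (cls a (psi s)) = 0 ->
  ip (cls a v) (cls a (psi s)) = 0.
Proof.
move=> t0 s1 Ft.
pose F r := ip (SV S r (cls a v)) (cls a (psi s)).
have FD (r : R) : 0 < r -> is_derive r (1 : R) F (s * F r).
  move=> r0; have [h [E D _]] := evol r0.
  by rewrite /F E KV_psi //; exact: D.
(* G is constant on (0, oo), so F vanishes there because it vanishes at t. *)
pose G r := F r * expR (- (s * r)).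
have GD (r : R) : 0 < r -> is_derive r (1 : R) G 0.
  move=> r0; have D1 := FD r r0.
  have D2 : is_derive r (1 : R) (fun r => - (s * r)) (- s).
    have := is_deriveN (is_deriveZ s (is_derive_id r (1 : R))).
    by rewrite /GRing.scale /= mulr1.
  have D3 := @is_derive1_comp _ expR (fun r => - (s * r)) r _ _ (is_derive_expR _) D2.
  apply: is_derive_eq (is_deriveM D1 D3) _.
  by rewrite /GRing.scale /=; ring.
have F0 r : 0 < r -> F r = 0.
  move=> r0; pose m := r + t + 1.
  have m0 : 0 < m by rewrite !addr_gt0.
  have rm : 0 < r < m by rewrite r0 /m; lra.
  have tm : 0 < t < m by rewrite t0 /m; lra.
  have [c Hc] := @zero_derive_cst R G 0 m m0 (fun x => fun xm => GD x (andP xm).1).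
  have : G r = G t by rewrite !Hc.
  have {Ft}Ft : F t = 0 := Ft.
  rewrite /G Ft mul0r => /eqP; rewrite mulf_eq0 => /orP[/eqP ->|/eqP ez]; first by [].
  by exfalso; have := expR_gt0 (- (s * r)); rewrite ez ltxx.
apply/eqP; rewrite -normr_le0; apply: le0_eps => e e0.
have c0 := SV_continuous0 HS (cls a v).
pose N := ipnorm ip (cls a (psi s)) + 1.
have N0 : 0 < N by rewrite ltr_wpDl ?ipnorm_ge0.
(* F vanishes at arbitrarily small times, where the orbit is close to the initial value. *)
have [d d0 Hd] := c0 _ (divr_gt0 e0 N0).
have d2 : 0 < d / 2 by rewrite divr_gt0.
have dd : d / 2 < d by rewrite ltr_pdivrMr // ltr_pMr // ltr1n.
have H := Hd _ d2 dd.
have -> : ip (cls a v) (cls a (psi s)) = ip (cls a v - SV S (d / 2) (cls a v)) (cls a (psi s)).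
  by rewrite ipBl (F0 _ d2 : ip _ _ = 0) subr0.
apply: le_trans; first exact: cauchy_schwarz.
apply: (@le_trans _ _ (e / N * N)); last by rewrite mulfVK // gt_eqF.
apply: ler_pM; [exact: ipnorm_ge0|exact: ipnorm_ge0| |by rewrite /N lerDl].
by rewrite -ipnormN opprB.
Qed.

(** With s = - j^2 / (4 (1 - a)), the substitution x = a + (1 - a) z^2 / j^2 turns psi
into J_0(z). *)
Lemma U1_psi j : 0 < j -> psi (- (j ^+ 2 / (4 * (1 - a)))) 1 = 0 -> U1 j a v != 0 ->
  ip (cls a v) (cls a (psi (- (j ^+ 2 / (4 * (1 - a)))))) != 0.
Proof.
set s := - _ => j0 s1; apply: contra => /eqP H; apply/eqP.
have a10 : 1 - a != 0 by rewrite subr_eq0 gt_eqF.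
have j2 : j != 0 by rewrite gt_eqF.
move: H; rewrite (ip_cls vL (psi_L2 s)) /ipL => H.
pose c := j ^+ 2 / (2 * (1 - a)).
have mv := L2_measurable vL.
have mg : measurable_fun setT (fun x => c * (v x * psi s x)).
  by apply: measurable_funM => //; apply: measurable_funM => //; exact: measurable_psi.
have := Rintegral_square a1 j0 mg.
rewrite (RintegralZl _ _ (L2_mul vL (psi_L2 s))) // H mulr0 => E.
rewrite /U1 [RHS]E; apply: eq_Rintegral => x _.
rewrite (@psi_bessel s _ x); last by rewrite /s; field; rewrite a10 j2.
by rewrite /c; field; rewrite a10 j2.
Qed.
End Solution.
End Psi.

(** * Comparison of the two solutions *)

Lemma convol_scale (R : realType) (s : R) f g k :
  convol (fun j => s ^+ j * f j) (fun j => s ^+ j * g j) k = s ^+ k * convol f g k.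
Proof.
rewrite /convol mulr_sumr; apply: eq_bigr => j _.
have jk : (j <= k)%N by rewrite -ltnS.
by rewrite mulrACA -exprD subnKC.
Qed.

Lemma convol_inj (R : realType) (f g d : nat -> R) : d 0%N = 1 ->
  (forall k, convol f d k = convol g d k) -> f =1 g.
Proof.
move=> d0 H k; elim/ltn_ind: k => k IH; have := H k.
rewrite /convol !big_ord_recr /= subnn d0 !mulr1.
by under eq_bigr => j _ do rewrite IH //; move/addrI.
Qed.

Lemma entire_of_square (R : realType) (M s : R) m : (forall k, `|m k| <= M / k`!%:R ^+ 2) ->
  entire_bound M `|s| (fun k => s ^+ k * m k).
Proof.
move=> H k; have f1 : 1 <= k`!%:R :> R by rewrite ler1n fact_gt0.
have M0 : 0 <= M by have := le_trans (normr_ge0 _) (H 0%N); rewrite fact0 expr1n invr1 mulr1.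
rewrite normrM normrX mulrCA; apply: ler_wpM2l; first exact: exprn_ge0.
apply: le_trans (H k) _; apply: ler_wpM2l => //.
have f0 : (0 : R) < k`!%:R by exact: lt_le_trans f1.
by rewrite lef_pV2 ?posrE ?exprn_gt0 // expr2 ler_peMl // ltW.
Qed.

Lemma KV_moments (R : realType) (a : R) (a0 : 0 < a) (a1 : a < 1) (h : L2V a) :
  (forall k, ipL2 a (KV h) (cls a (mono a k)) = 0) -> KV h = 0.
Proof.
move=> H; have hL := rep_L2 h; have kL := Kop_L2 a1 hL.
have w0 : forall x, (`]a, 1[%classic : set R) x -> Kop a (rep h) x = 0.
  apply: (moments_zero a1 kL (Kop_continuous a1 hL)) (ltW a0) => k.
  by rewrite -(ip_cls kL (mono_L2 a1 k)); exact: H.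
apply: (@ipnorm_eq0 _ _ (ipL2 a)); apply: (ipnorm_cls_le a0 a1 kL) => x Ix.
by rewrite w0 // normr0.
Qed.

Section Comparison.
Variables (R : realType) (j1 : R).
Hypothesis j1_zero : smallest_positive_zero (@besselJ0 R) j1.

(** Evaluate the product identity N_1 D_2 = N_2 D_1 at the s for which the first
eigenfunction on (a, 1) is psi: there D_1 vanishes and N_1 does not. *)
Lemma zero_comparison (a b t : R) (v v' : R -> R) u S S' (a0 : 0 < a) (a1 : a < 1)
    (b0 : 0 < b) (b1 : b < 1) (t0 : 0 < t) :
  v \in L2 a -> v' \in L2 b ->
  semigroup_generated_by_A a S -> semigroup_generated_by_A b S' ->
  (forall t, 0 < t -> exists h : L2V a,
  [/\ SV S t (cls a v) = KV h,
     forall p, is_derive t (1 : R) (fun s => ipL2 a (SV S s (cls a v)) p) (- ipL2 a h p) &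
     left_derivative (u t) 1 = - (ipL2 a h (cls a (fun=> 1)) / (1 - a))]) ->
  U1 j1 a v != 0 ->
  (forall k, convol (moment a v S ^~ t) (mono b ^~ 1) k = convol (moment b v' S' ^~ t) (mono a ^~ 1) k) ->
  b <= a.
Proof.
move=> vL v'L HS HS' evol U1v cross; have [j0 J0 jmin] := j1_zero.
have a10 : 0 < 1 - a by rewrite subr_gt0.
have b10 : 0 < 1 - b by rewrite subr_gt0.
pose s := - (j1 ^+ 2 / (4 * (1 - a))).
have sa : psi a s 1 = 0.
  by rewrite (@psi_bessel _ a s 1 j1) // /s; field; rewrite gt_eqF.
(* The value N_1(s) of the first generating function, up to the factor 1 - a. *)
have N0 : ipL2 a (SV S t (cls a v)) (cls a (psi a s)) != 0.
  apply/eqP => H; have := U1_psi a0 a1 vL j0 sa U1v.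
  by rewrite (psi_initial a0 a1 HS evol t0 sa H) eqxx.
have sb : psi b s 1 = 0.
  have m1 k := moment_le a0 a1 vL HS k t0.
  have m2 k := moment_le b0 b1 v'L HS' k t0.
  have d1 k : `|mono a k 1| <= 1 / k`!%:R ^+ 2 by apply: mono_le => //; exact: ltW.
  have d2 k : `|mono b k 1| <= 1 / k`!%:R ^+ 2 by apply: mono_le => //; exact: ltW.
  have L1 := entire_mul (normr_ge0 s) (entire_of_square s m1) (entire_of_square s d2).
  have L2 := entire_mul (normr_ge0 s) (entire_of_square s m2) (entire_of_square s d1).
  have E : convol (fun k => s ^+ k * moment a v S k t) (fun k => s ^+ k * mono b k 1) =
           convol (fun k => s ^+ k * moment b v' S' k t) (fun k => s ^+ k * mono a k 1).
    by apply/funext => k; rewrite !convol_scale; congr (_ * _); exact: cross.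
  rewrite E in L1.
  have : limn (series (fun k => s ^+ k * moment a v S k t)) * psi b s 1 =
      limn (series (fun k => s ^+ k * moment b v' S' k t)) * psi a s 1.
    exact: (cvg_unique _ L1 L2).
  rewrite sa mulr0 => /eqP; rewrite mulf_eq0 => /orP[|/eqP sb]; last exact: sb.
  have c1 := @ip_psi R a a0 a1 (SV S t (cls a v)) s.
  have c2 : series (fun k => s ^+ k * moment a v S k t) @ \oo -->
      ipL2 a (SV S t (cls a v)) (cls a (psi a s)) / (1 - a).
    have c3 : series (fun k => s ^+ k * ipL2 a (SV S t (cls a v)) (cls a (mono a k))) n / (1 - a) @[n --> \oo]
       --> ipL2 a (SV S t (cls a v)) (cls a (psi a s)) / (1 - a).
      by apply: cvgM; [exact: c1|exact: cvg_cst].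
    have E3 : series (fun k => s ^+ k * moment a v S k t) = (fun n => 
       series (fun k => s ^+ k * ipL2 a (SV S t (cls a v)) (cls a (mono a k))) n / (1 - a)).
      apply/funext => n; rewrite !series_ord mulr_suml; apply: eq_bigr => k _.
      by rewrite /moment mulrA.
    by rewrite E3.
  rewrite (cvg_lim _ c2) // mulf_eq0 (negPf N0) invr_eq0 => /eqP E0.
  by move: a10; rewrite E0 ltxx.
(* The point z at which D_2(s) = J_0(z). *)
pose r := (1 - b) / (1 - a); pose z := j1 * Num.sqrt r.
have r0 : 0 < r by rewrite divr_gt0.
have z0 : 0 < z by rewrite mulr_gt0 // sqrtr_gt0.
have Jz : besselJ0 z = 0.
  rewrite -sb (@psi_bessel _ b s 1 z) // /z exprMn sqr_sqrtr ?ltW // /s /r.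
  by field; rewrite gt_eqF.
have jz : j1 <= z.
  by rewrite leNgt; apply/negP => zj; have := jmin z z0 zj; rewrite Jz eqxx.
have r1 : 1 <= Num.sqrt r by move: jz; rewrite /z ler_pMr.
have : 1 <= r.
  rewrite -(sqr_sqrtr (ltW r0)) -[leLHS](expr1n _ 2) lerXn2r ?nnegrE ?sqrtr_ge0 //.
by rewrite /r ler_pdivlMr // mul1r lerD2l lerN2.
Qed.

End Comparison.

Theorem theorem6p1 (R : realType) (j1 a1 a2 t1 t2 : R)
    (u0 u0' : R -> R) (u u' : R -> R -> R)
    (j1_zero : smallest_positive_zero (@besselJ0 R) j1)
    (a1_gt0 : 0 < a1) (a1_lt1 : a1 < 1) (a2_gt0 : 0 < a2) (a2_lt1 : a2 < 1)
    (t1_gt0 : 0 < t1) (t1_lt_t2 : t1 < t2)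
    (u0_L2 : u0 \in L2 a1) (u0'_L2 : u0' \in L2 a2)
    (u_sol : solution a1 u0 u) (u'_sol : solution a2 u0' u')
    (U1_neq0 : U1 j1 a1 u0 != 0) (U1'_neq0 : U1 j1 a2 u0' != 0)
    (flux_eq : forall t, t1 < t -> t < t2 ->
       left_derivative (u t) 1 = left_derivative (u' t) 1) :
  a1 = a2 /\ u0 = u0' %[ae leb a1].
Proof.
have [S HS E] := solution_evolution a1_lt1 u0_L2 u_sol.
have [S' HS' E'] := solution_evolution a2_lt1 u0'_L2 u'_sol.
pose M1 := ipnorm (ipL2 a1) (cls a1 u0) / (1 - a1).
pose M2 := ipnorm (ipL2 a2) (cls a2 u0') / (1 - a2).
have M10 : 0 <= M1 by rewrite divr_ge0 ?ipnorm_ge0 // subr_ge0 ltW.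
have M20 : 0 <= M2 by rewrite divr_ge0 ?ipnorm_ge0 // subr_ge0 ltW.
have pos t : t1 < t < t2 -> 0 < t by move=> /andP[tt _]; exact: lt_trans tt.
have cross k t : t1 < t < t2 ->
    convol (moment a1 u0 S ^~ t) (mono a2 ^~ 1) k = convol (moment a2 u0' S' ^~ t) (mono a1 ^~ 1) k.
  apply: (@cross_zero R t1 t2 (M1 + M2) (moment a1 u0 S) (moment a2 u0' S') (mono a1 ^~ 1) (mono a2 ^~ 1)
    (fun t => left_derivative (u t) 1) t1_lt_t2).
  - by move=> j s sI; exact: (moment_derive a1_lt1 E j (pos s sI)).
  - move=> j s sI; have /andP[s1 s2] := sI; rewrite (flux_eq s s1 s2).
    exact: (moment_derive a2_lt1 E' j (pos s sI)).
  - move=> j s sI; apply: le_trans (moment_le a1_gt0 a1_lt1 u0_L2 HS j (pos s sI)) _.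
    by apply: ler_wpM2r; rewrite ?invr_ge0 ?exprn_ge0 // -/M1 lerDl.
  - move=> j s sI; apply: le_trans (moment_le a2_gt0 a2_lt1 u0'_L2 HS' j (pos s sI)) _.
    by apply: ler_wpM2r; rewrite ?invr_ge0 ?exprn_ge0 // -/M2 lerDr.
  - by move=> j; apply: mono_le => //; exact: ltW.
  - by move=> j; apply: mono_le => //; exact: ltW.
(* One time suffices from here on. *)
pose t := (t1 + t2) / 2.
have tI : t1 < t < t2 by rewrite !midf_lt.
have t0 := pos t tI.
(* The statement is symmetric in the two solutions, so one comparison is used twice. *)
have a12 : a1 = a2.
  apply/eqP; rewrite eq_le; apply/andP; split.
    apply: (zero_comparison j1_zero a2_gt0 a2_lt1 a1_gt0 a1_lt1 t0 u0'_L2 u0_L2 HS' HS E' U1'_neq0).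
    by move=> k; rewrite cross.
  apply: (zero_comparison j1_zero a1_gt0 a1_lt1 a2_gt0 a2_lt1 t0 u0_L2 u0'_L2 HS HS' E U1_neq0).
  by move=> k; rewrite cross.
split=> //.
move: u0'_L2 HS' E' cross {U1'_neq0 u'_sol M2 M20 a2_gt0 a2_lt1}; rewrite -a12 => u0'_L2 HS' E' cross.
have ipm v S0 k : ipL2 a1 (SV S0 t (cls a1 v)) (cls a1 (mono a1 k)) = moment a1 v S0 k t * (1 - a1).
  by rewrite /moment mulfVK // subr_eq0 gt_eqF.
have mm k : moment a1 u0 S k t = moment a1 u0' S' k t.
  have m1 : mono a1 0 1 = 1 by rewrite mono0.
  exact: (@convol_inj R (moment a1 u0 S ^~ t) (moment a1 u0' S' ^~ t) (mono a1 ^~ 1) m1 (fun k => cross k t tI)).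
have [h [Eh _ _]] := E t t0; have [h' [Eh' _ _]] := E' t t0.
have Khh : KV (h - h') = 0.
  apply: KV_moments => // k; rewrite (symB _ _ _ _ (KV_sym a1_lt1)) ipBl -Eh -Eh' !ipm mm.
  by rewrite subrr.
have SS : SV S t (cls a1 u0) = SV S t (cls a1 u0').
  rewrite (sg_unique _ _ _ _ (KV_sym a1_lt1) _ _ (SV_semigroup a1_lt1 HS) (SV_semigroup a1_lt1 HS') t (cls a1 u0') (ltW t0)).
  rewrite Eh Eh'; apply/eqP; rewrite -subr_eq0 -(symB _ _ _ _ (KV_sym a1_lt1)); apply/eqP; exact: Khh.
apply/(cls_eq u0_L2 u0'_L2).
apply/eqP; rewrite -subr_eq0; apply/eqP.
have B := sgB _ _ _ _ _ (SV_semigroup a1_lt1 HS) t (cls a1 u0) (cls a1 u0') (ltW t0).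
rewrite SS subrr in B.
exact: (sg_backward _ _ _ _ (KV_sym a1_lt1) _ (SV_semigroup a1_lt1 HS) t _ t0 B).
Qed.
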